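(* Let $A\in\mathbb{R}^{n\times n}$ and $b\in\mathbb{R}^n$ be such that $(A,b)$ satisfies the Kalman rank condition, and let $S_t^*$ denote the forward evolution on $L^2(\mathbb{R}^n)$ of the Fokker–Planck equation $\partial_t\rho=-\operatorname{div}(Ax\,\rho)+\frac12(b\cdot\nabla)^2\rho$. For every unit vector $q\in\mathbb{R}^n$ and every $t>0$, $$\|(q\cdot\nabla)S_t^*\|_{L^2\to L^2}=e^{-1/2}\,e^{-t\operatorname{tr}(A)/2}\,\big(q^\top G_t(A,b)^{-1}q\big)^{1/2}.$$ Consequently, for every $k\in\{1,\ldots,n\}$, as $t\to0^+$, one has, along the moving principal directions, $$\|(\psi_k(t)\cdot\nabla)S_t^*\|_{L^2\to L^2}=\frac{e^{-1/2}}{\kappa_k^{1/2}d_k(A,b)}\,t^{-k+1/2}\Big(1-\frac{a_k+\operatorname{tr}A}{2}\,t+\mathrm{O}(t^2)\Big),$$ whereas in the fixed Krylov directions, with $Y_k=q_k\cdot\nabla$, $$\|Y_kS_t^*\|_{L^2\to L^2}=e^{-1/2}\,\frac{\big((\mathfrak{H}_n^{-1})_{kk}\big)^{1/2}}{d_k(A,b)}\,t^{-k+1/2}\,(1+\mathrm{O}(t)).$$ Here $\mathfrak{H}_n=\big(\tfrac{1}{(i-1)!(j-1)!(i+j-1)}\big)_{1\le i,j\le n}$, and the entry $(\mathfrak{H}_n^{-1})_{kk}$ is explicitly $$(\mathfrak{H}_n^{-1})_{kk}=\frac{((n+k-1)!)^2}{(2k-1)\,((n-k)!)^2\,((k-1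)!)^2}.$$
   Context: $\langle\cdot,\cdot\rangle$ is the Euclidean scalar product on $\mathbb{R}^n$ and $\|\cdot\|$ its norm; $\|\cdot\|_{L^2\to L^2}$ is the operator norm on $L^2(\mathbb{R}^n)$. The Kalman rank condition is $\operatorname{rank}(b,Ab,\ldots,A^{n-1}b)=n$. For $t>0$, $G_t(A,b)=\int_0^te^{sA}bb^\top e^{sA^\top}\,ds$ is the controllability Gramian, with eigenvalues ordered decreasingly $\lambda_1(t)\ge\cdots\ge\lambda_n(t)>0$. $S_t^*$ is the solution operator $\rho_0\mapsto\rho(t)$ of the Fokker–Planck equation of $dX_t=AX_t\,dt+b\,dW_t$ ($W$ a real Brownian motion): $S_t^*\rho_0$ is the convolution of $x\mapsto e^{-t\operatorname{tr}A}\rho_0(e^{-tA}x)$ with the centered Gaussian density of covariance $G_t(A,b)$. Krylov data: $\mathcal{K}_k(A,b)=\operatorname{span}(b,Ab,\ldots,A^{k-1}b)$, $\mathcal{K}_0(A,b)=\{0\}$. The orthonormal basis $(q_1,\ldots,q_n)$ is obtained by Gram–Schmidt from $b,Ab,\ldots,A^{n-1}b$, characterized by $q_k\in\mathcal{K}_k(A,b)$, $q_k\perp\mathcal{K}_{k-1}(A,b)$, $d_k(A,b):=\langle q_k,A^{k-1}b\rangle>0$. Set $a_k=\langle q_k,Aq_k\rangle$ and $\kappa_k=\frac{((k-1)!)^2}{(2k-1)!\,(2k-2)!}$ for $k\in\{1,\ldots,n\}$. For all sufficiently small $t>0$ the eigenvalues $\lambda_k(t)$ are simple and the eigenspace of $\lambda_k(t)$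 is not orthogonal to $q_k$; $\psi_k(t)$ denotes the unit eigenvector of $G_t(A,b)$ associated with $\lambda_k(t)$ and oriented by $\langle\psi_k(t),q_k\rangle>0$. *)

(* Defs.v *)
From HB Require Import structures.
From mathcomp Require Import all_boot all_order all_algebra.
From mathcomp Require Import all_classical all_reals all_analysis.

Set Implicit Arguments.
Unset Strict Implicit.
Unset Printing Implicit Defensive.

Import Order.TTheory GRing.Theory Num.Theory.
Import numFieldNormedType.Exports.

Local Open Scope classical_set_scope.
Local Open Scope ring_scope.

(* Points of R^n are column vectors ['cV[R]_n].  Indices of type ['I_n] start at
   0: [k : 'I_n] stands for [k.+1] in the usual 1-based numbering. *)

Section euclidean.
Context {R : realType} {n : nat}.
Implicit Types u v : 'cV[R]_n.

Definition dotp u v : R := (u^T *m v) 0 0.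

(* The library norm [`|v|] of a matrix is the sup norm, hence this one. *)
Definition enorm v : R := Num.sqrt (dotp v v).

End euclidean.

(* Matrices with measurable entries carry the sigma-algebra generated by the
   entries; on ['cV[R]_n] this is the Borel sigma-algebra of R^n. *)
Definition matrix_display : measure_display -> measure_display.
Proof. exact. Qed.

Section measurable_matrix.
Context {d} {T : measurableType d} (m n : nat).

Definition matrix_entries_preimages : set (set 'M[T]_(m, n)) :=
  [set (fun M : 'M[T]_(m, n) => M ij.1 ij.2) @^-1` B
     | ij in [set: 'I_m * 'I_n] & B in (measurable : set (set T))].

Let mx_set0 : <<s matrix_entries_preimages >> set0.
Proof. exact: sigma_algebra0. Qed.

Let mx_setC B :
  <<s matrix_entries_preimages >> B -> <<s matrix_entries_preimages >> (~` B).
Proof. exact: sigma_algebraC. Qed.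

Let mx_bigcup (F : (set 'M[T]_(m, n))^nat) :
  (forall i, <<s matrix_entries_preimages >> (F i)) ->
  <<s matrix_entries_preimages >> (\bigcup_i (F i)).
Proof. exact: sigma_algebra_bigcup. Qed.

HB.instance Definition _ := @isMeasurable.Build (matrix_display d)
  'M[T]_(m, n) <<s matrix_entries_preimages >> mx_set0 mx_setC mx_bigcup.

End measurable_matrix.

Lemma measurable_mx_entry d (T : measurableType d) m n (i : 'I_m) (j : 'I_n) :
  measurable_fun [set: 'M[T]_(m, n)] (fun M => M i j).
Proof.
move=> _ B mB; rewrite setTI; apply: sub_sigma_algebra.
by exists (i, j) => //; exists B.
Qed.

Lemma measurable_fun_mx d d' (S : measurableType d') (T : measurableType d)
    m n (f : S -> 'M[T]_(m, n)) :
  (forall i j, measurable_fun setT (fun s => f s i j)) -> measurable_fun setT f.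
Proof.
move=> mf; apply: (@measurability _ _ _ _ _ _
  (@matrix_entries_preimages _ T m n)) => //.
move=> _ [_ [[i j] _ [B mB <-]] <-]; rewrite setTI -comp_preimage.
by have := mf i j measurableT _ mB; rewrite setTI.
Qed.

Lemma sigma_finite_product d1 d2 (T1 : measurableType d1)
    (T2 : measurableType d2) (R : realType)
    (m1 : {sigma_finite_measure set T1 -> \bar R})
    (m2 : {sigma_finite_measure set T2 -> \bar R}) :
  sigma_finite setT (m1 \x m2)%E.
Proof.
have /sigma_finiteP[F [TF ndF Foo]] := sigma_finiteT m1.
have /sigma_finiteP[G [TG ndG Goo]] := sigma_finiteT m2.
exists (fun n => F n `*` G n).
  rewrite -setXTT TF TG predeqE => -[x y]; split.
    move=> [/= [n _ Fnx] [k _ Gky]]; exists (maxn n k) => //; split.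
    - by move: x Fnx; exact/subsetPset/ndF/leq_maxl.
    - by move: y Gky; exact/subsetPset/ndG/leq_maxr.
  by move=> [n _ []/= ? ?]; split; exists n.
move=> k; have [? ?] := Foo k; have [? ?] := Goo k.
split; first exact: measurableX.
by rewrite product_measure1E// lte_mul_pinfty// ge0_fin_numE.
Qed.

Section lebesgue_cV.
Context {R : realType}.
Implicit Type n : nat.

Definition cV_cons n (p : measurableTypeR R * 'cV[R]_n) : 'cV[R]_n.+1 :=
  col_mx p.1%:M p.2.

Lemma measurable_cV_cons n : measurable_fun setT (@cV_cons n).
Proof.
apply: measurable_fun_mx => i j; rewrite /cV_cons /=.
rewrite (_ : (fun _ => _) = fun s : measurableTypeR R * 'cV[R]_n =>
  match fintype.split (i : 'I_(1 + n)) with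
  | inl _ => s.1 | inr k => s.2 k j end); last first.
  apply/funext => s; rewrite mxE; case: fintype.split => //= k.
  by rewrite mxE !ord1 eqxx mulr1n.
case: fintype.split => [_|k]; first exact: measurable_fst.
exact: (measurableT_comp (measurable_mx_entry k j) measurable_snd).
Qed.

Section cons_measure.
Context n (mu : {sigma_finite_measure set 'cV[R]_n -> \bar R}).

Definition lebesgue_cons : set 'cV[R]_n.+1 -> \bar R :=
  pushforward ((@lebesgue_measure R) \x mu)%E (@cV_cons n).

Let cons0 : lebesgue_cons set0 = 0%E.
Proof. by rewrite /lebesgue_cons /pushforward preimage_set0 measure0. Qed.

Let cons_ge0 B : (0 <= lebesgue_cons B)%E.
Proof. exact: (measure_ge0 ((@lebesgue_measure R) \x mu)%E). Qed.

Let preim_cons B : measurable B -> measurable (@cV_cons n @^-1` B).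
Proof. by move=> mB; rewrite -[X in measurable X]setTI; exact: measurable_cV_cons. Qed.

Let cons_sigma_additive : semi_sigma_additive lebesgue_cons.
Proof.
move=> F mF tF mUF; rewrite /lebesgue_cons /pushforward preimage_bigcup.
apply: (@measure_semi_sigma_additive _ _ _ ((@lebesgue_measure R) \x mu)%E).
- by move=> k; exact: preim_cons.
- apply/trivIsetP => i j _ _ ij; rewrite -preimage_setI.
  by move/trivIsetP : tF => /(_ _ _ _ _ ij) ->//; rewrite preimage_set0.
- by rewrite -preimage_bigcup; exact: preim_cons.
Qed.

HB.instance Definition _ := isMeasure.Build _ _ _ lebesgue_cons
  cons0 cons_ge0 cons_sigma_additive.

Let cons_sigma_finite : sigma_finite setT lebesgue_cons.
Proof.
have [F TF Foo] := sigma_finite_product (@lebesgue_measure R) mu.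
pose g (v : 'cV[R]_n.+1) : measurableTypeR R * 'cV[R]_n :=
  (v ord0 ord0, @dsubmx _ 1 n 1 v).
have gK : cancel (@cV_cons n) g.
  move=> [x v]; rewrite /g /cV_cons /=; congr pair; last exact: col_mxKd.
  have -> : ord0 = lshift n ord0 :> 'I_(1 + n) by apply/val_inj.
  by rewrite (@col_mxEu _ 1 n 1) mxE eqxx mulr1n.
have mg : measurable_fun setT g.
  apply: measurable_fun_pair; first exact: measurable_mx_entry.
  apply: measurable_fun_mx => i j; under eq_fun do rewrite mxE.
  exact: measurable_mx_entry.
exists (fun k => g @^-1` F k); first by rewrite -preimage_bigcup -TF preimage_setT.
move=> k; have [mF Fk] := Foo k; split.
  by rewrite -[X in measurable X]setTI; exact: mg.
rewrite /lebesgue_cons /pushforward -comp_preimage.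
by rewrite (_ : g \o _ = id) ?preimage_id//; apply/funext => x /=; rewrite gK.
Qed.

HB.instance Definition _ := Measure_isSigmaFinite.Build _ _ _ lebesgue_cons
  cons_sigma_finite.

End cons_measure.

(* Lebesgue measure of R^n, as the n-fold product of [lebesgue_measure]. *)
Fixpoint lebesgue_cV n : {sigma_finite_measure set 'cV[R]_n -> \bar R} :=
  match n with
  | 0 => \d_(0 : 'cV[R]_0)
  | m.+1 => lebesgue_cons (lebesgue_cV m)
  end.

End lebesgue_cV.

Section fokker_planck.
Context {R : realType} {n : nat}.
Implicit Types (A G : 'M[R]_n) (b q x y : 'cV[R]_n) (t : R).
Implicit Types rho : 'cV[R]_n -> R.

Definition expmx A : 'M[R]_n :=
  limn (series (fun k => (k`!%:R)^-1 *: A ^+ k)).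

Definition kalman A b : Prop := \rank (\matrix_(i, j < n) (A ^+ j *m b) i 0) = n.

Definition gramian A b t : 'M[R]_n :=
  \matrix_(i, j) \int[lebesgue_measure]_(s in `[0, t])
    (expmx (s *: A) *m b *m b^T *m expmx (s *: A^T)) i j.

(* Density of the centered Gaussian law with covariance matrix [G]. *)
Definition gauss_density G x : R :=
  (Num.sqrt ((2 * pi) ^+ n * \det G))^-1
  * expR (- (dotp x (invmx G *m x) / 2)).

(* S_t^* rho, the solution at time [t] of
   d_t rho = - div (A x rho) + 1/2 (b . grad)^2 rho with initial datum [rho]: the
   Gaussian of covariance [gramian A b t] convolved with the transport by e^(tA). *)
Definition fokker_planck A b t rho : 'cV[R]_n -> R := fun x =>
  \int[lebesgue_cV n]_y (gauss_density (gramian A b t) (x - y)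
    * (expR (- (t * \tr A)) * rho (expmx ((- t) *: A) *m y))).

Definition L2 : {pred 'cV[R]_n -> R} := Lfun (lebesgue_cV n) 2%:E.

Definition L2norm rho : \bar R := 'N[lebesgue_cV n]_2%:E[EFin \o rho]%E.

Definition L2opnorm (T : ('cV[R]_n -> R) -> 'cV[R]_n -> R) : \bar R :=
  ereal_sup [set L2norm (T rho) | rho in
    [set rho | rho \in L2 /\ (L2norm rho <= 1)%E]].

(* (q . grad) S_t^*, with the classical directional derivative: S_t^* rho is
   smooth for rho in L^2 and t > 0 when the Gramian is invertible. *)
Definition grad_fokker_planck A b t q rho : 'cV[R]_n -> R :=
  'D_q (fokker_planck A b t rho).

End fokker_planck.

Section krylov.
Context {R : realType} {n : nat}.
Implicit Types (A G : 'M[R]_n) (b v : 'cV[R]_n) (t : R) (k : 'I_n).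

Definition krylov A b (m : nat) : {vspace 'cV[R]_n} :=
  <<[seq A ^+ j *m b | j <- iota 0 m]>>%VS.

(* The vector q_(k+1) of the Gram-Schmidt basis of b, A b, ..., A^(n-1) b, given
   by its characterization; it exists and is unique under [kalman A b]. *)
Definition krylov_vec A b k : 'cV[R]_n :=
  xget 0 [set q | [/\ enorm q = 1, q \in krylov A b k.+1,
    forall v, v \in krylov A b k -> dotp q v = 0 & 0 < dotp q (A ^+ k *m b)]].

Definition krylov_d A b k : R := dotp (krylov_vec A b k) (A ^+ k *m b).

Definition krylov_a A b k : R :=
  dotp (krylov_vec A b k) (A *m krylov_vec A b k).

(* The 1-based kappa_(k+1). *)
Definition kappa k : R :=
  (k`! ^ 2)%N%:R / ((k.*2.+1)`! * (k.*2)`!)%N%:R.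

(* Eigenvalues in decreasing order, with multiplicity; meaningful for matrices
   with split characteristic polynomial, such as symmetric ones. *)
Definition eigenvalues G : seq R :=
  xget [::] [set s | sorted (fun x y => y <= x) s /\
    char_poly G = \prod_(x <- s) ('X - x%:P)].

(* psi_(k+1)(t); it exists and is unique for all small t > 0. *)
Definition principal_direction A b t k : 'cV[R]_n :=
  xget 0 [set v | [/\ enorm v = 1,
    gramian A b t *m v = (eigenvalues (gramian A b t))`_k *: v
    & 0 < dotp v (krylov_vec A b k)]].

Definition frakH : 'M[R]_n :=
  \matrix_(i, j) ((i`! * j`! * (i + j).+1)%N%:R)^-1.

End krylov.

(* Main.v *)
Require Import Defs.
From HB Require Import structures.
From mathcomp Require Import all_boot all_order all_algebra.
From mathcomp Require Import fingroup perm.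
From mathcomp Require Import all_classical all_reals all_analysis.
From mathcomp Require Import measurable_realfun.
From mathcomp Require Import ring lra zify.
Import Order.TTheory GRing.Theory Num.Theory.
Import numFieldNormedType.Exports.
Local Open Scope classical_set_scope.
Local Open Scope ring_scope.
Set Implicit Arguments.
Unset Strict Implicit.
Unset Printing Implicit Defensive.

(** The operator (q . grad) S_t^* is a composition of the dilation
    rho |-> exp (- t tr A) rho(exp (- t A) x), which multiplies L^2 norms by
    exp (- t tr A / 2), and of the derivative along q of the convolution with a
    gaussian of covariance G.  Choose L with L L^T = G and L e_0 proportional
    to q ([spd_adapted]); the proportionality factor is the square root of
    q^T G^-1 q.  In the coordinates L^-1 x the gaussian is standard and the
    derivative is a multiple of the first partial derivative ([smear_grad]), so
    that everything reduces to one fact: convolution with the first partial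
    derivative of the standard gaussian of R^n has norm exp (- 1/2) on L^2.

    On the Fourier side this is the maximum of |xi| exp (- xi^2 / 2), but the
    proof avoids the Fourier transform.  For the upper bound on the line, let
    m(s) be the quadratic form of the heat kernel of variance s at f.  It is
    log-convex by Cauchy-Schwarz and equals |f|^2 at s = 0, and the squared
    norm to be bounded is - 2 m'(2); a log-convex function satisfies
    - 2 m'(2) <= m(0) / e ([sharp_upper_1d]).  The remaining variables only
    average, which Jensen's inequality controls ([tensor_upper]).  For the
    lower bound one tests on wide gaussian wave packets whose frequency is
    close to the maximizing one ([tensor_lower], [std_grad_ge]).

    The asymptotics come from the expansion of the Gramian in the Krylov basis.
    The function s |-> <q_i, exp (s A) b> vanishes to order i at 0, and its
    first two Taylor coefficients are d_i / i! and d_i sigma_i / (i+1)!, where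
    sigma_i = a_0 + ... + a_i ([moment_next], indices from 0).  So the entry
    (i, j) of the Gramian is d_i d_j t^(i+j+1) (H_ij + O(t)) with an explicit
    first-order term, where H = frakH is the Gram matrix of the functions
    s^k / k! on [0, 1] ([krylov_gram_expand]).  The inverse of the Gramian
    is then governed by the inverse of H, which gives the fixed directions
    ([opnorm_krylov]).  Legendre polynomials diagonalize H: their squared norms
    are the kappa_k, and the diagonal of the inverse of H is a telescoping sum
    ([leg_mx_diag], [frakH_inv_diag]).

    For the moving directions put lambda = mu t^(2k+1) in the characteristic
    equation.  A suitable rescaling turns G - lambda into a matrix that is
    diagonal up to O(t) ([secular]), whose determinant is therefore the product
    of its diagonal entries up to O(t^2).  All of these stay away from 0 except
    the k-th, mu / d_k^2 - kappa_k (1 + a_k t) + O(t^2); the coefficient a_k is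
    sigma_k - sigma_(k-1), again by orthogonality of the Legendre polynomials
    ([leg_first_order]).  Hence mu = kappa_k d_k^2 (1 + a_k t) + O(t^2)
    ([secular_root]), and the first part applied to the eigenvector gives the
    norm exp (- 1/2) exp (- t tr A / 2) lambda^(- 1/2) ([opnorm_principal]). *)

(** * Linear changes of variables in R^n *)
Section Scales.
Context {R : realType}.

(** Says that the image of mu under phi is r mu, in the form in which it is
    applied: for integrals of nonnegative functions. *)
Definition scales_integral {d} {T : measurableType d} (mu : {measure set T -> \bar R})
    (phi : T -> T) (r : R) :=
  measurable_fun setT phi /\ forall f : T -> \bar R,
    measurable_fun setT f -> (forall x, 0 <= f x)%E ->
    (\int[mu]_x f (phi x) = r%:E * \int[mu]_x f x)%E.

Lemma scales_comp {d} {T : measurableType d} (mu : {measure set T -> \bar R})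
   (phi psi : T -> T) (r s : R) : scales_integral mu phi r ->
   scales_integral mu psi s -> scales_integral mu (phi \o psi) (r * s).
Proof.
move=> [mphi sphi] [mpsi spsi]; split; first exact: measurableT_comp.
move=> f mf f0.
rewrite (spsi (f \o phi) (measurableT_comp mf mphi) (fun x => f0 _)).
by rewrite sphi// EFinM muleA [(s%:E * _)%E]muleC.
Qed.

Lemma scales_opp : scales_integral (@lebesgue_measure R) -%R 1.
Proof.
split; first exact: oppr_measurable.
move=> f mf f0; rewrite mul1e.
have -> : (\int[lebesgue_measure]_x f (- x)%R =
  \int[pushforward lebesgue_measure (-%R : _ -> measurableTypeR R)]_x f x)%E.
  by rewrite ge0_integral_pushforward//.
by apply: eq_measure_integral => //= A mA _; exact: lebesgue_measureN.
Qed.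

(** The multiple by a of the image measure gives every interval its length,
    hence is Lebesgue measure. *)
Lemma scales_affine_pos (a c : R) : 0 < a ->
  scales_integral (@lebesgue_measure R) (fun x : measurableTypeR R => (a * x + c : measurableTypeR R)) a^-1.
Proof.
move=> a0.
have mphi : measurable_fun setT ((fun x => a * x + c) : measurableTypeR R -> measurableTypeR R).
  by apply: measurable_funD => //; apply: measurable_funM.
split => // f mf f0.
have -> : (\int[lebesgue_measure]_x f (a * x + c)%R =
  \int[pushforward lebesgue_measure ((fun x => a * x + c)%R : measurableTypeR R -> measurableTypeR R)]_x f x)%E.
  by rewrite ge0_integral_pushforward.
have ai0 : 0 <= a^-1 by rewrite invr_ge0 ltW.
have aa0 : 0 <= a by rewrite ltW.
rewrite -(ge0_integral_mscale (@lebesgue_measure R) measurableT (NngNum ai0)) //.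
apply: eq_measure_integral => //= A mA _.
pose nu := measure_function_pushforward__canonical__measure_function_Measure lebesgue_measure mphi.
suff E : lebesgue_measure A = mscale (NngNum aa0) nu A.
  by rewrite /mscale /= E /mscale/= muleA -EFinM mulVf ?gt_eqF// mul1e.
apply: (@lebesgue_measure_unique _ (mscale (NngNum aa0) nu)) => //= _ [[x y]] _ <-.
rewrite /mscale/= /pushforward.
rewrite [X in _ = (_ * lebesgue_measure X)%E](_ : _ = [set` `](x - c) / a, (y - c) / a]]); last first.
  apply/seteqP; split => z /=; rewrite !in_itv/= => /andP[xz zy]; apply/andP; split.
  - by rewrite ltr_pdivrMr// ltrBlDr mulrC.
  - by rewrite ler_pdivlMr// lerBrDr mulrC.
  - by move: xz; rewrite ltr_pdivrMr// ltrBlDr mulrC.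
  - by move: zy; rewrite ler_pdivlMr// lerBrDr mulrC.
rewrite !lebesgue_measure_itv/= !lte_fin ltr_pM2r ?invr_gt0// ltrD2r.
case: ifP => _; last by rewrite mule0.
rewrite -!EFinD -EFinM; congr EFin; field; exact: lt0r_neq0.
Qed.

(** Reflection handles the sign, so that only the case of a positive slope
    meets the uniqueness of Lebesgue measure. *)
Lemma scales_affine (a c : R) : a != 0 ->
  scales_integral (@lebesgue_measure R) (fun x : measurableTypeR R => (a * x + c : measurableTypeR R)) `|a|^-1.
Proof.
move=> a0; have [ag0|al0|] := ltgtP 0 a; last by move=> ?; subst; rewrite eqxx in a0.
  by rewrite gtr0_norm//; exact: scales_affine_pos.
rewrite (_ : (fun x => a * x + c) = (fun x => - a * x + c) \o -%R); last first.
  by apply/funext => x /=; rewrite mulrNN.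
rewrite -[X in scales_integral _ _ X]mulr1; apply: scales_comp; last exact: scales_opp.
by rewrite ltr0_norm//; apply: scales_affine_pos; rewrite oppr_gt0.
Qed.

Lemma tonelli_cV n (f : 'cV[R]_n.+1 -> \bar R) : measurable_fun setT f ->
  (forall x, 0 <= f x)%E ->
  (\int[lebesgue_cV n.+1]_x f x =
   \int[lebesgue_measure]_x \int[lebesgue_cV n]_v f (cV_cons (x, v)))%E.
Proof.
move=> mf f0.
transitivity (\int[(@lebesgue_measure R) \x lebesgue_cV n]_z f (cV_cons z))%E.
  rewrite /=.
  have := @ge0_integral_pushforward _ _ _ _ _ (@cV_cons R n) (@measurable_cV_cons R n) ((@lebesgue_measure R) \x lebesgue_cV n)%E setT f measurableT mf (fun x _ => f0 x).
  by rewrite preimage_setT.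
by rewrite fubini_tonelli1 //; apply: measurableT_comp => //; exact: measurable_cV_cons.
Qed.

Lemma tonelli_cV2 n (f : 'cV[R]_n.+1 -> \bar R) : measurable_fun setT f ->
  (forall x, 0 <= f x)%E ->
  (\int[lebesgue_cV n.+1]_x f x =
   \int[lebesgue_cV n]_v \int[lebesgue_measure]_x f (cV_cons (x, v)))%E.
Proof.
move=> mf f0; rewrite tonelli_cV//.
rewrite (fubini_tonelli (fun z => f (cV_cons z)))//.
by apply: measurableT_comp => //; exact: measurable_cV_cons.
Qed.

Lemma measurable_affine_cV m n (M : 'M[R]_(m, n)) (c : 'cV[R]_m) :
  measurable_fun setT (fun v : 'cV[R]_n => M *m v + c).
Proof.
apply: measurable_fun_mx => i j; under eq_fun do rewrite !mxE.
apply: measurable_funD => //.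
by apply: measurable_sum => k; apply: measurable_funM => //; exact: measurable_mx_entry.
Qed.

Lemma cV_cons_surj n (x : 'cV[R]_n.+1) : x = cV_cons (x 0 0, @dsubmx _ 1 n 1 x).
Proof.
rewrite /cV_cons /= -[LHS](@vsubmxK _ 1 n 1); congr (@col_mx _ 1 n 1 _ _).
apply/matrixP => i j; rewrite !mxE !ord1 eqxx mulr1n; congr (x _ _).
by apply/val_inj.
Qed.

(** With the last n coordinates fixed, only the first one moves, by an affine
    map of slope a; integrating in it first reduces to the line. *)
Lemma scales_cV_first n (a : R) (l : 'rV[R]_n) (c0 : R) : a != 0 ->
  scales_integral (lebesgue_cV n.+1)
    (fun x => @block_mx _ 1 n 1 n a%:M l 0 1%:M *m x + @col_mx _ 1 n 1 c0%:M 0) `|a|^-1.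
Proof.
move=> a0; split; first exact: measurable_affine_cV.
move=> f mf f0.
rewrite tonelli_cV2//; last by apply: measurableT_comp => //; exact: measurable_affine_cV.
rewrite (tonelli_cV2 mf f0).
rewrite -ge0_integralZl//=; last 2 first.
- apply: (measurable_fun_fubini_tonelli_G (fun z => f (cV_cons z))) => //.
  by apply: measurableT_comp => //; exact: measurable_cV_cons.
- by move=> v _; apply: integral_ge0.
apply: eq_integral => v _.
have E x : @block_mx _ 1 n 1 n a%:M l 0 1%:M *m cV_cons (x, v) + @col_mx _ 1 n 1 c0%:M 0
   = cV_cons (a * x + ((l *m v) 0 0 + c0), v).
  rewrite /cV_cons /= (@mul_block_col _ 1 n 1 n) add_col_mx mul0mx add0r addr0 mul1mx.
  congr (@col_mx _ 1 n 1 _ _).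
  by apply/matrixP => i j; rewrite !ord1 !mxE big_ord1 !mxE eqxx /= !mulr1n addrA.
under eq_integral do rewrite E.
apply: ((scales_affine ((l *m v) 0 0 + c0) a0).2 (fun x => f (cV_cons (x, v)))) => //.
apply: (measurableT_comp mf) => /=.
apply: (measurableT_comp (@measurable_cV_cons R n) ) => //=.
Qed.

(** With the first coordinate fixed, the others move by M and a translation
    depending on that coordinate; integrating in them first reduces to
    dimension n. *)
Lemma scales_cV_rest n (w : 'cV[R]_n) (M : 'M[R]_n) (c : 'cV[R]_n) (r : R) : 0 <= r ->
  (forall c, scales_integral (lebesgue_cV n) (fun x => M *m x + c) r) ->
  scales_integral (lebesgue_cV n.+1)
    (fun x => @block_mx _ 1 n 1 n 1%:M 0 w M *m x + @col_mx _ 1 n 1 0 c) r.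
Proof.
move=> r0 IH; split; first exact: measurable_affine_cV.
move=> f mf f0.
rewrite tonelli_cV//; last by apply: measurableT_comp => //; exact: measurable_affine_cV.
rewrite (tonelli_cV mf f0).
rewrite -ge0_integralZl//=; last 2 first.
- apply: (measurable_fun_fubini_tonelli_F (fun z => f (cV_cons z))) => //.
  by apply: measurableT_comp => //; exact: measurable_cV_cons.
- by move=> v _; apply: integral_ge0.
apply: eq_integral => x _.
have E v : @block_mx _ 1 n 1 n 1%:M 0 w M *m cV_cons (x, v) + @col_mx _ 1 n 1 0 c
   = cV_cons (x, M *m v + (x *: w + c)).
  rewrite /cV_cons /= (@mul_block_col _ 1 n 1 n) add_col_mx mul0mx addr0 mul1mx addr0.
  congr (@col_mx _ 1 n 1 _ _).
  by rewrite mul_mx_scalar [in LHS](addrC (x *: w)) addrA.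
under eq_integral do rewrite E.
apply: ((IH (x *: w + c)).2 (fun v => f (cV_cons (x, v)))) => //.
apply: (measurableT_comp mf) => /=.
apply: (measurableT_comp (@measurable_cV_cons R n) ) => //=.
Qed.

(** When the corner entry a is nonzero, M factors through its Schur complement
    S as a lower block matrix with blocks 1, S times an upper one with blocks
    a, 1. The two previous lemmas treat the factors. *)
Lemma scales_cV_pivot n (M : 'M[R]_n.+1) (c : 'cV[R]_n.+1) :
  (forall (M : 'M[R]_n) c, M \in unitmx -> scales_integral (lebesgue_cV n) (fun x => M *m x + c) `|\det M|^-1) ->
  M \in unitmx -> M 0 0 != 0 ->
  scales_integral (lebesgue_cV n.+1) (fun x => M *m x + c) `|\det M|^-1.
Proof.
move=> IH uM a0; set a := M 0 0 in a0.
pose M' : 'M[R]_(1 + n) := M; pose l := ursubmx M'; pose w := dlsubmx M'; pose M2 := drsubmx M'.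
have ME : M' = block_mx a%:M l w M2.
  rewrite -[LHS]submxK; congr block_mx; apply/matrixP => i j.
  by rewrite !mxE !ord1 eqxx mulr1n; congr (M _ _); apply/val_inj.
pose S := M2 - a^-1 *: (w *m l).
have Mfac : M' = block_mx 1%:M 0 (a^-1 *: w) S *m block_mx a%:M l 0 1%:M.
  rewrite mulmx_block !mul1mx !mulmx1 !mul0mx !addr0 ME; congr block_mx.
  - by rewrite mulmx0 addr0 mul_mx_scalar scalerA mulfV// scale1r.
  - by rewrite /S -scalemxAl addrC subrK.
have dM : \det M = a * \det S.
  have -> : \det M = \det M' by [].
  by rewrite Mfac det_mulmx det_lblock det_ublock !det1 det_scalar1 mul1r mulr1 mulrC.
have uS : S \in unitmx.
  by move: uM; rewrite !unitmxE dM !unitfE mulf_eq0 negb_or => /andP[].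
pose c' : 'cV[R]_(1 + n) := c.
pose c1 := usubmx c'; pose c2 := dsubmx c'.
rewrite (_ : (fun x => M *m x + c) = (fun x => @block_mx _ 1 n 1 n 1%:M 0 (a^-1 *: w) S *m x + @col_mx _ 1 n 1 0 (c2 - (a^-1 *: w) *m c1)) \o (fun x => @block_mx _ 1 n 1 n a%:M l 0 1%:M *m x + @col_mx _ 1 n 1 (c1 0 0)%:M 0)); last first.
  apply/funext => x /=; rewrite mulmxDr mulmxA.
  rewrite -[M]/M' {1}Mfac -addrA; congr (_ + _).
  rewrite (@mul_block_col _ 1 n 1 n) add_col_mx mul1mx mul0mx mulmx0 !addr0.
  have <- : c1 = (c1 0 0)%:M by exact: mx11_scalar.
  by rewrite addrC subrK vsubmxK.
rewrite dM normrM invfM mulrC; apply: scales_comp; last exact: scales_cV_first.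
by apply: scales_cV_rest => [|e]; [rewrite invr_ge0|apply: IH].
Qed.

(** By induction on the dimension. If the corner entry vanishes, adding to the
    first row a row whose first entry is nonzero, which is a shear of
    determinant 1, produces a pivot. *)
Lemma scales_cV_affine n (M : 'M[R]_n) (c : 'cV[R]_n) : M \in unitmx ->
  scales_integral (lebesgue_cV n) (fun x => M *m x + c) `|\det M|^-1.
Proof.
elim: n M c => [|n IH] M c uM.
  rewrite det_mx00 normr1 invr1.
  rewrite (_ : (fun _ => _) = id); last by apply/funext => x; apply/matrixP => -[].
  by split=> // f mf f0; rewrite mul1e.
have [a0|a0] := eqVneq (M 0 0) 0; last by apply: scales_cV_pivot.
have [i Mi0] : exists i, M i 0 != 0.
  apply/existsP; apply: contraT => /existsPn H; move: uM.
  rewrite unitmxE unitfE (expand_det_col _ 0) big1 ?eqxx// => i _.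
  by have := H i; rewrite negbK => /eqP ->; rewrite mul0r.
have i0 : i != 0 by apply: contraNneq Mi0 => ->; rewrite a0.
have [j ij] : exists j : 'I_n, i = rshift 1 j.
  have [j|] := unliftP 0 i; last by move/eqP; rewrite (negbTE i0).
  by move=> ->; exists j; apply/val_inj.
pose l : 'rV[R]_n := delta_mx 0 j.
pose E := @block_mx _ 1 n 1 n 1%:M l 0 1%:M : 'M[R]_n.+1.
pose F := @block_mx _ 1 n 1 n 1%:M (- l) 0 1%:M : 'M[R]_n.+1.
have FE : F *m E = 1%:M.
  rewrite /F /E (@mulmx_block _ 1 n 1 n 1 n) !mul1mx !mulmx1 !mulmx0 !mul0mx addr0 !add0r.
  by rewrite subrr -scalar_mx_block.
have dE : \det E = 1 by rewrite /E (@det_ublock _ 1 n) !det1 mulr1.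
have dF : \det F = 1 by rewrite /F (@det_ublock _ 1 n) !det1 mulr1.
have uEM : E *m M \in unitmx by rewrite unitmx_mul uM unitmxE dE unitr1.
have E0 k : E 0 (rshift 1 k) = (k == j)%:R.
  transitivity (@block_mx R 1 n 1 n 1%:M l 0 1%:M (lshift n 0) (rshift 1 k)).
    by congr (_ _ _); exact/val_inj.
  by rewrite block_mxEur mxE eqxx.
have EM0 : (E *m M) 0 0 != 0.
  rewrite mxE (bigD1 0)//= a0 mulr0 add0r (bigD1 i)//= big1 ?addr0.
    by rewrite ij E0 eqxx mul1r -ij.
  move=> k /andP[k0 ki].
  have [k'|] := unliftP 0 k; last by move/eqP; rewrite (negbTE k0).
  move=> kE; have {}kE : k = rshift 1 k' by rewrite kE; apply/val_inj.
  rewrite kE E0.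
  case: eqP => [kj|]; last by rewrite mul0r.
  by move: ki; rewrite kE kj ij eqxx.
have -> : (fun x => M *m x + c) = (fun x => F *m x + @col_mx _ 1 n 1 0%:M 0) \o (fun x => (E *m M) *m x + E *m c).
  apply/funext => x /=; rewrite -mulmxA -mulmxDr mulmxA FE mul1mx.
  by rewrite raddf0 col_mx0 addr0.
have -> : `|\det M|^-1 = `|1|^-1 * `|\det (E *m M)|^-1 :> R.
  by rewrite det_mulmx dE mul1r normr1 invr1 mul1r.
apply: scales_comp; first by apply: scales_cV_first; rewrite oner_neq0.
exact: scales_cV_pivot.
Qed.

End Scales.

(** * Square-integrable functions and product measures *)
Section SquareIntegrable.
Context {R : realType}.

Section one.
Context d {T : measurableType d} (mu : {measure set T -> \bar R}).

Lemma RintgZl (c : R) (f : T -> R) : mu.-integrable setT (EFin \o f) ->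
  mu.-integrable setT (EFin \o (fun x => c * f x)).
Proof.
by move=> i; apply: (@eq_integrable _ _ _ mu _ measurableT _ _ _ (integrableZl measurableT c i)) => x _ /=; rewrite EFinM.
Qed.

Lemma RintgD (f g : T -> R) : mu.-integrable setT (EFin \o f) ->
  mu.-integrable setT (EFin \o g) -> mu.-integrable setT (EFin \o (fun x => f x + g x)).
Proof.
by move=> i j; apply: (@eq_integrable _ _ _ mu _ measurableT _ _ _ (integrableD measurableT i j)) => x _ /=; rewrite EFinD.
Qed.

Lemma RintgB (f g : T -> R) : mu.-integrable setT (EFin \o f) ->
  mu.-integrable setT (EFin \o g) -> mu.-integrable setT (EFin \o (fun x => f x - g x)).
Proof.
by move=> i j; apply: (@eq_integrable _ _ _ mu _ measurableT _ _ _ (integrableB measurableT i j)) => x _ /=; rewrite EFinB.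
Qed.

Lemma Rintg_eq (f g : T -> R) : mu.-integrable setT (EFin \o f) -> (forall x, f x = g x) ->
  mu.-integrable setT (EFin \o g).
Proof. by move=> i fg; apply: (@eq_integrable _ _ _ mu _ measurableT _ _ _ i) => x _ /=; rewrite fg. Qed.

Lemma Rintg_le (f g : T -> R) : measurable_fun setT f -> (forall x, `|f x| <= g x) ->
  mu.-integrable setT (EFin \o g) -> mu.-integrable setT (EFin \o f).
Proof.
move=> mf fg; apply: le_integrable => //; first exact/measurable_EFinP.
by move=> x _ /=; rewrite lee_fin (le_trans (fg x)) ?ler_norm.
Qed.

Lemma Rintg_mf (f : T -> R) : mu.-integrable setT (EFin \o f) -> measurable_fun setT f.
Proof. by move=> i; apply/measurable_EFinP; exact: measurable_int i. Qed.

(** Membership in L^2 for honest real functions; [L2P] identifies it with the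
    definition used in the statement. *)
Definition sqint (f : T -> R) :=
  measurable_fun setT f /\ mu.-integrable setT (EFin \o (fun x => f x ^+ 2)).

Lemma sqint_mul (f h : T -> R) : sqint f -> sqint h ->
  mu.-integrable setT (EFin \o (fun x => f x * h x)).
Proof.
move=> [mf if_] [mh ih].
have := integrableD measurableT if_ ih.
apply: le_integrable => //; first by apply/measurable_EFinP; exact: measurable_funM.
move=> x _ /=; rewrite lee_fin [leRHS]ger0_norm ?addr_ge0 ?sqr_ge0//.
rewrite ler_norml; have := sqr_ge0 (f x + h x); have := sqr_ge0 (f x - h x); have := sqr_ge0 (f x); have := sqr_ge0 (h x); move=> *; apply/andP; split; nra.
Qed.

Lemma sqintZ (c : R) (f : T -> R) : sqint f -> sqint (fun x => c * f x).
Proof.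
move=> [mf if_]; split; first exact: measurable_funM.
by apply: (Rintg_eq (RintgZl (c ^+ 2) if_)) => x; rewrite exprMn.
Qed.

Lemma sqint_bound (f h : T -> R) : measurable_fun setT f -> (forall x, `|f x| <= h x) -> sqint h -> sqint f.
Proof.
move=> mf fh [mh ih]; split => //; apply: le_integrable ih => //.
  by apply/measurable_EFinP; exact: measurable_funX.
move=> x _ /=; rewrite lee_fin !normrX lerXn2r ?nnegrE ?normr_ge0//.
by rewrite (le_trans (fh x)) ?ler_norm.
Qed.

Lemma sqint_int_bound (f : T -> R) (M : R) : measurable_fun setT f -> (forall x, `|f x| <= M) ->
  mu.-integrable setT (EFin \o f) -> sqint f.
Proof.
move=> mf fM if_; split => //.
have := integrableZl measurableT M (integrable_abse if_).
apply: le_integrable => //.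
  by apply/measurable_EFinP; exact: measurable_funX.
move=> x _ /=; rewrite lee_fin normrX expr2 normrM normr_id ler_wpM2r//.
exact: le_trans (fM x) (ler_norm _).
Qed.

(** The quadratic t |-> |f - t h|^2 is nonnegative; its value at the minimum t
    = b / c is the claim. If c = 0 the quadratic is affine, which forces b =
    0. *)
Lemma cauchy_schwarz (f h : T -> R) : sqint f -> sqint h ->
  (\int[mu]_x (f x * h x)) ^+ 2 <= (\int[mu]_x (f x ^+ 2)) * (\int[mu]_x (h x ^+ 2)).
Proof.
move=> sf sh.
have ifh := sqint_mul sf sh.
have [mf if_] := sf; have [mh ih] := sh.
set a := \int[mu]_x (f x ^+ 2); set b := \int[mu]_x (f x * h x); set c := \int[mu]_x (h x ^+ 2).
have Q t : 0 <= a - 2 * t * b + t ^+ 2 * c.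
  have -> : a - 2 * t * b + t ^+ 2 * c = \int[mu]_x ((f x - t * h x) ^+ 2).
    rewrite /a /b /c.
    have <- : \int[mu]_x (f x ^+ 2 + (- (2 * t) * (f x * h x) + t ^+ 2 * h x ^+ 2)) =
       \int[mu]_x (f x - t * h x) ^+ 2.
      by apply: eq_Rintegral => x _; ring.
    have i1 : mu.-integrable setT (EFin \o (fun x => - (2 * t) * (f x * h x))).
      exact: RintgZl.
    have i2 : mu.-integrable setT (EFin \o (fun x => t ^+ 2 * h x ^+ 2)).
      exact: RintgZl.
    rewrite RintegralD//; last first.
      by apply: RintgD.
    by rewrite RintegralD// !RintegralZl//; ring.
  by apply: Rintegral_ge0 => x _; exact: sqr_ge0.
have a0 : 0 <= a by apply: Rintegral_ge0 => x _; exact: sqr_ge0.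
have c0 : 0 <= c by apply: Rintegral_ge0 => x _; exact: sqr_ge0.
have [c00|cn0] := eqVneq c 0.
  rewrite c00 mulr0; have [->|bn0] := eqVneq b 0; first by rewrite expr0n.
  exfalso; have := Q ((a + 1) / (2 * b)); rewrite c00 mulr0 addr0.
  have -> : 2 * ((a + 1) / (2 * b)) * b = a + 1 by field.
  lra.
have cp : 0 < c by rewrite lt_def cn0 c0.
have := Q (b / c).
have -> : a - 2 * (b / c) * b + (b / c) ^+ 2 * c = (a * c - b ^+ 2) / c by field.
by rewrite pmulr_lge0 ?invr_gt0// subr_ge0.
Qed.

(** The difference of the two sides is the variance of a under the density k.
    The right-hand side is an extended real because k a^2 may fail to be
    integrable. *)
Lemma jensen_sqr (k a : T -> R) : (forall x, 0 <= k x) -> measurable_fun setT k ->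
  measurable_fun setT a -> mu.-integrable setT (EFin \o k) -> \int[mu]_x k x = 1 ->
  mu.-integrable setT (EFin \o (fun x => k x * a x)) ->
  (((\int[mu]_x (k x * a x)) ^+ 2)%:E <= \int[mu]_x (k x * a x ^+ 2)%:E)%E.
Proof.
move=> k0 mk ma ik k1 ika.
set c := \int[mu]_x (k x * a x).
have mka2 : measurable_fun setT (EFin \o (fun x => k x * a x ^+ 2)).
  by apply/measurable_EFinP; apply: measurable_funM => //; exact: measurable_funX.
have pos x : (0 <= (k x * a x ^+ 2)%:E)%E by rewrite lee_fin mulr_ge0 ?sqr_ge0.
case: (ltP (\int[mu]_x (k x * a x ^+ 2)%:E)%E +oo%E) => [fin|]; last first.
  by rewrite leye_eq => /eqP ->; rewrite leey.
have ika2 : mu.-integrable setT (EFin \o (fun x => k x * a x ^+ 2)).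
  apply/integrableP; split => //; apply: le_lt_trans fin.
  rewrite (eq_integral (fun x => (k x * a x ^+ 2)%:E)) ?lexx// => x _ /=.
  by rewrite ger0_norm// mulr_ge0 ?sqr_ge0.
have -> : (\int[mu]_x (k x * a x ^+ 2)%:E)%E = (\int[mu]_x (k x * a x ^+ 2))%:E.
  by rewrite /Rintegral fineK//; exact: integrable_fin_num.
rewrite lee_fin -subr_ge0.
have <- : \int[mu]_x (k x * (a x - c) ^+ 2) = \int[mu]_x (k x * a x ^+ 2) - c ^+ 2.
  have -> : \int[mu]_x (k x * (a x - c) ^+ 2) =
      \int[mu]_x (k x * a x ^+ 2 + (- (2 * c) * (k x * a x) + c ^+ 2 * k x)).
    by apply: eq_Rintegral => x _; ring.
  have i1 : mu.-integrable setT (EFin \o (fun x => - (2 * c) * (k x * a x))).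
    exact: RintgZl.
  have i2 : mu.-integrable setT (EFin \o (fun x => c ^+ 2 * k x)).
    exact: RintgZl.
  rewrite RintegralD//; last first.
    by apply: RintgD.
  by rewrite RintegralD// !RintegralZl// -/c k1; ring.
by apply: Rintegral_ge0 => x _; rewrite mulr_ge0 ?sqr_ge0.
Qed.

Lemma EFin_Rintegral (f : T -> R) : mu.-integrable setT (EFin \o f) ->
  (\int[mu]_x f x)%:E = (\int[mu]_x (f x)%:E)%E.
Proof. by move=> i; rewrite /Rintegral fineK//; exact: integrable_fin_num. Qed.

Lemma ge0_integrable_lty (f : T -> R) : measurable_fun setT f -> (forall x, 0 <= f x) ->
  (\int[mu]_x (f x)%:E < +oo)%E -> mu.-integrable setT (EFin \o f).
Proof.
move=> mf f0 lt; apply/integrableP; split; first exact/measurable_EFinP.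
rewrite (eq_integral (fun x => (f x)%:E))// => x _ /=.
by rewrite ger0_norm.
Qed.

End one.

Section two.
Context d1 d2 (X : measurableType d1) (Y : measurableType d2).
Variable m1 : {sigma_finite_measure set X -> \bar R}.
Variable m2 : {sigma_finite_measure set Y -> \bar R}.

Lemma measurable_Rintegral_fst (f : X * Y -> R) : measurable_fun setT f ->
  measurable_fun setT (fun x => \int[m2]_y f (x, y)).
Proof.
move=> mf; apply: (measurableT_comp (@fine_measurable R setT measurableT)) => //.
rewrite (_ : (fun x => (\int[m2]_y (f (x, y))%:E)%E) = (fun x => (\int[m2]_y (EFin \o f)^\+ (x, y) - \int[m2]_y (EFin \o f)^\- (x, y))%E)); last first.
  apply/funext => x; rewrite [LHS]integralE; by congr (_ - _)%E; apply: eq_integral => y _; rewrite unlock.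
apply: emeasurable_funB.
- apply: (measurable_fun_fubini_tonelli_F (EFin \o f)^\+)%E => //.
  by apply: measurable_funepos; exact/measurable_EFinP.
- apply: (measurable_fun_fubini_tonelli_F (EFin \o f)^\-)%E => //.
  by apply: measurable_funeneg; exact/measurable_EFinP.
Qed.

(** Asking for every slice, and not just almost every one, to be integrable
    makes the inner real integrals meaningful everywhere. *)
Lemma Rfubini1 (f : X * Y -> R) : (m1 \x m2)%E.-integrable setT (EFin \o f) ->
  (forall x, m2.-integrable setT (EFin \o (fun y => f (x, y)))) ->
  \int[(m1 \x m2)%E]_z f z = \int[m1]_x \int[m2]_y f (x, y).
Proof.
move=> if_ ix; rewrite [LHS]/Rintegral -(integral12_prod_meas1 if_).
congr fine; apply: eq_integral => x _.
by rewrite EFin_Rintegral.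
Qed.

Lemma Rfubini2 (f : X * Y -> R) : (m1 \x m2)%E.-integrable setT (EFin \o f) ->
  (forall y, m1.-integrable setT (EFin \o (fun x => f (x, y)))) ->
  \int[(m1 \x m2)%E]_z f z = \int[m2]_y \int[m1]_x f (x, y).
Proof.
move=> if_ ix; rewrite [LHS]/Rintegral -(integral21_prod_meas1 if_).
congr fine; apply: eq_integral => x _.
by rewrite EFin_Rintegral.
Qed.

Lemma integrable_prodM (a : X -> R) (b : Y -> R) :
  m1.-integrable setT (EFin \o a) -> m2.-integrable setT (EFin \o b) ->
  (m1 \x m2)%E.-integrable setT (EFin \o (fun z => a z.1 * b z.2)).
Proof.
move=> ia ib.
have ma : measurable_fun setT a by apply/measurable_EFinP; exact: measurable_int ia.
have mb : measurable_fun setT b by apply/measurable_EFinP; exact: measurable_int ib.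
apply/integrable12ltyP.
  apply/measurable_EFinP; apply: measurable_funM.
    exact: (measurableT_comp ma).
  exact: (measurableT_comp mb).
under eq_integral => x _.
  under eq_integral => y _ do rewrite /= normrM EFinM.
  rewrite ge0_integralZl//; last first.
    by apply/measurable_EFinP; exact: measurableT_comp.
  over.
have [_ lb] := integrableP _ _ _ ib; have [_ la] := integrableP _ _ _ ia.
rewrite ge0_integralZr//=.
- by rewrite lte_mul_pinfty// ?integral_ge0// ge0_fin_numE ?integral_ge0.
- by apply/measurable_EFinP; exact: measurableT_comp.
- exact: integral_ge0.
Qed.

Lemma Rintegral_prodM (a : X -> R) (b : Y -> R) :
  m1.-integrable setT (EFin \o a) -> m2.-integrable setT (EFin \o b) ->
  \int[(m1 \x m2)%E]_z (a z.1 * b z.2) = (\int[m1]_x a x) * (\int[m2]_y b y).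
Proof.
move=> ia ib; rewrite Rfubini1/=.
- rewrite -RintegralZr//; apply: eq_Rintegral => x _.
  by rewrite RintegralZl.
- exact: integrable_prodM.
- by move=> x; exact: RintgZl.
Qed.

(** The Schur test: |f h k| is at most f^2 |k| + h^2 |k|, and each of the two
    is integrable because one can integrate |k| first. *)
Lemma integrable_kernel (k : X * Y -> R) (C : R) (f : X -> R) (h : Y -> R) :
  measurable_fun setT k ->
  (forall x, \int[m2]_y `|k (x, y)|%:E <= C%:E)%E ->
  (forall y, \int[m1]_x `|k (x, y)|%:E <= C%:E)%E ->
  sqint m1 f -> sqint m2 h ->
  (m1 \x m2)%E.-integrable setT (EFin \o (fun z => f z.1 * h z.2 * k z)).
Proof.
move=> mk k1 k2 [mf if_] [mh ih].
have mf' : measurable_fun setT (fun z : X * Y => f z.1) by exact: (measurableT_comp mf).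
have mh' : measurable_fun setT (fun z : X * Y => h z.2) by exact: (measurableT_comp mh).
have mk' : measurable_fun setT (fun z : X * Y => `|k z|) by exact: measurableT_comp.
have i1 : (m1 \x m2)%E.-integrable setT (EFin \o (fun z => f z.1 ^+ 2 * `|k z|)).
  apply/integrable12ltyP.
    by apply/measurable_EFinP; apply: measurable_funM => //; exact: measurable_funX.
  apply: (@le_lt_trans _ _ (\int[m1]_x (C%:E * (f x ^+ 2)%:E))%E).
    apply: ge0_le_integral => //=.
    - by move=> x _; apply: integral_ge0.
    - apply: (measurable_fun_fubini_tonelli_F (fun z => (`|f z.1 ^+ 2 * `|k z| |)%:E)) => //=.
      by apply/measurable_EFinP; apply: measurableT_comp => //; apply: measurable_funM => //; exact: measurable_funX.
    - by apply: emeasurable_funM => //; exact: measurable_int if_.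
    move=> x _.
    under eq_integral => y _ do rewrite normrM normr_id ger0_norm ?sqr_ge0// EFinM.
    rewrite ge0_integralZl//=.
    - by rewrite muleC lee_wpmul2r// lee_fin sqr_ge0.
    - by apply/measurable_EFinP; apply: measurableT_comp => //; apply: measurableT_comp => //; exact: measurable_pair1.
    - by rewrite lee_fin sqr_ge0.
  rewrite (integralZl measurableT if_) lte_mul_pinfty//.
    by rewrite (le_trans _ (k1 point))// integral_ge0.
  by apply: integrable_lty.
have i2 : (m1 \x m2)%E.-integrable setT (EFin \o (fun z => h z.2 ^+ 2 * `|k z|)).
  apply/integrable21ltyP.
    by apply/measurable_EFinP; apply: measurable_funM => //; exact: measurable_funX.
  apply: (@le_lt_trans _ _ (\int[m2]_x (C%:E * (h x ^+ 2)%:E))%E).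
    apply: ge0_le_integral => //=.
    - by move=> x _; apply: integral_ge0.
    - apply: (measurable_fun_fubini_tonelli_G (fun z => (`|h z.2 ^+ 2 * `|k z| |)%:E)) => //=.
      by apply/measurable_EFinP; apply: measurableT_comp => //; apply: measurable_funM => //; exact: measurable_funX.
    - by apply: emeasurable_funM => //; exact: measurable_int ih.
    move=> x _.
    under eq_integral => y _ do rewrite normrM normr_id ger0_norm ?sqr_ge0// EFinM.
    rewrite ge0_integralZl//=.
    - by rewrite muleC lee_wpmul2r// lee_fin sqr_ge0.
    - by apply/measurable_EFinP; apply: measurableT_comp => //; apply: measurableT_comp => //; exact: measurable_pair2.
    - by rewrite lee_fin sqr_ge0.
  rewrite (integralZl measurableT ih) lte_mul_pinfty//.
    by rewrite (le_trans _ (k1 point))// integral_ge0.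
  by apply: integrable_lty.
have := integrableD measurableT i1 i2.
apply: le_integrable => //.
  by apply/measurable_EFinP; do 2 apply: measurable_funM => //.
move=> z _ /=; rewrite -mulrDl lee_fin !normrM normr_id ler_wpM2r//.
rewrite [leRHS]ger0_norm ?addr_ge0 ?sqr_ge0//.
rewrite -[f z.1 ^+ 2]real_normK ?num_real// -[h z.2 ^+ 2]real_normK ?num_real//.
have := sqr_ge0 (`|f z.1| - `|h z.2|); have := sqr_ge0 (`|f z.1|); have := sqr_ge0 (`|h z.2|); nra.
Qed.

End two.
End SquareIntegrable.

(** * Convolution on the line *)
(** A copy of the product measure that carries the instance of
    sigma-finiteness, so that products can be iterated. *)
Definition sigma_finite_prod d1 d2 (T1 : measurableType d1) (T2 : measurableType d2) (R : realType)
    (m1 : {sigma_finite_measure set T1 -> \bar R}) (m2 : {sigma_finite_measure set T2 -> \bar R})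
    : set (T1 * T2) -> \bar R := (m1 \x m2)%E.

Section sigma_finite_prod_instances.
Context d1 d2 (T1 : measurableType d1) (T2 : measurableType d2) (R : realType).
Variables (m1 : {sigma_finite_measure set T1 -> \bar R}) (m2 : {sigma_finite_measure set T2 -> \bar R}).
HB.instance Definition _ := Measure.copy (sigma_finite_prod m1 m2) (m1 \x m2)%E.
HB.instance Definition _ :=
  @Measure_isSigmaFinite.Build _ _ _ (sigma_finite_prod m1 m2) (sigma_finite_product m1 m2).
End sigma_finite_prod_instances.

Section Conv.
Context {R : realType}.
Local Notation T := (measurableTypeR R).
Local Notation leb := (@lebesgue_measure R).

Lemma sqint_norm d (S : measurableType d) (mu : {measure set S -> \bar R}) (f : S -> R) :
  sqint mu f -> sqint mu (fun x => `|f x|).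
Proof.
move=> [mf if_]; split; first exact: measurableT_comp.
by apply: (Rintg_eq if_) => x; rewrite real_normK ?num_real.
Qed.

(** Apply the property to the positive and the negative part of f. *)
Lemma scales_Rintegral d (S : measurableType d) (mu : {measure set S -> \bar R})
    (phi : S -> S) (r : R) (f : S -> R) : 0 <= r ->
  scales_integral mu phi r -> mu.-integrable setT (EFin \o f) ->
  mu.-integrable setT (EFin \o (fun x => f (phi x))) /\
  \int[mu]_x f (phi x) = r * \int[mu]_x f x.
Proof.
move=> r0 [mphi sphi] if_.
have mf : measurable_fun setT f := Rintg_mf if_.
have iphi : mu.-integrable setT (EFin \o (fun x => f (phi x))).
  apply/integrableP; split; first by apply/measurable_EFinP; exact: (measurableT_comp mf).
  have /= -> := sphi (fun x => `|f x|%:E).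
  - by case/integrableP: if_ => _ lt; rewrite lte_mul_pinfty.
  - by apply/measurable_EFinP; exact: measurableT_comp.
  - by move=> x; rewrite lee_fin.
split => //; apply: EFin_inj; rewrite EFin_Rintegral// EFinM EFin_Rintegral//.
rewrite integralE.
have mp : measurable_fun setT (EFin \o f)^\+%E by apply: measurable_funepos; exact/measurable_EFinP.
have mn : measurable_fun setT (EFin \o f)^\-%E by apply: measurable_funeneg; exact/measurable_EFinP.
have /= E1 := sphi ((EFin \o f)^\+)%E mp (fun x => funepos_ge0 _ x).
have /= E2 := sphi ((EFin \o f)^\-)%E mn (fun x => funeneg_ge0 _ x).
rewrite (eq_integral (fun x => (EFin \o f)^\+%E (phi x)))//.
rewrite [X in (_ - X)%E](eq_integral (fun x => (EFin \o f)^\-%E (phi x)))//.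
rewrite E1 E2 -muleBr//.
  by congr (_ * _)%E; rewrite [RHS]integralE.
- by apply: fin_num_adde_defr; exact: (integrable_pos_fin_num measurableT if_).
- by move=> x _; rewrite !funenegE.
- by move=> x _; rewrite !funeposE.
Qed.

Lemma scales_shift (c : R) : scales_integral leb (fun x : T => (x + c : T)) 1.
Proof.
have := scales_affine c (oner_neq0 R); rewrite normr1 invr1.
by under eq_fun do rewrite mul1r.
Qed.

Lemma scales_reflect (c : R) : scales_integral leb (fun x : T => (c - x : T)) 1.
Proof.
have n1 : (-1 : R) != 0 by rewrite oppr_eq0 oner_neq0.
have := scales_affine c n1; rewrite normrN normr1 invr1.
by under eq_fun do rewrite mulN1r addrC.
Qed.

Lemma scales_sqint d (S : measurableType d) (mu : {measure set S -> \bar R})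
    (phi : S -> S) (r : R) (f : S -> R) : 0 <= r ->
  scales_integral mu phi r -> sqint mu f -> sqint mu (fun x => f (phi x)).
Proof.
move=> r0 s [mf if_]; split; first exact: (measurableT_comp mf s.1).
by have [] := scales_Rintegral r0 s if_.
Qed.

Lemma integrable_reflect (c : R) (f : T -> R) : leb.-integrable setT (EFin \o f) ->
  leb.-integrable setT (EFin \o (fun x : T => f (c - x))).
Proof. by move=> /(scales_Rintegral ler01 (scales_reflect c))[]. Qed.

Lemma Rintegral_reflect (c : R) (f : T -> R) : leb.-integrable setT (EFin \o f) ->
  \int[leb]_x f (c - x) = \int[leb]_x f x.
Proof. by move=> /(scales_Rintegral ler01 (scales_reflect c))[_ ->]; rewrite mul1r. Qed.

Lemma integrable_shift (c : R) (f : T -> R) : leb.-integrable setT (EFin \o f) ->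
  leb.-integrable setT (EFin \o (fun x : T => f (x + c))).
Proof. by move=> /(scales_Rintegral ler01 (scales_shift c))[]. Qed.

Lemma Rintegral_shift (c : R) (f : T -> R) : leb.-integrable setT (EFin \o f) ->
  \int[leb]_x f (x + c) = \int[leb]_x f x.
Proof. by move=> /(scales_Rintegral ler01 (scales_shift c))[_ ->]; rewrite mul1r. Qed.

Lemma measurable_comp_sub (phi : T -> R) : measurable_fun setT phi ->
  measurable_fun setT (fun z : T * T => phi (z.1 - z.2)).
Proof.
move=> mphi; apply: (measurableT_comp mphi); apply: measurable_funB; exact: measurable_fst || exact: measurable_snd.
Qed.

(** The kernel phi(x - y) satisfies the Schur test because translations and
    reflections preserve the integral of |phi|. *)
Lemma integrable_conv (phi f h : T -> R) : leb.-integrable setT (EFin \o phi) ->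
  sqint leb f -> sqint leb h ->
  (leb \x leb)%E.-integrable setT (EFin \o (fun z : T * T => f z.1 * h z.2 * phi (z.1 - z.2))).
Proof.
move=> ip sf sh.
have mp := Rintg_mf ip.
have aip : leb.-integrable setT (EFin \o (fun x => `|phi x|)) by exact: integrable_abse ip.
apply: (integrable_kernel (C := \int[leb]_x `|phi x|)) => //.
- exact: measurable_comp_sub.
- move=> x /=; rewrite -(Rintegral_reflect x aip) EFin_Rintegral//.
  exact: (integrable_reflect x aip).
- move=> x /=; rewrite -(Rintegral_shift (- x) aip) EFin_Rintegral//.
  exact: (integrable_shift (- x) aip).
Qed.

Definition conv (phi f : T -> R) (z : T) : R := \int[leb]_x (phi (z - x) * f x).
(** The correlation of phi and psi, through which scalar products of
    convolutions are computed. *)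
Definition corr (phi psi : T -> R) (u : T) : R := \int[leb]_w (phi w * psi (w + u)).

Lemma measurable_conv (phi f : T -> R) : measurable_fun setT phi -> measurable_fun setT f ->
  measurable_fun setT (conv phi f).
Proof.
move=> mp mf; apply: (measurable_Rintegral_fst _ (f := fun z : T * T => phi (z.1 - z.2) * f z.2)).
apply: measurable_funM; first exact: measurable_comp_sub.
exact: (measurableT_comp mf).
Qed.

Section ConvPair.
Variables (phi psi f h : T -> R).
Hypotheses (iphi : leb.-integrable setT (EFin \o phi)) (ipsi : leb.-integrable setT (EFin \o psi)).
Hypotheses (sphi : sqint leb phi) (spsi : sqint leb psi) (sf : sqint leb f) (sh : sqint leb h).

(** By Tonelli its integral is the product of the integrals of |phi| and
    |psi|. *)
Lemma integrable_corr_abs : leb.-integrable setT (EFin \o (corr (fun x => `|phi x|) (fun x => `|psi x|))).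
Proof.
have [mphi _] := sphi; have [mpsi _] := spsi.
have mF : measurable_fun setT (fun z : T * T => `|phi z.2| * `|psi (z.2 + z.1)|).
  apply: measurable_funM.
    by apply: measurableT_comp => //; exact: (measurableT_comp mphi).
  apply: measurableT_comp => //; apply: (measurableT_comp mpsi).
  by apply: measurable_funD; [exact: measurable_snd|exact: measurable_fst].
have iF : (leb \x leb)%E.-integrable setT (EFin \o (fun z : T * T => `|phi z.2| * `|psi (z.2 + z.1)|)).
  apply/integrable21ltyP; first exact/measurable_EFinP.
  under eq_integral => y _.
    under eq_integral => x _ do rewrite /= ger0_norm ?mulr_ge0// addrC EFinM.
    rewrite ge0_integralZl//=; last first.
      apply/measurable_EFinP; apply: measurableT_comp => //; apply: (measurableT_comp mpsi) => //.
      exact: measurable_funD.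
    have /= -> := (scales_shift y).2 (fun x => `|psi x|%:E).
    - over.
    - by apply/measurable_EFinP; exact: measurableT_comp.
    - by move=> x; rewrite lee_fin.
  rewrite mul1e ge0_integralZr//.
  - case/integrableP: iphi => _ l1; case/integrableP: ipsi => _ l2.
    by rewrite lte_mul_pinfty ?integral_ge0// ge0_fin_numE ?integral_ge0.
  - by apply/measurable_EFinP; exact: measurableT_comp.
  - exact: integral_ge0.
have := integrable_fubini_F iF.
apply: eq_integrable => // u _ /=; rewrite /fubini_F /corr EFin_Rintegral//.
apply: sqint_mul.
- exact: sqint_norm.
- apply: (scales_sqint (f := fun x => `|psi x|) ler01 (scales_shift u)).
  exact: sqint_norm.
Qed.

Let Phi (z : T * (T * T)) : R := (phi (z.1 - z.2.1) * f z.2.1) * (psi (z.1 - z.2.2) * h z.2.2).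

Let mPhi : measurable_fun setT Phi.
Proof.
have [mphi _] := sphi; have [mpsi _] := spsi; have [mf _] := sf; have [mh _] := sh.
apply: measurable_funM; apply: measurable_funM.
- apply: (measurableT_comp mphi); apply: measurable_funB; first exact: measurable_fst.
  by apply: (measurableT_comp measurable_fst); exact: measurable_snd.
- apply: (measurableT_comp mf).
  by apply: (measurableT_comp measurable_fst); exact: measurable_snd.
- apply: (measurableT_comp mpsi); apply: measurable_funB; first exact: measurable_fst.
  by apply: (measurableT_comp measurable_snd); exact: measurable_snd.
- apply: (measurableT_comp mh).
  by apply: (measurableT_comp measurable_snd); exact: measurable_snd.
Qed.

Lemma integrable_corr_slice (x y : T) (a b : R) :
  leb.-integrable setT (EFin \o (fun z : T => (phi (z - x) * a) * (psi (z - y) * b))).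
Proof.
apply: sqint_mul.
- apply: (scales_sqint (f := fun z => phi z * a) ler01 (scales_shift (- x))).
  by under eq_fun do rewrite mulrC; exact: sqintZ.
- apply: (scales_sqint (f := fun z => psi z * b) ler01 (scales_shift (- y))).
  by under eq_fun do rewrite mulrC; exact: sqintZ.
Qed.

Lemma Rintegral_corr_slice (x y : T) (a b : R) :
  \int[leb]_z ((phi (z - x) * a) * (psi (z - y) * b)) = a * b * corr phi psi (x - y).
Proof.
rewrite -(Rintegral_shift x); last exact: integrable_corr_slice.
rewrite /corr -RintegralZl//.
  by apply: eq_Rintegral => w _; rewrite addrK addrA; ring.
apply: (Rintg_eq (integrable_corr_slice 0 (- (x - y)) 1 1)) => w.
by rewrite subr0 !mulr1 opprK.
Qed.

Let iPhi : (leb \x sigma_finite_prod leb leb)%E.-integrable setT (EFin \o Phi).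
Proof.
apply/integrable21ltyP; first exact/measurable_EFinP.
have := integrable_conv integrable_corr_abs (sqint_norm sf) (sqint_norm sh).
case/integrableP => _; apply: le_lt_trans; apply: ge0_le_integral => //=.
- by move=> z _; apply: integral_ge0.
- apply: (measurable_fun_fubini_tonelli_G (fun z => `|Phi z|%:E)) => //.
  by apply/measurable_EFinP; exact: measurableT_comp.
- apply/measurable_EFinP; apply: measurableT_comp => //; apply: measurable_funM.
    have [mf _] := sf; have [mh _] := sh.
    apply: measurable_funM.
      by apply: measurableT_comp => //; exact: (measurableT_comp mf).
    by apply: measurableT_comp => //; exact: (measurableT_comp mh).
  apply: measurable_comp_sub; exact: Rintg_mf integrable_corr_abs.
move=> [x y] _ /=; rewrite /Phi /=.
rewrite (_ : (\int[leb]_z `|phi (z - x) * f x * (psi (z - y) * h y)|%:E)%E =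
  (`|f x| * `|h y| * corr (fun x => `|phi x|) (fun x => `|psi x|) (x - y))%:E).
  by rewrite lee_fin ler_norm.
rewrite -EFin_Rintegral; last exact: integrable_abse (integrable_corr_slice x y (f x) (h y)).
congr EFin.
have /= i := integrable_abse (integrable_corr_slice x y (f x) (h y)).
rewrite -(Rintegral_shift x); last exact: i.
rewrite /corr -RintegralZl//.
  by apply: eq_Rintegral => w _; rewrite addrK addrA !normrM; ring.
have /= j := integrable_abse (integrable_corr_slice 0 (- (x - y)) 1 1).
apply: (Rintg_eq j) => w.
by rewrite subr0 !mulr1 opprK normrM.
Qed.

Lemma integrable_conv_prod :
  leb.-integrable setT (EFin \o (fun z => conv phi f z * conv psi h z)).
Proof.
have := integrable_fubini_F iPhi.
apply: eq_integrable => // z _ /=; rewrite /fubini_F.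
rewrite -EFin_Rintegral.
  congr EFin; rewrite (Rintegral_prodM (m1 := leb) (m2 := leb) (a := fun x => phi (z - x) * f x) (b := fun y => psi (z - y) * h y))//.
  - exact: (sqint_mul (scales_sqint ler01 (scales_reflect z) sphi)).
  - exact: (sqint_mul (scales_sqint ler01 (scales_reflect z) spsi)).
apply: (integrable_prodM (m1 := leb) (m2 := leb) (a := fun x => phi (z - x) * f x) (b := fun y => psi (z - y) * h y)).
- exact: (sqint_mul (scales_sqint ler01 (scales_reflect z) sphi)).
- exact: (sqint_mul (scales_sqint ler01 (scales_reflect z) spsi)).
Qed.

(** Integrating in z first in the triple integral of phi(z - x) f(x) psi(z -
    y) h(y) leaves the correlation of phi and psi at x - y. Thus norms of
    convolutions become quadratic forms in f. *)
Lemma conv_pair : \int[leb]_z (conv phi f z * conv psi h z) =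
  \int[(leb \x leb)%E]_z (f z.1 * h z.2 * corr phi psi (z.1 - z.2)).
Proof.
transitivity (\int[(leb \x sigma_finite_prod leb leb)%E]_z Phi z).
  rewrite Rfubini1//.
    apply: eq_Rintegral => z _.
    rewrite (Rintegral_prodM (m1 := leb) (m2 := leb) (a := fun x => phi (z - x) * f x) (b := fun y => psi (z - y) * h y))//.
    - exact: (sqint_mul (scales_sqint ler01 (scales_reflect z) sphi)).
    - exact: (sqint_mul (scales_sqint ler01 (scales_reflect z) spsi)).
  move=> z; apply: (integrable_prodM (m1 := leb) (m2 := leb) (a := fun x => phi (z - x) * f x) (b := fun y => psi (z - y) * h y)).
  - exact: (sqint_mul (scales_sqint ler01 (scales_reflect z) sphi)).
  - exact: (sqint_mul (scales_sqint ler01 (scales_reflect z) spsi)).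
rewrite Rfubini2//.
  by apply: eq_Rintegral => -[x y] _; rewrite /Phi /= Rintegral_corr_slice.
by move=> [x y]; exact: (integrable_corr_slice x y (f x) (h y)).
Qed.

End ConvPair.

Lemma sqint_conv (phi f : T -> R) : leb.-integrable setT (EFin \o phi) -> sqint leb phi ->
  sqint leb f -> sqint leb (conv phi f).
Proof.
move=> ip sp sf; split; first by apply: measurable_conv; [have [] := sp|have [] := sf].
exact: (Rintg_eq (integrable_conv_prod ip ip sp sp sf sf)).
Qed.

End Conv.

(** * Gaussian densities on the line *)
Section Gauss.
Context {R : realType}.
Local Notation T := (measurableTypeR R).
Local Notation leb := (@lebesgue_measure R).

(** The centered gaussian density of variance s; the parameter is the variance
    because variances add under convolution. *)
Definition gauss (s x : R) : R := (Num.sqrt (2 * pi * s))^-1 * expR (- (x ^+ 2 / (2 * s))).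

Lemma peak_gt0 (s : R) : 0 < s -> 0 < Num.sqrt (2 * pi * s).
Proof. by move=> s0; rewrite sqrtr_gt0 !mulr_gt0// ?pi_gt0. Qed.

Lemma gauss_normal (s : R) : 0 < s -> gauss s = normal_pdf 0 (Num.sqrt s).
Proof.
move=> s0; have q0 : Num.sqrt s != 0 by rewrite gt_eqF// sqrtr_gt0.
apply/funext => x; rewrite (normal_pdfE _ q0) /normal_peak /normal_fun sqr_sqrtr ?ltW//.
rewrite /gauss subr0 mulNr; congr (_ ^-1 * expR (- (_ / _))).
- by congr Num.sqrt; rewrite -mulr_natr; ring.
- by rewrite mulr_natl.
Qed.

Lemma gauss_gt0 (s x : R) : 0 < s -> 0 < gauss s x.
Proof. by move=> s0; rewrite mulr_gt0 ?expR_gt0// invr_gt0 peak_gt0. Qed.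

Lemma gauss_ge0 (s x : R) : 0 <= gauss s x.
Proof. by rewrite mulr_ge0 ?expR_ge0// invr_ge0 sqrtr_ge0. Qed.

Lemma gauss_even (s x : R) : gauss s (- x) = gauss s x.
Proof. by rewrite /gauss sqrrN. Qed.

Lemma gauss_le (s x : R) : 0 <= s -> gauss s x <= (Num.sqrt (2 * pi * s))^-1.
Proof.
move=> s0; rewrite ler_piMr ?invr_ge0 ?sqrtr_ge0// expR_le1 oppr_le0.
by rewrite divr_ge0 ?sqr_ge0 ?mulr_ge0.
Qed.

Lemma measurable_gauss (s : R) : measurable_fun setT (gauss s : T -> R).
Proof.
apply: measurable_funM => //; apply: measurableT_comp => //.
apply: measurableT_comp => //; apply: measurable_funM => //; exact: measurable_funX.
Qed.

Lemma integrable_gauss (s : R) : 0 < s -> leb.-integrable setT (EFin \o (gauss s : T -> R)).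
Proof. by move=> s0; rewrite (gauss_normal s0); exact: integrable_normal_pdf. Qed.

Lemma Rintegral_gauss (s : R) : 0 < s -> \int[leb]_x gauss s x = 1.
Proof.
move=> s0; rewrite (gauss_normal s0) /Rintegral.
by have := @integral_normal_pdf R 0 (Num.sqrt s) => /= ->.
Qed.

Lemma sqint_gauss (s : R) : 0 < s -> sqint leb (gauss s : T -> R).
Proof.
move=> s0; apply: (@sqint_int_bound _ _ _ _ _ (Num.sqrt (2 * pi * s))^-1).
- exact: measurable_gauss.
- by move=> x; rewrite ger0_norm ?gauss_ge0// gauss_le// ltW.
- exact: integrable_gauss.
Qed.

(** Completing the square in w: the product of two gaussians is a gaussian in
    w whose mass depends on v as a gaussian of the summed variance. *)
Lemma gauss_mul (s u w v : R) : 0 < s -> 0 < u ->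
  gauss s w * gauss u (w + v) = gauss (s + u) v * gauss (s * u / (s + u)) (w + s * v / (s + u)).
Proof.
move=> s0 u0; have su0 : 0 < s + u by rewrite addr_gt0.
have sn := lt0r_neq0 s0; have un := lt0r_neq0 u0; have sun := lt0r_neq0 su0.
rewrite /gauss mulrACA [RHS]mulrACA -!expRD -!invfM; congr (_^-1 * expR _).
  rewrite -!sqrtrM ?mulr_ge0 ?pi_ge0 ?ltW//; congr Num.sqrt.
  by field.
by field; rewrite sn un sun.
Qed.

Lemma corr_gauss (s u v : R) : 0 < s -> 0 < u -> corr (gauss s) (gauss u) v = gauss (s + u) v.
Proof.
move=> s0 u0; have su0 : 0 < s + u by rewrite addr_gt0.
have q0 : 0 < s * u / (s + u) by rewrite divr_gt0 ?mulr_gt0.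
rewrite /corr; under eq_Rintegral do rewrite gauss_mul//.
rewrite RintegralZl//; last exact: (integrable_shift (s * v / (s + u)) (integrable_gauss q0)).
by rewrite (Rintegral_shift (s * v / (s + u)) (integrable_gauss q0)) Rintegral_gauss// mulr1.
Qed.

Lemma expR_sqr_gauss (c x : R) : 0 < c ->
  expR (- (c * x ^+ 2)) = Num.sqrt (2 * pi * (2 * c)^-1) * gauss (2 * c)^-1 x.
Proof.
move=> c0; have cn := lt0r_neq0 c0.
rewrite /gauss mulVKf; first by congr (expR (- _)); field.
by rewrite lt0r_neq0// peak_gt0// invr_gt0 mulr_gt0.
Qed.

Lemma integrable_expR_sqr (c : R) : 0 < c -> leb.-integrable setT (EFin \o (fun x : T => expR (- (c * x ^+ 2)))).
Proof.
move=> c0; have i : 0 < (2 * c)^-1 by rewrite invr_gt0 mulr_gt0.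
by apply: (Rintg_eq (RintgZl (Num.sqrt (2 * pi * (2 * c)^-1)) (integrable_gauss i))) => x; rewrite -expR_sqr_gauss.
Qed.

Lemma measurable_expR_sqr (c : R) : measurable_fun setT (fun x : T => expR (- (c * x ^+ 2))).
Proof.
by do 2 apply: measurableT_comp => //; apply: measurable_funM => //; exact: measurable_funX.
Qed.

(** By translation invariance the integral of x |-> F(x + h) does not depend
    on h. Differentiating it in h at 0, under the integral sign, gives the
    integral of F'. *)
Lemma Rintegral_derive0 (F F' : T -> R) (C c : R) : 0 < c ->
  leb.-integrable setT (EFin \o F) ->
  (forall x : R, is_derive x 1 (F : R -> R) (F' x)) ->
  (forall x, `|F' x| <= C * expR (- (c * x ^+ 2))) -> \int[leb]_x F' x = 0.
Proof.
move=> c0 iF dF bF.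
pose f (h x : R) := F (x + h).
pose G (x : R) := `|C| * expR c * expR (- (c / 2 * x ^+ 2)).
have d1 h x : partial1of2 f h x = F' (x + h).
  rewrite partial1of2E /f.
  have dx : is_derive (x + h) 1 (F : R -> R) (F' (x + h)) by exact: dF.
  have d2 : is_derive h 1 (fun h => x + h) (0 + 1) by apply: is_deriveD.
  have := @is_derive1_comp R F (fun h => x + h) h _ _ dx d2.
  by rewrite add0r mulr1 => d3; rewrite derive_val.
have := @cvg_differentiation_under_integral R _ T leb f setT measurableT 0 (-1) 1 _ _ _ G _ _ _.
have -> : (fun h : R => h^-1 *: ((\int[leb]_y f (h + 0) y) - \int[leb]_y f 0 y)) = fun => 0.
  apply/funext => h; rewrite /f addr0 (Rintegral_shift h iF).
  by under [X in _ - X]eq_Rintegral do rewrite addr0; rewrite subrr scaler0.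
move=> H.
have E : lim ((fun=> (0 : R)) x @[x --> (0:R)^']) = \int[leb]_y partial1of2 f 0 y.
  apply/cvg_lim => //; apply: H => //.
  - by rewrite /= in_itv/= ltrN10 ltr01.
  - by move=> x _; exact: (integrable_shift x iF).
  - by move=> y; rewrite /G !mulr_ge0 ?expR_ge0.
  - by apply: RintgZl; apply: integrable_expR_sqr; rewrite divr_gt0.
  - move=> h x /= /[!in_itv]/= /andP[h1 h2] _; rewrite d1 (le_trans (bF _))//.
    rewrite /G -mulrA -expRD; apply: ler_pM; rewrite ?expR_ge0//; last first.
      rewrite ler_expR; have : (x + h) ^+ 2 - x ^+ 2 / 2 + 1 >= 0.
        have := sqr_ge0 (x + 2 * h); have : h ^+ 2 <= 1 by rewrite -ler_sqrt ?sqrtr1 ?sqrtr_sqr ?ler_norml; lra.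
        nra.
      move=> H1; have := mulr_ge0 (ltW c0) H1; nra.
    - exact: ler_norm.
    - by have := bF 0; rewrite expr0n mulr0 oppr0 expR0 mulr1; apply: le_trans.
rewrite lim_cst// in E; rewrite [RHS]E; apply: eq_Rintegral => x _; rewrite d1 addr0 //.
Qed.

Lemma is_derive_gauss (s x : R) : 0 < s ->
  is_derive x 1 (gauss s) (- (x / s) * gauss s x).
Proof.
move=> s0; have sn := lt0r_neq0 s0.
have d1 : is_derive x 1 (fun x : R => - (x ^+ 2 / (2 * s))) (- (x / s)).
  apply: is_derive_eq; rewrite !scaler1 /GRing.scale/=; by field.
have d2 := @is_derive1_comp R expR _ x _ _ (is_derive_expR _) d1.
rewrite /gauss; have := is_deriveZ (Num.sqrt (2 * pi * s))^-1 d2.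
by move=> d3; apply: is_derive_eq; rewrite /GRing.scale/=; ring.
Qed.

Lemma sqr_le_expR (c x : R) : 0 < c -> x ^+ 2 <= c^-1 * expR (c * x ^+ 2).
Proof.
move=> c0; rewrite ler_pdivlMl//.
by rewrite (le_trans _ (expR_ge1Dx _))// lerDr.
Qed.

Lemma norm_le_expR (c x : R) : 0 < c -> `|x| <= (1 + c^-1) * expR (c * x ^+ 2).
Proof.
move=> c0; rewrite mulrDl mul1r.
apply: (@le_trans _ _ (1 + x ^+ 2)).
  rewrite -[x ^+ 2]real_normK ?num_real//; have := sqr_ge0 (`|x| - 1); have := sqr_ge0 `|x|; lra.
by rewrite lerD ?sqr_le_expR// (le_trans _ (expR_ge1Dx _))// lerDl mulr_ge0 ?sqr_ge0// ltW.
Qed.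

(** Half of the gaussian decay absorbs the growth of the factor y. *)
Lemma mulr_expR_sqr (c x y C : R) : `|y| <= C * expR (c * x ^+ 2) ->
  `|y * expR (- (2 * c * x ^+ 2))| <= C * expR (- (c * x ^+ 2)).
Proof.
move=> h; rewrite normrM (ger0_norm (expR_ge0 _)).
rewrite (_ : expR (- (c * x ^+ 2)) = expR (c * x ^+ 2) * expR (- (2 * c * x ^+ 2))).
  by rewrite mulrA ler_wpM2r ?expR_ge0.
by rewrite -expRD; congr expR; ring.
Qed.

Lemma integrable_sqr_gauss (s : R) : 0 < s -> leb.-integrable setT (EFin \o (fun x : T => x ^+ 2 * gauss s x)).
Proof.
move=> s0; have c0 : 0 < (4 * s)^-1 by rewrite invr_gt0 mulr_gt0.
have i := RintgZl ((Num.sqrt (2 * pi * s))^-1 * (4 * s)) (integrable_expR_sqr c0).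
apply: (Rintg_le _ _ i).
  by apply: measurable_funM; [exact: measurable_funX|exact: measurable_gauss].
move=> x; rewrite /gauss mulrCA normrM (ger0_norm (x:=_^-1)) ?invr_ge0 ?sqrtr_ge0//.
rewrite -[leRHS]mulrA ler_wpM2l ?invr_ge0 ?sqrtr_ge0//.
have h : `|x ^+ 2| <= 4 * s * expR ((4 * s)^-1 * x ^+ 2).
  by rewrite ger0_norm ?sqr_ge0//; have := sqr_le_expR x c0; rewrite invrK.
have := mulr_expR_sqr h.
by congr (`|_ * expR (- _)| <= _); field; exact: lt0r_neq0.
Qed.

Lemma integrable_id_gauss (s : R) : 0 < s -> leb.-integrable setT (EFin \o (fun x : T => x * gauss s x)).
Proof.
move=> s0; have := RintgD (integrable_gauss s0) (integrable_sqr_gauss s0).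
apply: Rintg_le; first by apply: measurable_funM => //; exact: measurable_gauss.
move=> x; rewrite normrM (ger0_norm (gauss_ge0 _ _)) -[X in _ <= X + _]mul1r -mulrDl ler_wpM2r ?gauss_ge0//.
rewrite -[x ^+ 2]real_normK ?num_real//; have := sqr_ge0 (`|x| - 1); have := sqr_ge0 `|x|; lra.
Qed.

(** Integrate the derivative of x |-> x gauss s x, which is gauss s x - x^2
    gauss s x / s. *)
Lemma second_moment_gauss (s : R) : 0 < s -> \int[leb]_x (x ^+ 2 * gauss s x) = s.
Proof.
move=> s0; have sn := lt0r_neq0 s0.
have H : \int[leb]_x (gauss s x - s^-1 * (x ^+ 2 * gauss s x)) = 0.
  have c0 : 0 < (4 * s)^-1 by rewrite invr_gt0 mulr_gt0.
  apply: (Rintegral_derive0 (F := fun x => x * gauss s x) (C := (Num.sqrt (2 * pi * s))^-1 * 5) c0).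
  - exact: integrable_id_gauss.
  - move=> x; have d := is_derive_gauss x s0.
    have := is_deriveM (is_derive_id x 1) d.
    by move=> d3; apply: is_derive_eq; rewrite /GRing.scale/=; field.
  - move=> x; rewrite /gauss.
    have -> : (Num.sqrt (2 * pi * s))^-1 * expR (- (x ^+ 2 / (2 * s))) - s^-1 * (x ^+ 2 * ((Num.sqrt (2 * pi * s))^-1 * expR (- (x ^+ 2 / (2 * s)))))
      = (Num.sqrt (2 * pi * s))^-1 * ((1 - x ^+ 2 / s) * expR (- (2 * (4 * s)^-1 * x ^+ 2))).
      have -> : 2 * (4 * s)^-1 * x ^+ 2 = x ^+ 2 / (2 * s) by field.
      by field; rewrite sn lt0r_neq0// peak_gt0.
    rewrite normrM (ger0_norm (x:=_^-1)) ?invr_ge0 ?sqrtr_ge0// -[leRHS]mulrA ler_wpM2l ?invr_ge0 ?sqrtr_ge0//.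
    apply: mulr_expR_sqr.
    have h1 := sqr_le_expR x c0; have h2 : 1 <= expR ((4 * s)^-1 * x ^+ 2).
      by rewrite (le_trans _ (expR_ge1Dx _))// lerDl mulr_ge0 ?sqr_ge0// ltW.
    have h3 : x ^+ 2 / s <= 4 * expR ((4 * s)^-1 * x ^+ 2).
      by rewrite ler_pdivrMr// (le_trans h1)// invrK mulrAC lexx.
    have h4 : 0 <= x ^+ 2 / s by rewrite divr_ge0 ?sqr_ge0// ltW.
    by rewrite ler_norml; apply/andP; split; lra.
rewrite RintegralB// in H; last 2 first.
- exact: integrable_gauss.
- by apply: RintgZl; exact: integrable_sqr_gauss.
have EZ : \int[leb]_x (s^-1 * (x ^+ 2 * gauss s x)) = s^-1 * \int[leb]_x (x ^+ 2 * gauss s x).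
  by rewrite RintegralZl//; exact: integrable_sqr_gauss.
rewrite EZ in H.
rewrite Rintegral_gauss// in H.
by apply: (mulfI (invr_neq0 sn)); rewrite mulVf//; lra.
Qed.

(** The derivative of the standard gaussian density. *)
Definition dgauss (x : R) : R := - x * gauss 1 x.

Lemma measurable_dgauss : measurable_fun setT (dgauss : T -> R).
Proof. by apply: measurable_funM; [exact: oppr_measurable|exact: measurable_gauss]. Qed.

Lemma integrable_dgauss : leb.-integrable setT (EFin \o (dgauss : T -> R)).
Proof.
by apply: (Rintg_eq (RintgZl (-1) (integrable_id_gauss (@ltr01 R)))) => x; rewrite /dgauss; ring.
Qed.

Lemma dgauss_bound : exists C, forall x, `|dgauss x| <= C * expR (- (4^-1 * x ^+ 2)).
Proof.
have c0 : 0 < (4^-1 : R) by rewrite invr_gt0.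
exists ((Num.sqrt (2 * pi * 1))^-1 * (1 + 4^-1^-1)) => x.
rewrite /dgauss /gauss mulrCA normrM (ger0_norm (x:=_^-1)) ?invr_ge0 ?sqrtr_ge0//.
rewrite -[leRHS]mulrA ler_wpM2l ?invr_ge0 ?sqrtr_ge0//.
have := @mulr_expR_sqr 4^-1 x (- x) (1 + 4^-1^-1); rewrite normrN => /(_ (norm_le_expR x c0)).
by congr (`|_ * expR (- _)| <= _); field.
Qed.

Lemma sqint_dgauss : sqint leb (dgauss : T -> R).
Proof.
have [C hC] := dgauss_bound.
apply: (@sqint_int_bound _ _ _ _ _ C); [exact: measurable_dgauss| |exact: integrable_dgauss].
move=> x; rewrite (le_trans (hC x))// ler_piMr//.
  by have := hC 0; rewrite expr0n mulr0 oppr0 expR0 mulr1; apply: le_trans.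
by rewrite expR_le1 oppr_le0 mulr_ge0 ?sqr_ge0.
Qed.

(** The correlation of g' with itself is minus the second derivative of the
    correlation of g with itself, which is the gaussian of variance 2. *)
Lemma corr_dgauss (v : R) : corr dgauss dgauss v = (2^-1 - v ^+ 2 / 4) * gauss 2 v.
Proof.
have q0 : 0 < (1 * 1 / (1 + 1) : R) by [].
rewrite /corr.
have E : forall w : R, dgauss w * dgauss (w + v) =
   gauss 2 v * (((w + v / 2) ^+ 2 - v ^+ 2 / 4) * gauss 2^-1 (w + v / 2)).
  move=> w; rewrite /dgauss.
  have -> : - w * gauss 1 w * (- (w + v) * gauss 1 (w + v)) = w * (w + v) * (gauss 1 w * gauss 1 (w + v)) by ring.
  rewrite (gauss_mul _ _ ltr01 ltr01) !mul1r (_ : 1 + 1 = 2 :> R)//.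
  by field.
under eq_Rintegral do rewrite E.
have h0 : 0 < (2^-1 : R) by rewrite invr_gt0.
have i : leb.-integrable setT (EFin \o (fun w : T => (w ^+ 2 - v ^+ 2 / 4) * gauss 2^-1 w)).
  apply: (Rintg_eq (RintgB (integrable_sqr_gauss h0) (RintgZl (v ^+ 2 / 4) (integrable_gauss h0)))) => w.
  by rewrite mulrBl.
rewrite RintegralZl//; last exact: (integrable_shift (v / 2) i).
rewrite (Rintegral_shift (v / 2) i) mulrC; congr (_ * _).
under eq_Rintegral do rewrite mulrBl.
rewrite RintegralB//; [|exact: integrable_sqr_gauss|by apply: RintgZl; exact: integrable_gauss].
by rewrite RintegralZl ?Rintegral_gauss ?second_moment_gauss ?mulr1//; exact: integrable_gauss.
Qed.

End Gauss.

(** * The sharp one-dimensional upper bound *)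
Section Upper.
Context {R : realType}.
Local Notation T := (measurableTypeR R).
Local Notation leb := (@lebesgue_measure R).

Lemma xexpN_le (x : R) : x * expR (- x) <= expR (- 1).
Proof.
rewrite expRN ler_pdivrMr ?expR_gt0// -expRD.
by have := expR_ge1Dx (-1 + x); rewrite addrA subrr add0r.
Qed.

(** Log-convexity makes the ratios c (k+1) / c k nondecreasing. With r the
    last one, c p is at most c 0 * r ^ p, so the left-hand side is at most c 0
    * p (1 - r) r ^ p, and r <= exp (- (1 - r)) reduces this to x exp (- x) <=
    exp (- 1). This is a discrete form of the bound - m'(1) <= m(0) / e for
    log-convex decreasing m on [0, 1]. *)
Lemma log_convex_drop (p : nat) (c : nat -> R) : (forall k, 0 <= c k) ->
  (forall k, (k < p)%N -> c k.+1 ^+ 2 <= c k * c k.+2) ->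
  p%:R * (c p - c p.+1) <= expR (- 1) * c 0.
Proof.
move=> c0 leg_coef.
case: p leg_coef => [|p] leg_coef; first by rewrite mul0r mulr_ge0 ?expR_ge0.
have [cp|cp] := leP (c p.+1) (c p.+2).
  rewrite (@le_trans _ _ 0) ?mulr_ge0 ?expR_ge0// mulr_ge0_le0 ?subr_le0//.
have cp0 : 0 < c p.+1 by exact: le_lt_trans cp.
have cq0 : 0 < c p.+2.
  rewrite lt_def c0 andbT; apply: contraTneq (leg_coef p (ltnSn _)) => ->.
  by rewrite mulr0 -ltNge exprn_gt0.
set r := c p.+2 / c p.+1.
have r0 : 0 < r by rewrite divr_gt0.
have H j : (j <= p.+1)%N -> c (p.+2 - j)%N <= c (p.+1 - j)%N * r /\ 0 < c (p.+1 - j)%N.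
  elim: j => [|j IH] jp.
    by rewrite !subn0 /r mulrCA divff ?mulr1// lt0r_neq0.
  have [h1 h2] := IH (ltnW jp).
  rewrite subSS.
  have E1 : (p.+1 - j)%N = (p.+1 - j.+1).+1 by rewrite subnSK.
  have E2 : (p.+2 - j)%N = (p.+1 - j.+1).+2 by rewrite -E1 -subSn // ltnW.
  have kp : (p.+1 - j.+1 < p.+1)%N by rewrite subSS ltnS leq_subr.
  have := leg_coef _ kp; rewrite -E2 -E1 => h3.
  have h4 : c (p.+1 - j)%N <= c (p.+1 - j.+1)%N * r.
    rewrite -(ler_pM2l h2) -expr2 (le_trans h3)// mulrCA ler_wpM2l//.
  split => //.
  by have := lt_le_trans h2 h4; rewrite pmulr_lgt0.
have K j : (j <= p.+1)%N -> c p.+1 <= c (p.+1 - j)%N * r ^+ j.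
  elim: j => [|j IH] jp; first by rewrite subn0 expr0 mulr1.
  apply: (le_trans (IH (ltnW jp))); rewrite exprS mulrA ler_pM2r ?exprn_gt0//.
  by have [] := H _ jp; rewrite subSS.
have := K _ (leqnn _); rewrite subnn => Kp.
have -> : c p.+1 - c p.+2 = c p.+1 * (1 - r).
  by rewrite mulrBr mulr1 /r mulrCA divff ?mulr1// lt0r_neq0.
have r1 : 0 <= 1 - r by rewrite subr_ge0 ler_pdivrMr// mul1r ltW.
apply: (@le_trans _ _ (p.+1%:R * (c 0 * r ^+ p.+1 * (1 - r)))).
  by rewrite ler_wpM2l// ler_wpM2r.
have rexp : r ^+ p.+1 <= expR (- (p.+1%:R * (1 - r))).
  rewrite -mulrN expRM_natl lerXn2r ?nnegrE ?expR_ge0 ?(ltW r0)//.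
  by rewrite (le_trans _ (expR_ge1Dx _))// opprB addrC subrK.
apply: (@le_trans _ _ (c 0 * (p.+1%:R * (1 - r) * expR (- (p.+1%:R * (1 - r)))))).
  rewrite (_ : p.+1%:R * _ = c 0 * (p.+1%:R * (1 - r) * r ^+ p.+1)); last by ring.
  by rewrite ler_wpM2l// ler_wpM2l// mulr_ge0.
by rewrite [leRHS]mulrC ler_wpM2l// xexpN_le.
Qed.

Let is_derive_gauss_var_aux (p q s e x : R) : q != 0 -> s != 0 -> p != 0 ->
  q ^- 2 = (2 * p * s)^-1 ->
  q^-1 * (e * - (x ^+ 2 * (- (2 * s) ^- 2 * 2))) + e * (- q ^- 2 * ((2 * q)^-1 * (2 * p))) =
  (x ^+ 2 / (2 * s ^+ 2) - (2 * s)^-1) * (q^-1 * e).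
Proof. by move=> q0 s0 p0 ->; field; rewrite q0 s0 p0. Qed.

(** The heat equation: the derivative in the variance is half of the second
    derivative in x. *)
Lemma is_derive_gauss_var (s x : R) : 0 < s ->
  is_derive s 1 (fun s => gauss s x) ((x ^+ 2 / (2 * s ^+ 2) - (2 * s)^-1) * gauss s x).
Proof.
move=> s0; have sn := lt0r_neq0 s0.
have pn : (pi : R) != 0 by rewrite lt0r_neq0// pi_gt0.
have ps : 0 < 2 * pi * s by rewrite !mulr_gt0// pi_gt0.
have qn : Num.sqrt (2 * pi * s) != 0 by rewrite lt0r_neq0// sqrtr_gt0.
have d1 : is_derive s 1 (fun s : R => 2 * pi * s) (2 * pi).
  by apply: is_derive_eq; rewrite /GRing.scale/= mulr1.
have d2 := @is_derive1_comp R _ _ s _ _ (is_derive1_sqrt ps) d1.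
have d3 := @is_deriveV R _ s _ _ qn d2.
have d4 : is_derive s 1 (fun s : R => 2 * s) 2.
  by apply: is_derive_eq; rewrite /GRing.scale/= mulr1.
have d4' : 2 * s != 0 by rewrite mulf_neq0.
have d5 := @is_deriveV R _ s _ _ d4' d4.
have d6 := is_deriveN (is_deriveZ (x ^+ 2) d5).
have d7 := @is_derive1_comp R expR _ s _ _ (is_derive_expR _) d6.
have := is_deriveM d3 d7.
rewrite /gauss /= => d8; apply: is_derive_eq.
rewrite /GRing.scale /= !fctE /GRing.scale/=.
have E : Num.sqrt (2 * pi * s) ^- 2 = (2 * pi * s)^-1 by rewrite sqr_sqrtr// ltW.
set q := Num.sqrt _ in qn E *.
set e := expR _.
have q2 : q ^+ 2 = 2 * pi * s by rewrite sqr_sqrtr// ltW.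
exact: is_derive_gauss_var_aux.
Qed.

Section Contraction.
Variable f : T -> R.
Hypothesis sf : sqint leb f.

Let m s : R := \int[(leb \x leb)%E]_z (f z.1 * f z.2 * gauss s (z.1 - z.2)).
Let N : R := \int[leb]_x f x ^+ 2.

Let m_pair (s u : R) : 0 < s -> 0 < u ->
  \int[leb]_z (conv (gauss s) f z * conv (gauss u) f z) = m (s + u).
Proof.
move=> s0 u0; rewrite conv_pair//; try exact: integrable_gauss; try exact: sqint_gauss.
by apply: eq_Rintegral => z _; rewrite corr_gauss.
Qed.

Let sqint_c (s : R) : 0 < s -> sqint leb (conv (gauss s) f).
Proof. by move=> s0; apply: sqint_conv => //; [exact: integrable_gauss|exact: sqint_gauss]. Qed.

Let m_ge0 (s : R) : 0 < s -> 0 <= m s.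
Proof.
move=> s0; have h0 : 0 < s / 2 by rewrite divr_gt0.
have := m_pair h0 h0; rewrite -splitr => <-.
by apply: Rintegral_ge0 => x _; rewrite -expr2 sqr_ge0.
Qed.

Let m_log_convex (s h : R) : 0 < h -> h < s -> m s ^+ 2 <= m (s - h) * m (s + h).
Proof.
move=> h0 hs.
have a0 : 0 < (s - h) / 2 by rewrite divr_gt0 ?subr_gt0.
have b0 : 0 < (s + h) / 2 by rewrite divr_gt0 ?addr_gt0// (lt_trans h0).
have E0 : s = (s - h) / 2 + (s + h) / 2 by field.
have E1 : s - h = (s - h) / 2 + (s - h) / 2 by field.
have E2 : s + h = (s + h) / 2 + (s + h) / 2 by field.
have := cauchy_schwarz (sqint_c a0) (sqint_c b0).
under [X in _ <= X * _ -> _]eq_Rintegral do rewrite expr2.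
under [X in _ <= _ * X -> _]eq_Rintegral do rewrite expr2.
by rewrite (m_pair a0 b0) (m_pair a0 a0) (m_pair b0 b0) -E0 -E1 -E2.
Qed.

Let m_log_convex0 (h : R) : 0 < h -> m h ^+ 2 <= N * m (h + h).
Proof.
move=> h0; rewrite -m_pair//.
have := cauchy_schwarz sf (sqint_c h0).
under [X in _ <= _ * X -> _]eq_Rintegral do rewrite expr2.
suff -> : \int[leb]_x (f x * conv (gauss h) f x) = m h by [].
rewrite /m Rfubini1.
- apply: eq_Rintegral => x _; rewrite /conv -RintegralZl//.
    by apply: eq_Rintegral => y _ /=; ring.
  exact: (sqint_mul (scales_sqint ler01 (scales_reflect x) (sqint_gauss h0))).
- exact: integrable_conv (integrable_gauss h0) sf sf.
move=> x; apply: (Rintg_eq (RintgZl (f x) (sqint_mul (scales_sqint ler01 (scales_reflect x) (sqint_gauss h0)) sf))) => y /=.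
by ring.
Qed.

Let k2 (u : R) := (u ^+ 2 / (2 * 2 ^+ 2) - (2 * 2)^-1) * gauss 2 u.

Let m_deriv : h^-1 *: (m (h + 2) - m 2) @[h --> 0^'] -->
  \int[(leb \x leb)%E]_z (f z.1 * f z.2 * k2 (z.1 - z.2)).
Proof.
pose F (s : R) (z : T * T) : R := f z.1 * f z.2 * gauss s (z.1 - z.2).
have dF (s : R) (z : T * T) : 0 < s -> is_derive s 1 (fun s : R => F s z : R) (f z.1 * f z.2 * (((z.1 - z.2) ^+ 2 / (2 * s ^+ 2) - (2 * s)^-1) * gauss s (z.1 - z.2))).
  move=> s0; have := is_deriveZ (f z.1 * f z.2) (is_derive_gauss_var (z.1 - z.2) s0).
  by [].
have pd s z : 0 < s -> partial1of2 F s z = f z.1 * f z.2 * (((z.1 - z.2) ^+ 2 / (2 * s ^+ 2) - (2 * s)^-1) * gauss s (z.1 - z.2)).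
  by move=> s0; rewrite partial1of2E; have := dF s z s0 => d; rewrite derive_val.
have c0 : 0 < (12^-1 : R) by rewrite invr_gt0.
(* Dominates the derivatives for 1 < s < 3, with generous constants: the
   gaussian has variance 6 and 7 bounds 12 / 2 + 1 / 2. *)
pose G (z : T * T) := `|f z.1| * `|f z.2| * (7 * expR (- (12^-1 * (z.1 - z.2) ^+ 2))).
have iG : (leb \x leb)%E.-integrable setT (EFin \o G).
  exact: (integrable_conv (RintgZl 7 (integrable_expR_sqr c0)) (sqint_norm sf) (sqint_norm sf)).
have := @cvg_differentiation_under_integral R _ _ (leb \x leb)%E F setT measurableT 2 1 3 _ _ _ G _ iG _.
have -> : \int[(leb \x leb)%E]_y partial1of2 F 2 y = \int[(leb \x leb)%E]_z (f z.1 * f z.2 * k2 (z.1 - z.2)).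
  by apply: eq_Rintegral => z _; rewrite pd.
apply.
- by rewrite /= in_itv/=; apply/andP; split; lra.
- move=> s /=; rewrite in_itv/= => /andP[s1 _].
  by apply: (integrable_conv (integrable_gauss _) sf sf); lra.
- move=> s z /=; rewrite in_itv/= => /andP[s1 _] _.
  have s0 : 0 < s by lra.
  by have [] := dF s z s0.
- by move=> z; rewrite /G !mulr_ge0 ?expR_ge0.
- move=> s z /=; rewrite in_itv/= => /andP[s1 s3] _.
  have s0 : 0 < s by lra.
  rewrite pd// /G (normrM (f z.1 * f z.2)) (normrM (f z.1)) ler_wpM2l ?mulr_ge0//.
  set u := z.1 - z.2.
  have sn := lt0r_neq0 s0.
  have g1 : gauss s u <= expR (- (6^-1 * u ^+ 2)).
    rewrite /gauss -[leRHS]mul1r ler_pM ?invr_ge0 ?sqrtr_ge0 ?expR_ge0//.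
      rewrite invf_le1 ?peak_gt0// -[leLHS]sqrtr1 ler_wsqrtr//.
      by have := pi_ge2 R => ?; nra.
    rewrite ler_expR lerN2 mulrC ler_wpM2l ?sqr_ge0// lef_pV2 ?posrE ?mulr_gt0//; lra.
  rewrite (normrM _ (gauss s u)) (ger0_norm (gauss_ge0 _ _)).
  apply: (@le_trans _ _ ((u ^+ 2 / 2 + 2^-1) * expR (- (6^-1 * u ^+ 2)))).
    apply: ler_pM => //; first exact: gauss_ge0.
    have b1 : 0 <= u ^+ 2 / (2 * s ^+ 2) by rewrite divr_ge0 ?sqr_ge0// mulr_ge0// sqr_ge0.
    have b2 : u ^+ 2 / (2 * s ^+ 2) <= u ^+ 2 / 2.
      by rewrite ler_wpM2l ?sqr_ge0// lef_pV2 ?posrE ?mulr_gt0 ?exprn_gt0// ler_peMr// exprn_ege1 // ltW.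
    have b3 : 0 <= (2 * s)^-1 by rewrite invr_ge0 mulr_ge0// ltW.
    have b4 : (2 * s)^-1 <= 2^-1 by rewrite lef_pV2 ?posrE ?mulr_gt0//; lra.
    by rewrite ler_norml; apply/andP; split; lra.
  have h1 := sqr_le_expR u c0; rewrite invrK in h1.
  have h2 : 1 <= expR (12^-1 * u ^+ 2).
    by rewrite (le_trans _ (expR_ge1Dx _))// lerDl mulr_ge0 ?sqr_ge0// ltW.
  have h3 : `|u ^+ 2 / 2 + 2^-1| <= 7 * expR (12^-1 * u ^+ 2).
    by rewrite ger0_norm ?addr_ge0 ?divr_ge0 ?sqr_ge0//; lra.
  have := mulr_expR_sqr h3; rewrite (_ : 2 / 12 = 6^-1); last by field.
  exact: le_trans (ler_norm _).
Qed.

(** On the Fourier side this is the bound x exp (- x) <= exp (- 1) with x =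
    xi^2. Here the role of the spectral measure of f is played by the function
    m(s), the quadratic form of gauss s at f, that is, the squared norm of
    gauss (s / 2) * f. It is log-convex by Cauchy-Schwarz, equals the squared
    norm N of f at s = 0, and the squared norm of dgauss * f is - 2 m'(2). The
    last difference quotient of m on the grid 2 k / (p + 1) is bounded by
    [log_convex_drop]. *)
Lemma sharp_upper_1d : \int[leb]_z (conv dgauss f z ^+ 2) <= expR (- 1) * \int[leb]_x f x ^+ 2.
Proof.
have -> : \int[leb]_z (conv dgauss f z ^+ 2) = - 2 * \int[(leb \x leb)%E]_z (f z.1 * f z.2 * k2 (z.1 - z.2)).
  under eq_Rintegral do rewrite expr2.
  rewrite conv_pair//; try exact: integrable_dgauss; try exact: sqint_dgauss.
  rewrite -RintegralZl//.
    by apply: eq_Rintegral => z _; rewrite corr_dgauss /k2; field.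
  suff ik2 : leb.-integrable setT (EFin \o (k2 : T -> R)) by exact: (integrable_conv ik2 sf sf).
  have i2 := integrable_sqr_gauss (ltr0n R 2); have i1 := integrable_gauss (ltr0n R 2).
  by apply: (Rintg_eq (RintgB (RintgZl (8^-1) i2) (RintgZl (4^-1) i1))) => u; rewrite /k2; field.
set D := \int[_]_z (f z.1 * f z.2 * k2 (z.1 - z.2)).
(* The last step of the grid with p + 1 steps on [0, 2]; then p * x p tends to
   - 2 m'(2). *)
pose t (p : nat) : R := - (2 / p.+1%:R).
pose x p := m (t p + 2) - m 2.
have tn p : t p != 0 by rewrite oppr_eq0 mulf_neq0// invr_neq0.
have t0 : t p @[p --> \oo] --> (0 : R).
  rewrite -oppr0; apply: cvgN; rewrite -[X in _ --> X](mulr0 2); apply: cvgM; first exact: cvg_cst.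
  exact: cvg_harmonic.
have c1 : (t p)^-1 * x p @[p --> \oo] --> D.
  by have /cvgr_dnbhsP/(_ t (conj tn t0)) := m_deriv.
have xE p : x p = t p * ((t p)^-1 * x p) by rewrite mulVKf.
have x0 : x p @[p --> \oo] --> (0 : R).
  rewrite (_ : x = fun p => t p * ((t p)^-1 * x p)); last by apply/funext.
  by rewrite -(mul0r D); apply: cvgM.
have c2 : p%:R * x p @[p --> \oo] --> - 2 * D.
  have -> : (fun p => p%:R * x p) = (fun p => - 2 * ((t p)^-1 * x p) - x p).
    apply/funext => p; rewrite /t; field; by rewrite nat1r.
  rewrite -[X in _ --> X]subr0; apply: cvgB => //.
  by apply: cvgM => //; exact: cvg_cst.
rewrite (_ : -2 * D = lim (p%:R * x p @[p --> \oo])); last by apply/esym/cvg_lim.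
apply: limr_le; first by apply/cvg_ex; exists (-2 * D).
apply: nearW => p.
(* The value at k = 0 is the limit N of m at 0, not the value of the integral
   m 0, where the density is degenerate. *)
pose c k := if k == 0%N then N else m (2 * k%:R / p.+1%:R).
have pp k : (0 < k)%N -> 0 < 2 * k%:R / p.+1%:R :> R.
  by move=> k0; rewrite divr_gt0// mulr_gt0// ltr0n.
have := @log_convex_drop p c _ _.
have -> : c p.+1 = m 2 by rewrite /c /= mulfK.
have [->|pn] := eqVneq p 0%N.
  by move=> _; rewrite mul0r mulr_ge0 ?expR_ge0// Rintegral_ge0// => y _; exact: sqr_ge0.
have -> : c p = m (t p + 2).
  by rewrite /c (negbTE pn); congr m; rewrite /t; field; rewrite nat1r.
apply.
- case=> [|k]; first by rewrite /c /= Rintegral_ge0// => y _; exact: sqr_ge0.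
  by apply: m_ge0; exact: pp.
- move=> [|k] kp; rewrite /c /=.
    have := m_log_convex0 (pp 1%N isT); congr (_ <= _ * m _); field; by rewrite nat1r.
  have := @m_log_convex (2 * k.+2%:R / p.+1%:R) (2 / p.+1%:R).
  have -> : 2 * k.+2%:R / p.+1%:R - 2 / p.+1%:R = 2 * k.+1%:R / p.+1%:R :> R.
    by rewrite -mulrBl -{2}[2]mulr1 -mulrBr -[k.+2]addn1 natrD addrK.
  have -> : 2 * k.+2%:R / p.+1%:R + 2 / p.+1%:R = 2 * k.+3%:R / p.+1%:R :> R.
    by rewrite -mulrDl -{2}[2]mulr1 -mulrDr natr1.
  apply; first by rewrite divr_gt0.
  by rewrite ltr_pM2r ?invr_gt0// -{1}[2]mulr1 ltr_pM2l// ltr1n.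
Qed.
End Contraction.
End Upper.

(** * Adding variables: the upper bound *)
Section TensorProduct.
Context {R : realType}.

(** Scaling by c >= 0 commutes with the positive and the negative part, also
    when one of these has infinite integral. *)
Lemma RintegralZl_ge0 d (T : measurableType d) (mu : {measure set T -> \bar R}) (c : R) (g : T -> R) :
  0 <= c -> measurable_fun setT g -> \int[mu]_x (c * g x) = c * \int[mu]_x g x.
Proof.
move=> c0 mg; rewrite /Rintegral integralE [in RHS]integralE.
have E1 : (\int[mu]_x (fun x => (c * g x)%:E)^\+ x = c%:E * \int[mu]_x (fun x => (g x)%:E)^\+ x)%E.
  rewrite -ge0_integralZl//.
  - by apply: eq_integral => x _; rewrite !funeposE EFinM maxeMr// mule0.
  - by apply: measurable_funepos; exact/measurable_EFinP.
have E2 : (\int[mu]_x (fun x => (c * g x)%:E)^\- x = c%:E * \int[mu]_x (fun x => (g x)%:E)^\- x)%E.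
  rewrite -ge0_integralZl//.
  - by apply: eq_integral => x _; rewrite !funenegE EFinM -muleN maxeMr// mule0.
  - by apply: measurable_funeneg; exact/measurable_EFinP.
rewrite E1 E2.
set a := (\int[mu]_x _ ^\+ x)%E; set b := (\int[mu]_x _ ^\- x)%E.
have [->|cn] := eqVneq c 0; first by rewrite !mul0e sube0 /= mul0r.
have cp : 0 < c by rewrite lt_def cn.
have : (0 <= a)%E by exact: integral_ge0.
have : (0 <= b)%E by exact: integral_ge0.
case: a => [a| |]; case: b => [b| |] //= _ _; rewrite ?gt0_muley ?lte_fin//= ?mulr0//.
by rewrite mulrBr.
Qed.

Section two.
Context d1 d2 (X : measurableType d1) (Y : measurableType d2).
Variable m1 : {sigma_finite_measure set X -> \bar R}.
Variable m2 : {sigma_finite_measure set Y -> \bar R}.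

Lemma measurable_Rintegral_snd (f : X * Y -> R) : measurable_fun setT f ->
  measurable_fun setT (fun y => \int[m1]_x f (x, y)).
Proof.
move=> mf; apply: (measurable_Rintegral_fst m1 (f := fun z : Y * X => f (z.2, z.1))).
apply: (measurableT_comp mf); apply: measurable_fun_pair; [exact: measurable_snd|exact: measurable_fst].
Qed.

(** Almost every slice is integrable. On the remaining ones the inner integral
    is a junk value, which the null set makes harmless. *)
Lemma Rfubini2_ae (f : X * Y -> R) : (m1 \x m2)%E.-integrable setT (EFin \o f) ->
  m2.-integrable setT (EFin \o (fun y => \int[m1]_x f (x, y))) /\
  \int[(m1 \x m2)%E]_z f z = \int[m2]_y \int[m1]_x f (x, y).
Proof.
move=> if_.
have mf := Rintg_mf if_.
have mG : measurable_fun setT (fun y => \int[m1]_x f (x, y)) by exact: measurable_Rintegral_snd.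
have aeE : {ae m2, forall y, (\int[m1]_x (f (x, y))%:E)%E = (\int[m1]_x f (x, y))%:E}.
  have := ae_integrable2 if_; apply: filterS => y iy.
  by rewrite EFin_Rintegral.
have iG : m2.-integrable setT (EFin \o (fun y => \int[m1]_x f (x, y))).
  apply/integrableP; split; first exact/measurable_EFinP.
  have := (integrable21ltyP m1 m2 (measurable_int _ if_)).1 if_.
  apply: le_lt_trans; apply: ge0_le_integral => //=.
  - by apply/measurable_EFinP; exact: measurableT_comp.
  - apply: (measurable_fun_fubini_tonelli_G (fun z => `|f z|%:E)) => //.
    by apply/measurable_EFinP; exact: measurableT_comp.
  move=> y _; have my : measurable_fun setT (fun x => f (x, y)) by apply: (measurableT_comp mf); exact: measurable_pair2.
  have [fin|] := ltP (\int[m1]_x `|(f (x, y))%:E|)%E +oo%E; last by rewrite leye_eq => /eqP ->; rewrite leey.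
  have iy : m1.-integrable setT (EFin \o (fun x => f (x, y))).
    by apply/integrableP; split => //; exact/measurable_EFinP.
  have := le_normr_Rintegral measurableT iy.
  by rewrite -lee_fin => /le_trans; apply; rewrite EFin_Rintegral//; exact: integrable_abse iy.
split => //.
apply: EFin_inj; rewrite EFin_Rintegral// EFin_Rintegral// -(integral21_prod_meas1 if_).
apply: ae_eq_integral => //.
- exact: measurable_fubini_G if_.
- exact: measurable_int iG.
by apply: filterS aeE => y E _; rewrite /fubini_G.
Qed.

End two.

Lemma sharp_upper_1d_ereal (f : measurableTypeR R -> R) : measurable_fun setT f ->
  (\int[lebesgue_measure]_z (conv dgauss f z ^+ 2)%:E <= (expR (- 1))%:E * \int[lebesgue_measure]_x (f x ^+ 2)%:E)%E.
Proof.
move=> mf.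
have [fin|] := ltP (\int[lebesgue_measure]_x (f x ^+ 2)%:E)%E +oo%E; last first.
  by rewrite leye_eq => /eqP ->; rewrite gt0_muley ?leey// lte_fin expR_gt0.
have sf : sqint lebesgue_measure f.
  split => //; apply: ge0_integrable_lty => //; [exact: measurable_funX|by move=> x; exact: sqr_ge0].
have [_ i1] := sf; have [_ i2] := sqint_conv integrable_dgauss sqint_dgauss sf.
rewrite -EFin_Rintegral// -EFin_Rintegral// -EFinM lee_fin.
exact: sharp_upper_1d.
Qed.

Section Tensor.
Context d (V : measurableType d) (nu : {sigma_finite_measure set V -> \bar R}).
Local Notation T := (measurableTypeR R).
Local Notation leb := (@lebesgue_measure R).
Variable k : V * V -> R.
Hypothesis mk : measurable_fun setT k.
Hypothesis k0 : forall z, 0 <= k z.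
Hypothesis k1 : forall x, \int[nu]_y k (x, y) = 1.
Hypothesis ik : forall x, nu.-integrable setT (EFin \o (fun y => k (x, y))).
Hypothesis k2 : forall y, (\int[nu]_x (k (x, y))%:E = 1)%E.
Hypothesis sk : forall x, sqint nu (fun y => k (x, y)).
Local Notation mu := (leb \x nu)%E.

(** Only the first variable will be differentiated. The other ones enter
    through a kernel k whose rows and columns have mass 1, so that k acts as a
    contraction of L^2. *)
Definition tensor_op (g : R -> R) (F : T * V -> R) (x : T * V) : R :=
  \int[mu]_y (g (x.1 - y.1) * k (x.2, y.2) * F y).

Lemma sqint_prod d1 d2 (X : measurableType d1) (Y : measurableType d2)
  (m1 : {sigma_finite_measure set X -> \bar R}) (m2 : {sigma_finite_measure set Y -> \bar R})
  (a : X -> R) (b : Y -> R) : sqint m1 a -> sqint m2 b ->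
  sqint (m1 \x m2)%E (fun z => a z.1 * b z.2).
Proof.
move=> [ma ia] [mb ib]; split.
  by apply: measurable_funM; [exact: (measurableT_comp ma)|exact: (measurableT_comp mb)].
by apply: (Rintg_eq (integrable_prodM ia ib)) => z; rewrite exprMn.
Qed.

Lemma sqint_tensor_op (g : T -> R) x : sqint leb g -> sqint mu (fun y : T * V => g (x.1 - y.1) * k (x.2, y.2)).
Proof.
move=> sg.
exact: (sqint_prod (scales_sqint ler01 (scales_reflect x.1) sg) (sk x.2)).
Qed.

Lemma measurable_tensor_op (g : T -> R) F : measurable_fun setT g -> measurable_fun setT F ->
  measurable_fun setT (tensor_op g F).
Proof.
move=> mg mF.
apply: (measurable_Rintegral_fst (sigma_finite_prod leb nu) (f := fun z : (T * V) * (T * V) => g (z.1.1 - z.2.1) * k (z.1.2, z.2.2) * F z.2)).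
apply: measurable_funM; last exact: (measurableT_comp mF).
apply: measurable_funM.
  apply: (measurableT_comp mg); apply: measurable_funB.
    exact: (measurableT_comp measurable_fst).
  exact: (measurableT_comp measurable_fst).
apply: (measurableT_comp mk); apply: measurable_fun_pair.
  exact: (measurableT_comp measurable_snd).
exact: (measurableT_comp measurable_snd).
Qed.

(** By Jensen the square of the average over k is at most the average of the
    squares; integrating it over the last variables removes k, and the bound
    on the line applies slice by slice. *)
Lemma tensor_upper F : sqint mu F ->
  (\int[mu]_z (tensor_op dgauss F z ^+ 2)%:E <= (expR (- 1))%:E * \int[mu]_z (F z ^+ 2)%:E)%E.
Proof.
move=> sF; have [mF iF] := sF.
pose U (z : T * V) : R := conv dgauss (fun y0 => F (y0, z.2)) z.1.
have mU : measurable_fun setT U.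
  apply: (measurable_Rintegral_fst leb (f := fun z : (T * V) * T => dgauss (z.1.1 - z.2) * F (z.2, z.1.2))).
  apply: measurable_funM.
    apply: (measurableT_comp measurable_dgauss); apply: measurable_funB; last exact: measurable_snd.
    exact: (measurableT_comp measurable_fst).
  apply: (measurableT_comp mF); apply: measurable_fun_pair; first exact: measurable_snd.
  exact: (measurableT_comp measurable_snd).
have mkU : measurable_fun setT (fun z : (T * V) * V => k (z.1.2, z.2) * U (z.1.1, z.2) ^+ 2).
  apply: measurable_funM.
    apply: (measurableT_comp mk); apply: measurable_fun_pair; last exact: measurable_snd.
    exact: (measurableT_comp measurable_snd).
  apply: measurable_funX; apply: (measurableT_comp mU); apply: measurable_fun_pair; last exact: measurable_snd.
  exact: (measurableT_comp measurable_fst).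
have P x : ((tensor_op dgauss F x ^+ 2)%:E <= \int[nu]_y (k (x.2, y) * U (x.1, y) ^+ 2)%:E)%E.
  have := sqint_mul (sqint_tensor_op x sqint_dgauss) sF => /Rfubini2_ae.
  have E y : \int[leb]_y0 (dgauss (x.1 - (y0, y).1) * k (x.2, (y0, y).2) * F (y0, y)) = k (x.2, y) * U (x.1, y).
    rewrite -RintegralZl_ge0//.
      by apply: eq_Rintegral => y0 _ /=; ring.
    apply: measurable_funM.
      by apply: (measurableT_comp measurable_dgauss); exact: measurable_funB.
    by apply: (measurableT_comp mF); exact: measurable_pair2.
  move=> [i1 i2].
  rewrite /tensor_op i2; under eq_Rintegral do rewrite E.
  apply: (jensen_sqr (k := fun y => k (x.2, y)) (a := fun y => U (x.1, y))) => //.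
  - by apply: (measurableT_comp mk); exact: measurable_pair1.
  - by apply: (measurableT_comp mU); exact: measurable_pair1.
  - by apply: (Rintg_eq i1) => y; rewrite E.
have mkU' (x0 : T) : measurable_fun setT (fun z : V * V => (k (z.1, z.2) * U (x0, z.2) ^+ 2)%:E).
  apply/measurable_EFinP; apply: (measurableT_comp mkU (g := fun z : V * V => ((x0, z.1), z.2))).
  apply: measurable_fun_pair; last exact: measurable_snd.
  by apply: measurable_fun_pair => //; exact: measurable_fst.
apply: (@le_trans _ _ (\int[mu]_x \int[nu]_y (k (x.2, y) * U (x.1, y) ^+ 2)%:E)%E).
  apply: ge0_le_integral => //.
  - by move=> x _; rewrite lee_fin sqr_ge0.
  - apply/measurable_EFinP; apply: measurable_funX; apply: measurable_tensor_op => //; exact: measurable_dgauss.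
  - apply: (measurable_fun_fubini_tonelli_F (m2 := nu) (fun z : (T * V) * V => (k (z.1.2, z.2) * U (z.1.1, z.2) ^+ 2)%:E)) => //.
    + exact/measurable_EFinP.
    + by move=> z; rewrite lee_fin mulr_ge0 ?sqr_ge0.
rewrite (fubini_tonelli1 (fun x : T * V => \int[nu]_y (k (x.2, y) * U (x.1, y) ^+ 2)%:E)%E)//=; last 2 first.
- apply: (measurable_fun_fubini_tonelli_F (m2 := nu) (fun z : (T * V) * V => (k (z.1.2, z.2) * U (z.1.1, z.2) ^+ 2)%:E)) => //.
  + exact/measurable_EFinP.
  + by move=> z; rewrite lee_fin mulr_ge0 ?sqr_ge0.
- by move=> x; apply: integral_ge0 => y _; rewrite lee_fin mulr_ge0 ?sqr_ge0.
under eq_integral => x0 _.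
  rewrite /fubini_F /= (fubini_tonelli (fun z : V * V => (k (z.1, z.2) * U (x0, z.2) ^+ 2)%:E))//=; last first.
    by move=> z; rewrite lee_fin mulr_ge0 ?sqr_ge0.
  under eq_integral => y _.
    under eq_integral do rewrite EFinM.
    rewrite ge0_integralZr//=.
    - rewrite k2 mul1e; over.
    - by apply/measurable_EFinP; apply: (measurableT_comp mk); exact: measurable_pair2.
    - by move=> x _; rewrite lee_fin.
    - by rewrite lee_fin sqr_ge0.
  over.
rewrite /= (fubini_tonelli (fun z : T * V => (U z ^+ 2)%:E))/=; last 2 first.
- by apply/measurable_EFinP; exact: measurable_funX.
- by move=> z; rewrite lee_fin sqr_ge0.
rewrite (fubini_tonelli2 (fun z : T * V => (F z ^+ 2)%:E))/=; last 2 first.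
- by apply/measurable_EFinP; exact: measurable_funX.
- by move=> z; rewrite lee_fin sqr_ge0.
rewrite -ge0_integralZl ?lee_fin ?expR_ge0//.
- apply: ge0_le_integral => //.
  + by move=> y _; apply: integral_ge0 => x _; rewrite lee_fin sqr_ge0.
  + apply: (measurable_fun_fubini_tonelli_G (fun z : T * V => (U z ^+ 2)%:E)).
    * by apply/measurable_EFinP; exact: measurable_funX.
    * by move=> z; rewrite lee_fin sqr_ge0.
  + apply: measurable_funeM; apply: (measurable_fun_fubini_tonelli_G (fun z : T * V => (F z ^+ 2)%:E)).
    * by apply/measurable_EFinP; exact: measurable_funX.
    * by move=> z; rewrite lee_fin sqr_ge0.
  + move=> y _; rewrite /fubini_G.
    have mFy : measurable_fun setT (fun x : T => F (x, y)).
      by apply: (measurableT_comp mF); exact: measurable_pair2.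
    exact: (sharp_upper_1d_ereal mFy).
- apply: (measurable_fun_fubini_tonelli_G (fun z : T * V => (F z ^+ 2)%:E)).
  * by apply/measurable_EFinP; exact: measurable_funX.
  * by move=> z; rewrite lee_fin sqr_ge0.
- by move=> y _; apply: integral_ge0 => x _; rewrite lee_fin sqr_ge0.
Qed.

Lemma sqint_tensor_op_dgauss F : sqint mu F -> sqint mu (tensor_op dgauss F).
Proof.
move=> sF; have [mF iF] := sF.
have mK : measurable_fun setT (tensor_op dgauss F) by apply: measurable_tensor_op => //; exact: measurable_dgauss.
split => //; apply: ge0_integrable_lty; first exact: measurable_funX.
  by move=> x; exact: sqr_ge0.
apply: (le_lt_trans (tensor_upper sF)); rewrite lte_mul_pinfty ?lee_fin ?expR_ge0//.
exact: (integrable_lty measurableT iF).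
Qed.

(** Differentiation under the integral sign. For |h| <= 1 the derivatives
    dgauss (h + u) are dominated by a gaussian in u of larger variance. *)
Lemma tensor_op_derive F x : sqint mu F ->
  h^-1 *: (tensor_op (gauss 1) F (x.1 + h, x.2) - tensor_op (gauss 1) F x) @[h --> (0:R)^'] --> tensor_op dgauss F x.
Proof.
move=> sF; have [mF _] := sF.
pose f (h : R) (y : T * V) := gauss 1 (h + x.1 - y.1) * k (x.2, y.2) * F y.
have df (h : R) (y : T * V) : is_derive h 1 (fun h : R => f h y : R) (dgauss (h + x.1 - y.1) * k (x.2, y.2) * F y).
  have d0 : is_derive h 1 (fun h : R => h + x.1 - y.1) 1.
    by apply: is_derive_eq; rewrite addr0 subr0.
  have d1 := @is_derive1_comp R (gauss 1) _ h _ _ (is_derive_gauss (h + x.1 - y.1) ltr01) d0.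
  have d2 := is_deriveZ (k (x.2, y.2) * F y) d1.
  rewrite (_ : (fun h : R => f h y : R) = (k (x.2, y.2) * F y) \*: (gauss 1 \o (fun h : R => h + x.1 - y.1))); last first.
    by apply/funext => h'; rewrite /f /= /GRing.scale/=; ring.
  by apply: is_derive_eq; rewrite /GRing.scale/= /dgauss divr1; ring.
have pd h y : partial1of2 f h y = dgauss (h + x.1 - y.1) * k (x.2, y.2) * F y.
  by rewrite partial1of2E; have := df h y => dfy; rewrite derive_val.
have [C hC] := @dgauss_bound R.
have C0 : 0 <= C by have := hC 0; rewrite expr0n mulr0 oppr0 expR0 mulr1; apply: le_trans.
have c0 : 0 < (8^-1 : R) by rewrite invr_gt0.
pose g8 (u : R) := expR (- (8^-1 * u ^+ 2)).
pose G (y : T * V) := C * expR (4^-1) * (g8 (x.1 - y.1) * k (x.2, y.2) * `|F y|).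
have sg8 : sqint leb (g8 : T -> R).
  apply: (@sqint_int_bound _ _ _ _ _ 1); [exact: measurable_expR_sqr| |exact: integrable_expR_sqr].
  by move=> u; rewrite ger0_norm ?expR_ge0// expR_le1 oppr_le0 mulr_ge0 ?sqr_ge0.
have iG : mu.-integrable setT (EFin \o G).
  by apply: RintgZl; apply: sqint_mul; [exact: (sqint_tensor_op x sg8)|exact: sqint_norm].
have := @cvg_differentiation_under_integral R _ _ mu f setT measurableT 0 (-1) 1 _ _ _ G _ iG _.
have -> : \int[mu]_y partial1of2 f 0 y = tensor_op dgauss F x.
  by rewrite /tensor_op; apply: eq_Rintegral => y _; rewrite pd add0r.
have -> : (fun h : R => h^-1 *: ((\int[mu]_y f (h + 0) y) - \int[mu]_y f 0 y)) =
   (fun h : R => h^-1 *: (tensor_op (gauss 1) F (x.1 + h, x.2) - tensor_op (gauss 1) F x)).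
  have E1 (h : R) : \int[mu]_y f (h + 0) y = tensor_op (gauss 1) F (x.1 + h, x.2).
    by rewrite /tensor_op; apply: eq_Rintegral => y _; rewrite /f addr0 [h + _]addrC.
  have E2 : \int[mu]_y f 0 y = tensor_op (gauss 1) F x.
    by rewrite /tensor_op; apply: eq_Rintegral => y _; rewrite /f add0r.
  by apply/funext => h; rewrite E1 E2.
apply.
- by rewrite /= in_itv/= ltrN10 ltr01.
- move=> h _; apply: sqint_mul => //; exact: (sqint_tensor_op (h + x.1, x.2) (sqint_gauss ltr01)).
- by move=> h y _ _; have [] := df h y.
- by move=> y; rewrite /G !mulr_ge0 ?expR_ge0.
- move=> h y /=; rewrite in_itv/= => /andP[h1 h2] _.
  rewrite pd normrM normrM (ger0_norm (k0 _)) /G.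
  rewrite !mulrA ler_wpM2r// ler_wpM2r//.
  rewrite (le_trans (hC _))// -mulrA -expRD ler_wpM2l// ler_expR.
  set u := x.1 - y.1; have -> : h + x.1 - y.1 = h + u by rewrite /u addrA.
  have : h ^+ 2 <= 1 by nra.
  have := sqr_ge0 (u + 2 * h); lra.
Qed.

End Tensor.
End TensorProduct.

(** * Adding variables: the lower bound *)
Section LowerBound.
Context {R : realType}.
Local Notation T := (measurableTypeR R).
Local Notation leb := (@lebesgue_measure R).

Lemma measurable_cosM (xi : R) : measurable_fun setT (fun u : T => cos (xi * u)).
Proof. by apply: measurableT_comp; [apply: continuous_measurable_fun; exact: continuous_cos|exact: measurable_funM]. Qed.

Lemma measurable_sinM (xi : R) : measurable_fun setT (fun u : T => sin (xi * u)).
Proof. by apply: measurableT_comp; [apply: continuous_measurable_fun; exact: continuous_sin|exact: measurable_funM]. Qed.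

Lemma integrable_bounded_mul (b : R) (g f : T -> R) : measurable_fun setT g -> (forall x, `|g x| <= b) ->
  leb.-integrable setT (EFin \o f) -> leb.-integrable setT (EFin \o (fun x => g x * f x)).
Proof.
move=> mg gb if_; apply: (Rintg_le (g := fun x => b * `|f x|)).
- by apply: measurable_funM => //; exact: Rintg_mf if_.
- by move=> x; rewrite normrM ler_wpM2r.
- by apply: RintgZl; exact: integrable_abse if_.
Qed.

Lemma norm_sin_le1 (x : R) : `|sin x| <= 1.
Proof. by rewrite ler_norml sin_geN1 sin_le1. Qed.
Lemma norm_cos_le1 (x : R) : `|cos x| <= 1.
Proof. by rewrite ler_norml cos_geN1 cos_le1. Qed.

Section gauss_char.
Variable s : R.
Hypothesis s0 : 0 < s.

Let Cs (xi : R) := \int[leb]_u (cos (xi * u) * gauss s u).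

(** Integration by parts: the derivative of u |-> sin (xi u) gauss s u has
    zero integral. *)
Lemma gauss_sin_ibp (xi : R) : \int[leb]_u (u * sin (xi * u) * gauss s u) = s * xi * Cs xi.
Proof.
have sn := lt0r_neq0 s0.
have icos : leb.-integrable setT (EFin \o (fun u : T => cos (xi * u) * gauss s u)).
  apply: (integrable_bounded_mul (b := 1)); [exact: measurable_cosM| |exact: integrable_gauss].
  by move=> x; exact: norm_cos_le1.
have isin : leb.-integrable setT (EFin \o (fun u : T => u * sin (xi * u) * gauss s u)).
  have := integrable_bounded_mul (measurable_sinM xi) (fun x => norm_sin_le1 _) (integrable_id_gauss s0).
  by move/Rintg_eq; apply => u; ring.
have c0 : 0 < (4 * s)^-1 by rewrite invr_gt0 mulr_gt0.
have H : \int[leb]_u (xi * (cos (xi * u) * gauss s u) - s^-1 * (u * sin (xi * u) * gauss s u)) = 0.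
  apply: (Rintegral_derive0 (F := fun u => sin (xi * u) * gauss s u)
    (C := (Num.sqrt (2 * pi * s))^-1 * (`|xi| + s^-1 * (1 + (4 * s)^-1^-1))) c0).
  - apply: (integrable_bounded_mul (b := 1)); [exact: measurable_sinM| |exact: integrable_gauss].
    by move=> x; exact: norm_sin_le1.
  - move=> u; have d := is_derive_gauss u s0.
    have d1 : is_derive u 1 (fun u : R => xi * u) xi.
      by apply: is_derive_eq; rewrite /GRing.scale/= mulr1.
    have d2 := @is_derive1_comp R sin _ u _ _ (is_derive_sin _) d1.
    have d3 := is_deriveM d2 d.
    by apply: is_derive_eq; rewrite /GRing.scale/=; field.
  - move=> u; rewrite /gauss.
    set p := (Num.sqrt (2 * pi * s))^-1.
    have p0 : 0 <= p by rewrite invr_ge0 sqrtr_ge0.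
    rewrite (_ : xi * _ - _ = p * ((xi * cos (xi * u) - s^-1 * (u * sin (xi * u))) * expR (- (2 * (4 * s)^-1 * u ^+ 2)))); last first.
      have -> : 2 * (4 * s)^-1 * u ^+ 2 = u ^+ 2 / (2 * s) by field.
      by ring.
    rewrite normrM (ger0_norm p0) -[leRHS]mulrA ler_wpM2l//; apply: mulr_expR_sqr.
    rewrite (le_trans (ler_normB _ _))// mulrDl lerD//.
      rewrite normrM ler_wpM2l//.
      by apply: (le_trans (norm_cos_le1 _)); rewrite (le_trans _ (expR_ge1Dx _))// lerDl mulr_ge0 ?sqr_ge0// ltW.
    rewrite normrM (ger0_norm (x:=s^-1)) ?invr_ge0 ?(ltW s0)// -mulrA ler_wpM2l ?invr_ge0 ?(ltW s0)//.
    rewrite normrM; apply: le_trans (norm_le_expR u c0).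
    by rewrite ler_piMr// norm_sin_le1.
rewrite RintegralB// in H; try by apply: RintgZl.
rewrite !RintegralZl// in H.
apply: (mulfI (invr_neq0 sn)); rewrite !mulrA mulVf// mul1r.
by apply/esym/eqP; rewrite -subr_eq0 H.
Qed.

Let Cs_derive (a : R) : is_derive a 1 Cs (- (s * a * Cs a)).
Proof.
pose f (xi : R) (u : T) := cos (xi * u) * gauss s u.
have df (xi : R) (u : T) : is_derive xi 1 (fun xi : R => f xi u : R) (- (u * sin (xi * u) * gauss s u)).
  have d1 : is_derive xi 1 (fun xi : R => xi * u) u.
    by apply: is_derive_eq; rewrite /GRing.scale/=; ring.
  have d2 := @is_derive1_comp R cos _ xi _ _ (is_derive_cos _) d1.
  have d3 := is_deriveZ (gauss s u) d2.
  rewrite (_ : (fun xi : R => f xi u : R) = gauss s u \*: (cos \o (fun xi : R => xi * u))); last first.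
    by apply/funext => h'; rewrite /f /= /GRing.scale/=; ring.
  by apply: is_derive_eq; rewrite /GRing.scale/=; ring.
have pd xi u : partial1of2 f xi u = - (u * sin (xi * u) * gauss s u).
  by rewrite partial1of2E; have := df xi u => dfy; rewrite derive_val.
have iG := integrable_abse (integrable_id_gauss s0).
have a1 : a - 1 < a by rewrite ltrBlDr ltrDl.
have a2 : a < a + 1 by rewrite ltrDl.
have := @cvg_differentiation_under_integral R _ _ leb f setT measurableT a (a - 1) (a + 1) _ _ _ (fun u => `|u * gauss s u|) _ iG _.
have -> : \int[leb]_y partial1of2 f a y = - (s * a * Cs a).
  rewrite -gauss_sin_ibp -mulN1r -RintegralZl//.
    by apply: eq_Rintegral => u _; rewrite pd mulN1r.
  have := integrable_bounded_mul (measurable_sinM a) (fun x => norm_sin_le1 _) (integrable_id_gauss s0).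
  by move/Rintg_eq; apply => u; ring.
move=> H; have {}H : h^-1 *: (Cs (h + a) - Cs a) @[h --> (0:R)^'] --> - (s * a * Cs a).
  apply: H.
  - by rewrite /= in_itv/= a1 a2.
  - move=> xi _; apply: (integrable_bounded_mul (b := 1)); [exact: measurable_cosM| |exact: integrable_gauss].
    by move=> x; exact: norm_cos_le1.
  - by move=> xi u _ _; have [] := df xi u.
  - by move=> u.
  - by move=> xi u _ _; rewrite pd normrN !normrM mulrAC ler_piMr ?mulr_ge0// norm_sin_le1.
have dC : derivable Cs a 1.
  by apply/cvg_ex; exists (- (s * a * Cs a)); under eq_fun do rewrite scaler1.
split => //; rewrite /derive; apply/cvg_lim => //.
by under eq_fun do rewrite scaler1.
Qed.

(** The integral C satisfies C' = - s xi C by [gauss_sin_ibp], so C(xi) exp (s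
    xi^2 / 2) is constant. *)
Lemma gauss_char (xi : R) : \int[leb]_u (cos (xi * u) * gauss s u) = expR (- (s * xi ^+ 2 / 2)).
Proof.
pose E (x : R) := Cs x * expR (s * x ^+ 2 / 2).
have dE (x : R) : is_derive x 1 (E : R -> R) 0.
  have d1 : is_derive x 1 (fun x : R => s * x ^+ 2 / 2) (s * x).
    by apply: is_derive_eq; rewrite /GRing.scale/=; field.
  have d2 := @is_derive1_comp R expR _ x _ _ (is_derive_expR _) d1.
  have d3 := is_deriveM (Cs_derive x) d2.
  by apply: is_derive_eq; rewrite /GRing.scale/=; ring.
have E0 : E xi = E 0 by apply: is_derive_0_is_cst.
have E1 : E 0 = 1.
  rewrite /E /Cs expr0n mulr0 mul0r expR0 mulr1 -(Rintegral_gauss s0).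
  by apply: eq_Rintegral => u _; rewrite mul0r cos0 mul1r.
rewrite -/(Cs xi); move: E0; rewrite E1 /E => /(congr1 (fun z => z * expR (- (s * xi ^+ 2 / 2)))).
by rewrite mul1r -(mulrA (Cs xi)) -expRD subrr expR0 mulr1.
Qed.

Lemma gauss_sin (xi : R) : \int[leb]_u (u * sin (xi * u) * gauss s u) = s * xi * expR (- (s * xi ^+ 2 / 2)).
Proof. by rewrite gauss_sin_ibp /Cs gauss_char. Qed.
End gauss_char.

Section pairing.
Variables (sg xi : R).
Hypothesis sg0 : 0 < sg.
Let si (x : R) := sin (xi * x) * gauss sg x.
Let co (x : R) := cos (xi * x) * gauss sg x.

Lemma sqint_si : sqint leb (si : T -> R).
Proof.
apply: (@sqint_bound R _ T leb _ (gauss sg)); last exact: sqint_gauss.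
  by apply: measurable_funM; [exact: measurable_sinM|exact: measurable_gauss].
by move=> x; rewrite normrM (ger0_norm (gauss_ge0 _ _)) ler_piMl ?gauss_ge0 ?norm_sin_le1.
Qed.

Lemma sqint_co : sqint leb (co : T -> R).
Proof.
apply: (@sqint_bound R _ T leb _ (gauss sg)); last exact: sqint_gauss.
  by apply: measurable_funM; [exact: measurable_cosM|exact: measurable_gauss].
by move=> x; rewrite normrM (ger0_norm (gauss_ge0 _ _)) ler_piMl ?gauss_ge0 ?norm_cos_le1.
Qed.

(** Since cos^2 + sin^2 = 1, the frequency disappears from the sum of the two
    norms. Together si and co stand for the complex wave packet exp (i xi x)
    gauss sg x. *)
Lemma si_co_norm : \int[leb]_x (si x ^+ 2) + \int[leb]_x (co x ^+ 2) = gauss (sg + sg) 0.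
Proof.
have [_ i1] := sqint_si; have [_ i2] := sqint_co.
rewrite -RintegralD// -corr_gauss// /corr; apply: eq_Rintegral => x _.
rewrite addr0 /si /co -[RHS]mul1r -(cos2Dsin2 (xi * x)).
set a := cos _; set b := sin _; set c := gauss sg x; ring.
Qed.

Lemma fubini_inner (a b : T -> R) : sqint leb a -> sqint leb b ->
  \int[leb]_x (a x * conv dgauss b x) = \int[(leb \x leb)%E]_z (a z.1 * b z.2 * dgauss (z.1 - z.2)).
Proof.
move=> sa sb; rewrite Rfubini1.
- apply: eq_Rintegral => x _; rewrite /conv -RintegralZl//.
    by apply: eq_Rintegral => y _ /=; ring.
  exact: (sqint_mul (scales_sqint ler01 (scales_reflect x) sqint_dgauss)).
- exact: integrable_conv integrable_dgauss sa sb.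
move=> x; apply: (Rintg_eq (RintgZl (a x) (sqint_mul (scales_sqint ler01 (scales_reflect x) sqint_dgauss) sb))) => y /=.
by ring.
Qed.

(** Antisymmetrizing turns sin (xi x) cos (xi y) into sin (xi (x - y)), so
    that the double integral depends on x and y through a correlation of
    gaussians. *)
Lemma pair_si_co :
  \int[leb]_x (si x * conv dgauss co x) - \int[leb]_x (co x * conv dgauss si x) =
  - \int[leb]_u (u * sin (xi * u) * (gauss 1 u * gauss (sg + sg) u)).
Proof.
rewrite !fubini_inner//; try exact: sqint_si; try exact: sqint_co.
have i1 := integrable_conv integrable_dgauss sqint_si sqint_co.
have i2 := integrable_conv integrable_dgauss sqint_co sqint_si.
rewrite -RintegralB//.
pose psi (u : R) := dgauss u * sin (xi * u).
have ipsi : leb.-integrable setT (EFin \o (psi : T -> R)).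
  have := integrable_bounded_mul (measurable_sinM xi) (fun x => norm_sin_le1 _) integrable_dgauss.
  by move/Rintg_eq; apply => u; rewrite /psi mulrC.
pose b : R := (Num.sqrt (2 * pi * sg))^-1.
have gb x : gauss sg x <= b by rewrite gauss_le// ltW.
have iconv := integrable_conv ipsi (sqint_gauss sg0) (sqint_gauss sg0).
transitivity (\int[(leb \x leb)%E]_z (gauss sg z.1 * gauss sg z.2 * psi (z.1 - z.2))).
  by apply: eq_Rintegral => z _; rewrite /si /co /psi mulrBr sinB; ring.
have spsi : sqint leb (psi : T -> R).
  apply: (@sqint_bound R _ T leb _ (fun x => `|dgauss x|)); last exact: sqint_norm sqint_dgauss.
    by apply: measurable_funM; [exact: measurable_dgauss|exact: measurable_sinM].
  by move=> x; rewrite normrM ler_piMr ?norm_sin_le1.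
rewrite Rfubini2//; last first.
  move=> y /=; have := sqint_mul (sqint_gauss sg0) (scales_sqint ler01 (scales_shift (- y)) spsi).
  by move=> i; apply: (Rintg_eq (RintgZl (gauss sg y) i)) => x; ring.
pose H (z : T * T) := gauss sg z.1 * (gauss sg (z.2 + z.1) * psi z.2).
have mH : measurable_fun setT H.
  apply: measurable_funM; first exact: (measurableT_comp (measurable_gauss sg)).
  apply: measurable_funM; last exact: (measurableT_comp (Rintg_mf ipsi)).
  apply: (measurableT_comp (measurable_gauss sg)); apply: measurable_funD; [exact: measurable_snd|exact: measurable_fst].
have iH : (leb \x leb)%E.-integrable setT (EFin \o H).
  have := integrable_prodM (integrable_gauss sg0) (RintgZl b (integrable_abse ipsi)).
  apply: Rintg_le => // z.
  rewrite /H (normrM (gauss sg z.1)) (normrM (gauss sg (z.2 + z.1))) !(ger0_norm (gauss_ge0 _ _)).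
  by rewrite ler_wpM2l ?gauss_ge0// ler_wpM2r.
transitivity (\int[leb]_y \int[leb]_u H (y, u)).
  apply: eq_Rintegral => y _ /=.
  have sp := sqint_mul (sqint_gauss sg0) (scales_sqint ler01 (scales_shift (- y)) spsi).
  rewrite -(Rintegral_shift y); last first.
    by apply: (Rintg_eq (RintgZl (gauss sg y) sp)) => x; ring.
  by apply: eq_Rintegral => u _; rewrite /H /= addrK; ring.
rewrite -Rfubini1//; last first.
  move=> y; have := sqint_mul (scales_sqint ler01 (scales_shift y) (sqint_gauss sg0)) spsi.
  by move/(RintgZl (gauss sg y)).
rewrite Rfubini2//; last first.
  move=> u; have := sqint_mul (sqint_gauss sg0) (scales_sqint ler01 (scales_shift u) (sqint_gauss sg0)).
  by move/(RintgZl (psi u))/Rintg_eq; apply => y; rewrite /H /= (addrC u); ring.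
have ig : leb.-integrable setT (EFin \o (fun u : T => u * sin (xi * u) * (gauss 1 u * gauss (sg + sg) u))).
  have q0 : 0 < 1 * (sg + sg) / (1 + (sg + sg)) by rewrite divr_gt0 ?mulr_gt0 ?addr_gt0.
  have := integrable_bounded_mul (measurable_sinM xi) (fun x => norm_sin_le1 _) (integrable_id_gauss q0).
  move/(RintgZl (gauss (1 + (sg + sg)) 0))/Rintg_eq; apply => u.
  have := gauss_mul u 0 ltr01 (addr_gt0 sg0 sg0); rewrite addr0 mulr0 mul0r addr0 => ->.
  by ring.
rewrite -mulN1r -RintegralZl//; apply: eq_Rintegral => u _.
rewrite -corr_gauss// /corr [RHS](_ : _ = psi u * \int[leb]_w (gauss sg w * gauss sg (w + u))); last first.
  by rewrite /psi /dgauss; ring.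
rewrite -RintegralZl//; last first.
  exact: (sqint_mul (sqint_gauss sg0) (scales_sqint ler01 (scales_shift u) (sqint_gauss sg0))).
by apply: eq_Rintegral => y _; rewrite /H /= (addrC u); ring.
Qed.

End pairing.

Section tensor_lower.
Context d (V : measurableType d) (nu : {sigma_finite_measure set V -> \bar R}).
Variable k : V * V -> R.
Hypothesis sk : forall x, sqint nu (fun y => k (x, y)).
Local Notation mu := (leb \x nu)%E.
Definition kernel_op (chi : V -> R) (x : V) : R := \int[nu]_y (k (x, y) * chi y).

Lemma tensor_op_prod (f : T -> R) (chi : V -> R) x : sqint leb f -> sqint nu chi ->
  tensor_op nu k dgauss (fun y : T * V => f y.1 * chi y.2) x = conv dgauss f x.1 * kernel_op chi x.2.
Proof.
move=> sf sc; rewrite /tensor_op /conv /kernel_op -(Rintegral_prodM (m1 := leb) (m2 := nu) (a := fun y => dgauss (x.1 - y) * f y) (b := fun y => k (x.2, y) * chi y)).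
- by apply: eq_Rintegral => y _ /=; ring.
- exact: (sqint_mul (scales_sqint ler01 (scales_reflect x.1) sqint_dgauss)).
- exact: sqint_mul.
Qed.

Let aux (p s : R) : p != 0 -> s != 0 -> 1 + 2 * s != 0 ->
  (2 * p * (1 + (s + s)))^-1 = 2 * s / (1 + 2 * s) * (2 * p * (s + s))^-1.
Proof.
have -> : s + s = 2 * s by ring.
by move=> p0 s0' q0; field; rewrite p0 s0' q0.
Qed.

(** Test the bound on products of the wave packets with chi. Their frequency
    is the one that maximizes the resulting integral. The loss tau = 2 sg / (1
    + 2 sg) tends to 1 as the packets spread, that is, as sg grows. *)
Lemma tensor_lower (c sg : R) (chi : V -> R) : 0 <= c -> 0 < sg ->
  (forall F : T * V -> R, sqint mu F -> sqint mu (tensor_op nu k dgauss F) /\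
     \int[mu]_x (tensor_op nu k dgauss F x ^+ 2) <= c ^+ 2 * \int[mu]_x (F x ^+ 2)) ->
  sqint nu chi -> sqint nu (kernel_op chi) -> 0 <= \int[nu]_x (chi x * kernel_op chi x) ->
  2 * sg / (1 + 2 * sg) * expR (- 2^-1) * \int[nu]_x (chi x * kernel_op chi x) <= c * \int[nu]_x (chi x ^+ 2).
Proof.
move=> c0 sg0 bd sc sv pos.
set B := \int[nu]_x (chi x * kernel_op chi x) in pos *; set X := \int[nu]_x (chi x ^+ 2).
set tau := 2 * sg / (1 + 2 * sg).
have ss0 : 0 < sg + sg by rewrite addr_gt0.
have q0 : 0 < 1 + 2 * sg by rewrite addr_gt0 ?mulr_gt0.
have t0 : 0 < tau by rewrite divr_gt0 ?mulr_gt0.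
(* The maximum of tau xi exp (- tau xi^2 / 2), which is the integral of u sin
   (xi u) against the gaussian of variance tau. *)
pose xi := (Num.sqrt tau)^-1.
have st0 : 0 < Num.sqrt tau by rewrite sqrtr_gt0.
have xi2 : xi ^+ 2 = tau^-1 by rewrite exprVn sqr_sqrtr// ltW.
pose si (x : R) := sin (xi * x) * gauss sg x.
pose co (x : R) := cos (xi * x) * gauss sg x.
have ssi : sqint leb (si : T -> R) by exact: sqint_si.
have sco : sqint leb (co : T -> R) by exact: sqint_co.
have cs (a b : T -> R) : sqint leb a -> sqint leb b ->
  `|(\int[leb]_x (a x * conv dgauss b x)) * B| <= c * ((\int[leb]_x (a x ^+ 2)) * X + (\int[leb]_x (b x ^+ 2)) * X) / 2.
  move=> sa sb.
  pose S (x : T * V) := a x.1 * chi x.2; pose C (x : T * V) := b x.1 * chi x.2.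
  have sS : sqint mu S by exact: sqint_prod.
  have sC : sqint mu C by exact: sqint_prod.
  have [sK bK] := bd _ sC.
  have scb : sqint leb (conv dgauss b) by apply: sqint_conv => //; [exact: integrable_dgauss|exact: sqint_dgauss].
  have E : \int[mu]_x (S x * tensor_op nu k dgauss C x) = (\int[leb]_x (a x * conv dgauss b x)) * B.
    rewrite /B -(Rintegral_prodM (m1 := leb) (m2 := nu) (a := fun x => a x * conv dgauss b x) (b := fun y => chi y * kernel_op chi y)).
    - by apply: eq_Rintegral => x _ /=; rewrite tensor_op_prod// /S; ring.
    - exact: sqint_mul.
    - exact: sqint_mul.
  have nS : \int[mu]_x (S x ^+ 2) = \int[leb]_x (a x ^+ 2) * X.
    have [_ ia] := sa; have [_ ic] := sc.
    rewrite /X -(Rintegral_prodM (m1 := leb) (m2 := nu) (a := fun x => a x ^+ 2) (b := fun y => chi y ^+ 2))//.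
    by apply: eq_Rintegral => x _ /=; rewrite /S exprMn.
  have nC : \int[mu]_x (C x ^+ 2) = \int[leb]_x (b x ^+ 2) * X.
    have [_ ib] := sb; have [_ ic] := sc.
    rewrite /X -(Rintegral_prodM (m1 := leb) (m2 := nu) (a := fun x => b x ^+ 2) (b := fun y => chi y ^+ 2))//.
    by apply: eq_Rintegral => x _ /=; rewrite /C exprMn.
  rewrite -E; have H := cauchy_schwarz sS sK.
  have P0 : 0 <= \int[mu]_x (S x ^+ 2) by apply: Rintegral_ge0 => x _; exact: sqr_ge0.
  have Q0 : 0 <= \int[mu]_x (C x ^+ 2) by apply: Rintegral_ge0 => x _; exact: sqr_ge0.
  rewrite -nS -nC.
  set P := \int[mu]_x (S x ^+ 2) in H P0 *; set Q := \int[mu]_x (C x ^+ 2) in bK Q0 *.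
  have W0 : 0 <= c * (P + Q) / 2 by rewrite divr_ge0// mulr_ge0// addr_ge0.
  rewrite -(ger0_norm W0) -ler_sqr ?nnegrE ?normr_ge0// !real_normK ?num_real//.
  apply: (le_trans H); apply: (@le_trans _ _ (P * (c ^+ 2 * Q))); first by rewrite ler_wpM2l.
  rewrite -subr_ge0 (_ : _ - _ = c ^+ 2 * ((P - Q) ^+ 2 / 4)); last by field.
  by rewrite mulr_ge0 ?sqr_ge0// divr_ge0 ?sqr_ge0.
(* Add the two bounds: the left sides combine to the antisymmetric pairing,
   the right sides to the total norm of the packets. *)
have h1 := cs _ _ ssi sco; have h2 := cs _ _ sco ssi.
have p : \int[leb]_x (si x * conv dgauss co x) - \int[leb]_x (co x * conv dgauss si x) =
  - \int[leb]_u (u * sin (xi * u) * (gauss 1 u * gauss (sg + sg) u)) := pair_si_co xi sg0.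
have n : \int[leb]_x (si x ^+ 2) + \int[leb]_x (co x ^+ 2) = gauss (sg + sg) 0 := si_co_norm xi sg0.
have e1 : 1 * (sg + sg) / (1 + (sg + sg)) = tau by rewrite /tau; congr (_ / (_ + _)); ring.
have J : \int[leb]_u (u * sin (xi * u) * (gauss 1 u * gauss (sg + sg) u)) = gauss (1 + (sg + sg)) 0 * (tau * xi * expR (- 2^-1)).
  have E u : u * sin (xi * u) * (gauss 1 u * gauss (sg + sg) u) = gauss (1 + (sg + sg)) 0 * (u * sin (xi * u) * gauss tau u).
    have := gauss_mul u 0 ltr01 ss0; rewrite addr0 mulr0 mul0r addr0 e1 => ->; ring.
  under eq_Rintegral do rewrite E.
  rewrite RintegralZl//; last first.
    have := integrable_bounded_mul (measurable_sinM xi) (fun x => norm_sin_le1 _) (integrable_id_gauss t0).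
    by move/Rintg_eq; apply => u; ring.
  by rewrite gauss_sin// xi2 divff ?lt0r_neq0// div1r.
have g1 : gauss (1 + (sg + sg)) 0 = Num.sqrt tau * gauss (sg + sg) 0.
  rewrite /gauss expr0n !mul0r oppr0 expR0 !mulr1 -sqrtrV ?mulr_ge0 ?pi_ge0 ?addr_ge0 ?ltW//.
  rewrite -[(Num.sqrt (2 * pi * (sg + sg)))^-1]sqrtrV ?mulr_ge0 ?pi_ge0 ?ltW// -sqrtrM ?ltW//.
  congr Num.sqrt; rewrite /tau; exact: aux (lt0r_neq0 (pi_gt0 R)) (lt0r_neq0 sg0) (lt0r_neq0 q0).
have G0 : 0 < gauss (sg + sg) 0 by exact: gauss_gt0.
rewrite J g1 in p.
have xs : Num.sqrt tau * xi = 1 by rewrite divff// lt0r_neq0.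
have p' : \int[leb]_x (si x * conv dgauss co x) - \int[leb]_x (co x * conv dgauss si x) = - (gauss (sg + sg) 0 * (tau * expR (- 2^-1))).
  rewrite p; congr (- _).
  have comb (r x g t e : R) : r * g * (t * x * e) = (r * x) * (g * (t * e)) by ring.
  by rewrite comb xs mul1r.
set A1 := \int[leb]_x (si x * conv dgauss co x) in h1 p'; set A2 := \int[leb]_x (co x * conv dgauss si x) in h2 p'.
set N1 := \int[leb]_x (si x ^+ 2) in h1 h2 n; set N2 := \int[leb]_x (co x ^+ 2) in h1 h2 n.
rewrite -(ler_pM2l G0).
have -> : gauss (sg + sg) 0 * (tau * expR (- 2^-1) * B) = - ((A1 - A2) * B) by rewrite p'; ring.
rewrite -n.
move: h1 h2; rewrite !ler_norml => /andP[h11 _] /andP[_ h22]; lra.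
Qed.
End tensor_lower.

(** Let tau tend to 1; Bernoulli's inequality makes this quantitative. *)
Lemma le_of_powers (a c : R) (n : nat) :
  (forall tau, 0 < tau -> tau < 1 -> tau ^+ n * a <= c) -> 0 <= a -> a <= c.
Proof.
move=> H a0; rewrite leNgt; apply/negP => ca.
have an : 0 < a - c by rewrite subr_gt0.
have bern (t : R) m : 0 <= t -> t <= 1 -> 1 - m%:R * t <= (1 - t) ^+ m.
  move=> t0 t1; elim: m => [|m IH]; first by rewrite mul0r subr0 expr0.
  rewrite exprS; have := ler_wpM2l (_ : 0 <= 1 - t) IH; rewrite subr_ge0 => /(_ t1).
  apply: le_trans; rewrite -natr1; have : 0 <= m%:R * t ^+ 2 by rewrite mulr_ge0 ?sqr_ge0.
  nra.
pose t := (a - c) / (2 * ((n%:R + 1) * (a + 1) + (a - c))).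
have D0 : 0 < (n%:R + 1) * (a + 1) by rewrite mulr_gt0// ltr_wpDl.
have D1 : 0 < 2 * ((n%:R + 1) * (a + 1) + (a - c)) by rewrite mulr_gt0// addr_gt0.
have t0 : 0 < t by rewrite divr_gt0.
have t1 : t < 1 by rewrite ltr_pdivrMr// mul1r; lra.
have := H (1 - t) _ _; rewrite subr_gt0 t1 ltrBlDr ltrDl t0 => /(_ isT isT).
apply/negP; rewrite -ltNge.
apply: (@lt_le_trans _ _ ((1 - n%:R * t) * a)); last by rewrite ler_wpM2r// bern// ltW.
rewrite mulrBl mul1r ltrBrDl -ltrBrDr.
apply: (@le_lt_trans _ _ (((n%:R + 1) * (a + 1)) * t)).
  rewrite mulrAC ler_wpM2r ?(ltW t0)// ler_pM ?lerDl// .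
rewrite /t mulrA ltr_pdivrMr//; nra.
Qed.
End LowerBound.

(** * The standard gaussian in R^n *)
Section Std.
Context {R : realType}.
Local Notation T := (measurableTypeR R).
Local Notation leb := (@lebesgue_measure R).

Section cons.
Variable n : nat.
Local Notation mu := (lebesgue_cV n.+1 : {sigma_finite_measure set 'cV[R]_n.+1 -> \bar R}).
Local Notation nu := (lebesgue_cV n : {sigma_finite_measure set 'cV[R]_n -> \bar R}).
Local Notation mup := (leb \x nu)%E.

(** Identifies R^(n+1) with R x R^n, the form in which the lemmas on
    [tensor_op] apply. *)
Definition cV_uncons (x : 'cV[R]_n.+1) : T * 'cV[R]_n := (x 0 0, @dsubmx _ 1 n 1 x).

Lemma cV_unconsK : cancel cV_uncons (@cV_cons R n).
Proof. by move=> x; rewrite /cV_uncons -cV_cons_surj. Qed.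

Lemma cV_consK : cancel (@cV_cons R n) cV_uncons.
Proof.
move=> [x v]; rewrite /cV_uncons /cV_cons /=; congr pair; last exact: col_mxKd.
transitivity (@col_mx R 1 n 1 x%:M v (lshift n 0) 0).
  by congr (_ _ _); exact/val_inj.
by rewrite (@col_mxEu _ 1 n 1) mxE eqxx mulr1n.
Qed.

Lemma measurable_cV_uncons : measurable_fun setT cV_uncons.
Proof.
apply: measurable_fun_pair; first exact: measurable_mx_entry.
by apply: measurable_fun_mx => i j; under eq_fun do rewrite mxE; exact: measurable_mx_entry.
Qed.

Lemma ge0_integral_cons (f : 'cV[R]_n.+1 -> \bar R) : measurable_fun setT f -> (forall x, 0 <= f x)%E ->
  (\int[mu]_x f x = \int[mup]_z f (cV_cons z))%E.
Proof.
move=> mf f0.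
have := @ge0_integral_pushforward _ _ _ _ _ (@cV_cons R n) (@measurable_cV_cons R n) mup setT f measurableT mf (fun x _ => f0 x).
by rewrite preimage_setT.
Qed.

Lemma integrable_cons (f : 'cV[R]_n.+1 -> R) : measurable_fun setT f ->
  (mu.-integrable setT (EFin \o f) <-> mup.-integrable setT (EFin \o (fun z => f (cV_cons z)))).
Proof.
move=> mf; have mf2 : measurable_fun setT (fun z => f (cV_cons z)).
  by apply: (measurableT_comp mf); exact: measurable_cV_cons.
have E : (\int[mu]_x `|(f x)%:E| = \int[mup]_z `|(f (cV_cons z))%:E|)%E.
  rewrite (ge0_integral_cons (f := fun x => `|(f x)%:E|%E))//.
  by apply/measurable_EFinP; exact: measurableT_comp.
split=> /integrableP[_ lt]; apply/integrableP; split; try exact/measurable_EFinP.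
- by move: lt; rewrite /= E.
- by rewrite /= E.
Qed.

Lemma Rintegral_cons (f : 'cV[R]_n.+1 -> R) : measurable_fun setT f ->
  \int[mu]_x f x = \int[mup]_z f (cV_cons z).
Proof.
move=> mf; rewrite /Rintegral integralE [in RHS]integralE.
rewrite (ge0_integral_cons (f := (fun x => (f x)%:E)^\+%E)); last 2 first.
- by apply: measurable_funepos; exact/measurable_EFinP.
- by move=> x; exact: funepos_ge0.
rewrite (ge0_integral_cons (f := (fun x => (f x)%:E)^\-%E)); last 2 first.
- by apply: measurable_funeneg; exact/measurable_EFinP.
- by move=> x; exact: funeneg_ge0.
congr (fine (_ - _)%E); apply: eq_integral => z _; first by rewrite !funeposE.
by rewrite !funenegE.
Qed.

Lemma sqint_cons (f : 'cV[R]_n.+1 -> R) : sqint mu f <-> sqint mup (fun z => f (cV_cons z)).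
Proof.
split=> -[mf if_].
  have mf2 : measurable_fun setT (fun z => f (cV_cons z)).
    by apply: (measurableT_comp mf); exact: measurable_cV_cons.
  by split => //; apply/(integrable_cons (f := fun x => f x ^+ 2)) => //; exact: measurable_funX.
have mf2 : measurable_fun setT f.
  rewrite (_ : f = (fun z => f (cV_cons z)) \o cV_uncons); last first.
    by apply/funext => x /=; rewrite cV_unconsK.
  exact: (measurableT_comp mf measurable_cV_uncons).
by split => //; apply/(integrable_cons (f := fun x => f x ^+ 2)) => //; exact: measurable_funX.
Qed.
End cons.

Let lebesgue_cV0T : (\int[lebesgue_cV 0]_(v in [set: 'cV[R]_0]) 1 = 1)%E.
Proof. by rewrite integral_cst// mul1e; exact: diracT. Qed.

(** Induction on the dimension through [cV_uncons]. *)
Lemma prod_integral n (f : 'I_n -> T -> R) : (forall i, leb.-integrable setT (EFin \o f i)) ->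
  (lebesgue_cV n).-integrable setT (EFin \o (fun v : 'cV[R]_n => \prod_i f i (v i 0))) /\
  \int[lebesgue_cV n]_v (\prod_i f i (v i 0)) = \prod_i \int[leb]_x f i x.
Proof.
elim: n f => [|n IH] f if_.
  split.
    apply: (@Rintg_eq _ _ _ _ (fun=> 1)); last by move=> v; rewrite big_ord0.
    apply/integrableP; split; first exact/measurable_EFinP.
    under eq_integral do rewrite /= normr1.
    by rewrite lebesgue_cV0T ltry.
  rewrite big_ord0; under eq_Rintegral do rewrite big_ord0.
  by rewrite /Rintegral lebesgue_cV0T.
have mP : measurable_fun setT (fun v : 'cV[R]_n.+1 => \prod_i f i (v i 0)).
  apply: measurable_prod => i _.
  by apply: (measurableT_comp (Rintg_mf (if_ i))); exact: measurable_mx_entry.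
have [i1 i2] := IH (fun i => f (lift ord0 i)) (fun i => if_ _).
have E z : \prod_i f i (@cV_cons R n z i 0) = f ord0 z.1 * \prod_(i < n) f (lift ord0 i) (z.2 i 0).
  rewrite big_ord_recl; congr (_ * _).
    by have := cV_consK z => /(congr1 fst) /= ->.
  apply: eq_bigr => i _; congr (f _ _).
  have <- : @dsubmx _ 1 n 1 (cV_cons z) = z.2 by exact: (congr1 snd (cV_consK z)).
  by rewrite [RHS]mxE; have -> // : lift ord0 i = rshift 1 i by apply/val_inj.
have ip := integrable_prodM (if_ ord0) i1.
split.
  by apply/(integrable_cons mP); apply: (Rintg_eq ip) => z; rewrite E.
rewrite (Rintegral_cons mP); under eq_Rintegral do rewrite E.
rewrite (Rintegral_prodM (m1 := leb) (m2 := lebesgue_cV n) (a := f ord0) (b := fun v => \prod_(i < n) f (lift ord0 i) (v i 0)))//.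
by rewrite i2 big_ord_recl.
Qed.

(** The gaussian density with covariance s times the identity. *)
Definition gaussn (s : R) n (v : 'cV[R]_n) : R := \prod_i gauss s (v i 0).

(** The quotient of the two values at 0 is the square root of tau. The weaker
    factor tau gives each variable the same loss as [tensor_lower]. *)
Lemma gauss_ratio (tau sg : R) : 0 < sg -> 0 < tau -> tau < 1 -> 2 * sg / (1 + 2 * sg) = tau ->
  tau * gauss (sg + sg) 0 <= gauss (sg + (1 + sg)) 0.
Proof.
move=> sg0 t0 t1 tE.
rewrite /gauss expr0n !mul0r oppr0 expR0 !mulr1.
have P (a : R) : 0 < a -> 0 < 2 * pi * a by move=> a0; rewrite !mulr_gt0// pi_gt0.
have q0 : 0 < 1 + 2 * sg by rewrite addr_gt0// mulr_gt0.
set Y := 2 * pi * (sg + (1 + sg)).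
have Y0 : 0 < Y by rewrite P ?addr_gt0.
have -> : 2 * pi * (sg + sg) = tau * Y.
  have -> : Y = 2 * pi * (1 + 2 * sg) by rewrite /Y; ring.
  by rewrite -tE mulrCA divfK ?lt0r_neq0//; ring.
rewrite sqrtrM ?(ltW t0)// invfM mulrA ler_piMl ?invr_ge0 ?sqrtr_ge0//.
rewrite ler_pdivrMr ?sqrtr_gt0// mul1r -[X in X <= _](sqr_sqrtr (ltW t0)) expr2.
by rewrite ler_piMl ?sqrtr_ge0// -[leRHS]sqrtr1 ler_wsqrtr// ltW.
Qed.

Section gaussn.
Variable n : nat.
Local Notation nu := (lebesgue_cV n : {sigma_finite_measure set 'cV[R]_n -> \bar R}).
Implicit Types s : R.

Lemma gaussn_ge0 s (v : 'cV[R]_n) : 0 <= gaussn s v.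
Proof. by apply: prodr_ge0 => i _; exact: gauss_ge0. Qed.

Lemma measurable_gaussn s : measurable_fun setT (@gaussn s n).
Proof.
by apply: measurable_prod => i _; apply: (measurableT_comp (measurable_gauss s)); exact: measurable_mx_entry.
Qed.

Lemma integrable_gaussn s : 0 < s -> nu.-integrable setT (EFin \o (@gaussn s n)).
Proof. by move=> s0; have [] := prod_integral (fun i : 'I_n => integrable_gauss s0). Qed.

Lemma Rintegral_gaussn s : 0 < s -> \int[nu]_v gaussn s v = 1.
Proof.
move=> s0; have [_ ->] := prod_integral (fun i : 'I_n => integrable_gauss s0).
by rewrite big1// => i _; exact: Rintegral_gauss.
Qed.

Lemma sqint_gaussn s : 0 < s -> sqint nu (@gaussn s n).
Proof.
move=> s0; apply: (@sqint_int_bound _ _ _ _ _ ((Num.sqrt (2 * pi * s))^-1 ^+ n)).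
- exact: measurable_gaussn.
- move=> v; rewrite ger0_norm ?gaussn_ge0// /gaussn.
  rewrite -[X in _ ^+ X]card_ord -prodr_const ler_prod// => i _.
  by rewrite gauss_ge0 gauss_le// ltW.
- exact: integrable_gaussn.
Qed.

Lemma gaussn_opp s (v : 'cV[R]_n) : gaussn s (- v) = gaussn s v.
Proof. by apply: eq_bigr => i _; rewrite mxE gauss_even. Qed.

Lemma scales_cV_reflect (c : 'cV[R]_n) : scales_integral nu (fun x => c - x) 1.
Proof.
have u : - 1%:M \in @unitmx R n by rewrite unitmxE -scaleN1r detZ det1 mulr1 unitrX// unitrN1.
have := scales_cV_affine c u.
rewrite -scaleN1r detZ det1 mulr1 normrX normrN1 expr1n invr1.
by under eq_fun do rewrite -scalemxAl mul1mx scaleN1r addrC.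
Qed.

Lemma conv_gaussn (x : 'cV[R]_n) s u : 0 < s -> 0 < u ->
  \int[nu]_y (gaussn s (x - y) * gaussn u y) = gaussn (s + u) x.
Proof.
move=> s0 u0.
have i (i : 'I_n) : leb.-integrable setT (EFin \o (fun t : T => gauss s (x i 0 - t) * gauss u t)).
  by exact: (sqint_mul (scales_sqint ler01 (scales_reflect (x i 0)) (sqint_gauss s0)) (sqint_gauss u0)).
have [_ E] := prod_integral i.
transitivity (\int[nu]_v (\prod_i (gauss s (x i 0 - v i 0) * gauss u (v i 0)))).
  by apply: eq_Rintegral => v _; rewrite /gaussn -big_split; apply: eq_bigr => j _; rewrite !mxE.
rewrite E; apply: eq_bigr => j _.
rewrite addrC -corr_gauss// /corr.
have := Rintegral_reflect 0 (i j) => <-.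
rewrite [in LHS]/gauss; rewrite -/(gauss _ _).
by apply: eq_Rintegral => t _; rewrite sub0r opprK -/(gauss s _) -/(gauss u _) gauss_even mulrC [t + _]addrC.
Qed.

Lemma inner_gaussn s u : 0 < s -> 0 < u ->
  \int[nu]_x (gaussn s x * gaussn u x) = gauss (s + u) 0 ^+ n.
Proof.
move=> s0 u0; have [_ E] := prod_integral (fun i : 'I_n => sqint_mul (sqint_gauss s0) (sqint_gauss u0)).
transitivity (\int[nu]_v (\prod_i (gauss s (v i 0) * gauss u (v i 0)))).
  by apply: eq_Rintegral => v _; rewrite /gaussn -big_split.
rewrite E prodr_const card_ord; congr (_ ^+ n).
by rewrite -corr_gauss// /corr; apply: eq_Rintegral => t _; rewrite addr0.
Qed.
End gaussn.

Section std.
Variable n : nat.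
Local Notation mu := (lebesgue_cV n.+1 : {sigma_finite_measure set 'cV[R]_n.+1 -> \bar R}).
Local Notation nu := (lebesgue_cV n : {sigma_finite_measure set 'cV[R]_n -> \bar R}).
Local Notation mup := (leb \x nu)%E.

Let k (z : 'cV[R]_n * 'cV[R]_n) := gaussn 1 (z.1 - z.2).

Definition std_kernel (z : 'cV[R]_n.+1) : R := dgauss (z 0 0) * gaussn 1 (@dsubmx _ 1 n 1 z).
Definition std_smooth (F : 'cV[R]_n.+1 -> R) (x : 'cV[R]_n.+1) := \int[mu]_y (gaussn 1 (x - y) * F y).
(** The first partial derivative of [std_smooth], written as a convolution
    with the derivative of the kernel. Every directional derivative of the
    semigroup is conjugate to a multiple of this operator. *)
Definition std_grad (F : 'cV[R]_n.+1 -> R) (x : 'cV[R]_n.+1) := \int[mu]_y (std_kernel (x - y) * F y).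

Let mk : measurable_fun setT k.
Proof.
apply: (measurableT_comp (measurable_gaussn 1)); apply: measurable_fun_mx => i j.
under eq_fun do rewrite !mxE.
by apply: measurable_funB; apply: (measurableT_comp (measurable_mx_entry i j)); [exact: measurable_fst|exact: measurable_snd].
Qed.
Let k0 z : 0 <= k z. Proof. exact: gaussn_ge0. Qed.
Let sk x : sqint nu (fun y => k (x, y)).
Proof. exact: (scales_sqint ler01 (scales_cV_reflect x) (sqint_gaussn n ltr01)). Qed.
Let ik x : nu.-integrable setT (EFin \o (fun y => k (x, y))).
Proof. by have [] := scales_Rintegral ler01 (scales_cV_reflect x) (integrable_gaussn n ltr01). Qed.
Let k1 x : \int[nu]_y k (x, y) = 1.
Proof.
have [_ ->] := scales_Rintegral ler01 (scales_cV_reflect x) (integrable_gaussn n ltr01).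
by rewrite mul1r Rintegral_gaussn.
Qed.
Let k2 y : (\int[nu]_x (k (x, y))%:E = 1)%E.
Proof.
have kC x : k (x, y) = k (y, x) by rewrite /k /= -gaussn_opp opprB.
under eq_integral do rewrite kC.
by rewrite -EFin_Rintegral// k1.
Qed.

Let gaussnS (z : 'cV[R]_n.+1) : gaussn 1 z = gauss 1 (z 0 0) * gaussn 1 (@dsubmx _ 1 n 1 z).
Proof.
rewrite /gaussn big_ord_recl; congr (_ * _); apply: eq_bigr => i _; rewrite mxE.
have -> // : lift ord0 i = rshift 1 i by apply/val_inj.
Qed.

Let uncons_sub (x y : 'cV[R]_n.+1) : cV_uncons (x - y) = ((cV_uncons x).1 - (cV_uncons y).1, (cV_uncons x).2 - (cV_uncons y).2).
Proof. by rewrite /cV_uncons /= !mxE linearB. Qed.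

Let sub_cons (x : 'cV[R]_n.+1) (z : T * 'cV[R]_n) :
  (x - cV_cons z) 0 0 = (cV_uncons x).1 - z.1 /\ @dsubmx _ 1 n 1 (x - cV_cons z) = (cV_uncons x).2 - z.2.
Proof.
have := uncons_sub x (cV_cons z); rewrite cV_consK {1}/cV_uncons => -[h1 h2].
by split; rewrite ?h1 ?h2.
Qed.

Let measurable_sub (x : 'cV[R]_n.+1) (f : 'cV[R]_n.+1 -> R) : measurable_fun setT f ->
  measurable_fun setT (fun y : 'cV[R]_n.+1 => f (x - y)).
Proof. by move=> mf; exact: (measurableT_comp mf (scales_cV_reflect x).1). Qed.

Lemma measurable_std_kernel : measurable_fun setT std_kernel.
Proof.
apply: measurable_funM.
  by apply: (measurableT_comp measurable_dgauss); exact: measurable_mx_entry.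
apply: (measurableT_comp (measurable_gaussn 1)).
by apply: measurable_fun_mx => i j; under eq_fun do rewrite mxE; exact: measurable_mx_entry.
Qed.

(* Comparing two integrals must not unfold the kernels under them. *)
Opaque tensor_op gauss dgauss gaussn.
Lemma std_grad_cons F x : measurable_fun setT F ->
  std_grad F x = tensor_op nu k dgauss (fun z => F (cV_cons z)) (cV_uncons x).
Proof.
move=> mF; rewrite /std_grad Rintegral_cons; last first.
  by apply: measurable_funM => //; apply: measurable_sub; exact: measurable_std_kernel.
apply: eq_Rintegral => z _; rewrite /std_kernel.
by have [-> ->] := sub_cons x z.
Qed.

Lemma std_smooth_cons F x : measurable_fun setT F ->
  std_smooth F x = tensor_op nu k (gauss 1) (fun z => F (cV_cons z)) (cV_uncons x).
Proof.
move=> mF; rewrite /std_smooth Rintegral_cons; last first.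
  by apply: measurable_funM => //; apply: measurable_sub; exact: measurable_gaussn.
apply: eq_Rintegral => z _; rewrite gaussnS.
by have [-> ->] := sub_cons x z.
Qed.

Lemma tensor_op_std_grad F : measurable_fun setT F ->
  (fun z => std_grad F (cV_cons z)) = tensor_op nu k dgauss (fun z => F (cV_cons z)).
Proof.
move=> mF; apply/funext => z.
by rewrite (std_grad_cons (cV_cons z) mF) cV_consK.
Qed.

Lemma std_grad_sqint F : sqint mu F -> sqint mu (std_grad F).
Proof.
move=> sF; have [mF _] := sF; apply/sqint_cons.
have := sqint_tensor_op_dgauss mk k0 k1 ik k2 sk ((sqint_cons F).1 sF).
by rewrite -tensor_op_std_grad.
Qed.

Lemma std_grad_le F : sqint mu F ->
  \int[mu]_x (std_grad F x ^+ 2) <= expR (- 1) * \int[mu]_x (F x ^+ 2).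
Proof.
move=> sF; have [mF iF] := sF; have [mK iK] := std_grad_sqint sF.
rewrite Rintegral_cons; last exact: measurable_funX.
rewrite [in leRHS]Rintegral_cons; last exact: measurable_funX.
have [_ iK'] := (sqint_cons _).1 (std_grad_sqint sF).
have [_ iF'] := (sqint_cons _).1 sF.
rewrite -lee_fin EFinM !EFin_Rintegral//.
have := tensor_upper mk k0 k1 ik k2 sk ((sqint_cons F).1 sF).
by rewrite -tensor_op_std_grad.
Qed.

(** In the n transversal variables take gaussians of variance sg: these lose
    at most the factor tau each, so that tau ^ (n+1) exp (- 1/2) <= c for
    every tau < 1. *)
Lemma std_grad_ge (c : R) : 0 <= c ->
  (forall F, sqint mu F -> \int[mu]_x (std_grad F x ^+ 2) <= c ^+ 2 * \int[mu]_x (F x ^+ 2)) ->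
  expR (- 2^-1) <= c.
Proof.
move=> c0 H; apply: (@le_of_powers _ _ _ n.+1); last exact: expR_ge0.
move=> tau t0 t1.
(* Solves 2 sg / (1 + 2 sg) = tau. *)
pose sg := tau / (2 * (1 - tau)).
have t1' : 0 < 1 - tau by rewrite subr_gt0.
have t1n := lt0r_neq0 t1'.
have sg0 : 0 < sg by rewrite divr_gt0// mulr_gt0.
have ss0 : 0 < 1 + sg by rewrite addr_gt0.
have tE : 2 * sg / (1 + 2 * sg) = tau.
  rewrite /sg; field; rewrite t1n /=.
  by rewrite (_ : _ - _ + _ = 1)//; ring.
have vE : kernel_op nu k (@gaussn sg n) = @gaussn (1 + sg) n :> ('cV[R]_n -> R).
  by apply/funext => x; rewrite /kernel_op conv_gaussn.
have := @tensor_lower R _ _ nu k sk c sg (@gaussn sg n) c0 sg0 _ (sqint_gaussn n sg0).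
rewrite vE inner_gaussn// tE => /(_ _ (sqint_gaussn n ss0) (exprn_ge0 _ (gauss_ge0 _ _))) H1.
have {}H1 : tau * expR (- 2^-1) * gauss (sg + (1 + sg)) 0 ^+ n <= c * gauss (sg + sg) 0 ^+ n.
  have -> : gauss (sg + sg) 0 ^+ n = \int[nu]_x (gaussn sg x ^+ 2).
    by rewrite -inner_gaussn//; apply: eq_Rintegral => x _; rewrite expr2.
  apply: H1 => F sF.
  pose F' (x : 'cV[R]_n.+1) := F (cV_uncons x).
  have FE : (fun z => F' (cV_cons z)) = F by apply/funext => z; rewrite /F' cV_consK.
  have sF' : sqint mu F' by apply/sqint_cons; rewrite FE.
  have [mF' _] := sF'.
  have KE : tensor_op nu k dgauss F = (fun z => std_grad F' (cV_cons z)).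
    by rewrite tensor_op_std_grad// FE.
  have sK := std_grad_sqint sF'; have [mK _] := sK.
  rewrite KE; split; first exact: ((sqint_cons (std_grad F')).1 sK).
  have := H _ sF'; rewrite Rintegral_cons; last exact: measurable_funX.
  rewrite [in leRHS]Rintegral_cons; last exact: measurable_funX.
  by under [X in _ <= _ * X -> _]eq_Rintegral do rewrite /F' cV_consK.
have G0 : 0 < gauss (sg + sg) 0 by rewrite gauss_gt0 ?addr_gt0.
have ratio : tau * gauss (sg + sg) 0 <= gauss (sg + (1 + sg)) 0 by exact: gauss_ratio.
have powr : tau ^+ n * gauss (sg + sg) 0 ^+ n <= gauss (sg + (1 + sg)) 0 ^+ n.
  by rewrite -exprMn lerXn2r// nnegrE ?mulr_ge0 ?gauss_ge0// ltW.
rewrite -(ler_pM2r (exprn_gt0 n G0)); apply: le_trans H1.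
rewrite exprS -!mulrA ler_wpM2l ?(ltW t0)// mulrCA ler_wpM2l ?expR_ge0//.
Qed.

Lemma std_smooth_derive F x : sqint mu F ->
  h^-1 *: (std_smooth F (x + h *: delta_mx 0 0) - std_smooth F x) @[h --> (0:R)^'] --> std_grad F x.
Proof.
move=> sF; have [mF _] := sF.
have := tensor_op_derive (x := cV_uncons x) k0 sk ((sqint_cons F).1 sF).
rewrite -std_grad_cons//.
have E h : cV_uncons (x + h *: delta_mx 0 0) = ((cV_uncons x).1 + h, (cV_uncons x).2).
  rewrite /cV_uncons !mxE eqxx mulr1; congr pair; apply/matrixP => i j.
  by rewrite !mxE /= mulr0 addr0.
by under eq_fun do rewrite -E -!std_smooth_cons//.
Qed.

End std.
End Std.

(** * Positive definite matrices *)
Section LinAlg.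
Context {R : realType}.

Lemma dotpE n (u v : 'cV[R]_n) : dotp u v = \sum_i u i 0 * v i 0.
Proof. by rewrite /dotp mxE; apply: eq_bigr => i _; rewrite mxE. Qed.

Lemma dotpC n (u v : 'cV[R]_n) : dotp u v = dotp v u.
Proof. by rewrite !dotpE; apply: eq_bigr => i _; rewrite mulrC. Qed.

Lemma dotp_ge0 n (u : 'cV[R]_n) : 0 <= dotp u u.
Proof. by rewrite dotpE sumr_ge0// => i _; rewrite -expr2 sqr_ge0. Qed.

Lemma dotp_eq0 n (u : 'cV[R]_n) : (dotp u u == 0) = (u == 0).
Proof.
apply/idP/eqP => [|->]; last by rewrite /dotp mulmx0 mxE.
rewrite dotpE psumr_eq0 => [/allP h|i _]; last by rewrite -expr2 sqr_ge0.
apply/matrixP => i j; rewrite ord1 mxE.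
by have := h i (mem_index_enum _); rewrite mulf_eq0 orbb => /eqP.
Qed.

Lemma dotp_gt0 n (u : 'cV[R]_n) : u != 0 -> 0 < dotp u u.
Proof. by move=> u0; rewrite lt_def dotp_ge0 dotp_eq0 u0. Qed.

Lemma dotpDl n (u v w : 'cV[R]_n) : dotp (u + v) w = dotp u w + dotp v w.
Proof. by rewrite /dotp linearD mulmxDl mxE. Qed.
Lemma dotpZl n (a : R) (u w : 'cV[R]_n) : dotp (a *: u) w = a * dotp u w.
Proof. by rewrite /dotp linearZ -scalemxAl mxE. Qed.
Lemma dotpDr n (u v w : 'cV[R]_n) : dotp w (u + v) = dotp w u + dotp w v.
Proof. by rewrite dotpC dotpDl !(dotpC w). Qed.
Lemma dotpZr n (a : R) (u w : 'cV[R]_n) : dotp w (a *: u) = a * dotp w u.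
Proof. by rewrite dotpC dotpZl (dotpC w). Qed.
Lemma dotp_mull m n (M : 'M[R]_(m, n)) u v : dotp (M *m u) v = dotp u (M^T *m v).
Proof. by rewrite /dotp trmx_mul mulmxA. Qed.

Lemma enorm1_dotp n (q : 'cV[R]_n) : enorm q = 1 -> dotp q q = 1.
Proof.
move=> h; have := sqr_sqrtr (dotp_ge0 q); rewrite -/(enorm q) h expr1n => //.
Qed.

Definition spd n (G : 'M[R]_n) := G^T = G /\ forall x, x != 0 -> 0 < dotp x (G *m x).

Lemma spd_unit n (G : 'M[R]_n) : spd G -> G \in unitmx.
Proof.
move=> [_ pG]; rewrite -unitmx_tr -row_free_unit -kermx_eq0.
apply/rowV0P => v /sub_kermxP vG; apply/eqP; apply: contraT => v0.
have vt : v^T != 0 by rewrite -trmx0 (inj_eq trmx_inj).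
have := pG _ vt; rewrite -[G *m _]trmxK trmx_mul trmxK vG trmx0 /dotp mulmx0 mxE ltxx.
by [].
Qed.

Lemma det_lower n (L : 'M[R]_n) : (forall i j : 'I_n, (i < j)%N -> L i j = 0) ->
  \det L = \prod_i L i i.
Proof. by move=> h; apply: det_trig; apply/is_trig_mxP. Qed.

(** Induction through the Schur complement of the corner entry, which is again
    positive definite: its quadratic form is that of G minimized over the
    first coordinate. *)
Lemma cholesky n (G : 'M[R]_n) : spd G ->
  exists L : 'M[R]_n, [/\ forall i j : 'I_n, (i < j)%N -> L i j = 0,
     forall i, 0 < L i i & L *m L^T = G].
Proof.
elim: n G => [|n IH] G spdG.
  by exists 0; split; [case|case|apply/matrixP; case].
pose G' : 'M[R]_(1 + n) := G.
have [sG pG] : spd G' := spdG.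
pose a := G' 0 0; pose c := dlsubmx G'; pose M := drsubmx G'.
have GE : G' = block_mx a%:M c^T c M.
  rewrite -[LHS]submxK; congr block_mx.
  - apply/matrixP => i j; rewrite !mxE !ord1 eqxx mulr1n; congr (G' _ _); exact/val_inj.
  - by rewrite /c -[in RHS]sG trmx_dlsub trmxK.
have qf (x0 : R) (v : 'cV[R]_n) : dotp (col_mx x0%:M v) (G' *m col_mx x0%:M v) =
    a * x0 ^+ 2 + 2 * x0 * dotp c v + dotp v (M *m v).
  rewrite GE mul_block_col /dotp tr_col_mx mul_row_col mxE !mulmxDr !mxE !big_ord1 !mxE !eqxx !mulr1n.
  rewrite !big_ord1 !mxE eqxx mulr1n.
  have -> : \sum_j v^T 0 j * (c *m x0%:M) j 0 = x0 * \sum_j c^T 0 j * v j 0.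
    rewrite mul_mx_scalar big_distrr; apply: eq_bigr => j _; rewrite !mxE /=; ring.
  by rewrite mulr1n; ring.
have a0 : 0 < a.
  have := pG (col_mx 1%:M 0); rewrite qf /dotp mulmx0 trmx0 mul0mx !mxE mulr0 !addr0 expr1n mulr1.
  apply; apply/eqP => /matrixP /(_ (lshift n 0) 0); rewrite col_mxEu !mxE eqxx => /eqP.
  by rewrite oner_eq0.
pose S := M - a^-1 *: (c *m c^T).
have MT : M^T = M by rewrite /M trmx_drsub sG.
have spdS : spd S.
  split; first by rewrite /S linearB linearZ /= trmx_mul trmxK MT.
  move=> v v0.
  have x0 : col_mx (- (a^-1 * dotp c v))%:M v != 0.
    by apply: contraNneq v0 => /(congr1 (@dsubmx _ 1 n 1)); rewrite col_mxKd linear0 => ->.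
  have := pG _ x0; rewrite qf.
  have -> : dotp v (S *m v) = dotp v (M *m v) - a^-1 * (dotp c v) ^+ 2.
    rewrite /S mulmxBl -scalemxAl dotpDr -scaleN1r dotpZr mulN1r dotpZr; congr (_ - _ * _).
    by rewrite -mulmxA (mx11_scalar (c^T *m v)) -/(dotp c v) mul_mx_scalar dotpZr expr2 (dotpC v).
  by congr (_ < _); field; exact: lt0r_neq0.
have [L [Ll Ld LL]] := IH S spdS.
have sa : Num.sqrt a != 0 by rewrite sqrtr_eq0 -ltNge.
pose L1 : 'M[R]_(1 + n) := block_mx (Num.sqrt a)%:M 0 ((Num.sqrt a)^-1 *: c) L.
exists L1; split.
- move=> i j; rewrite /L1.
  case: (@splitP 1 n i) => i' ii; case: (@splitP 1 n j) => j' jj.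
  + by rewrite ii jj !ord1.
  + move=> _; have -> : i = lshift n i' by apply/val_inj.
    have -> : j = rshift 1 j' by apply/val_inj.
    by apply: etrans (block_mxEur (Num.sqrt a)%:M 0 ((Num.sqrt a)^-1 *: c) L i' j') _; rewrite mxE.
  + by rewrite ii jj ord1.
  + have -> : i = rshift 1 i' by apply/val_inj.
    have -> : j = rshift 1 j' by apply/val_inj.
    move=> ij; apply: etrans (block_mxEdr (Num.sqrt a)%:M 0 ((Num.sqrt a)^-1 *: c) L i' j') _.
    exact: Ll.
- move=> i; rewrite /L1.
  case: (@splitP 1 n i) => i' ii.
  + have -> : i = lshift n i' by apply/val_inj.
    suff: 0 < (Num.sqrt a)%:M i' i'.
      by rewrite -(block_mxEul _ 0 ((Num.sqrt a)^-1 *: c) L).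
    by rewrite mxE eqxx mulr1n sqrtr_gt0.
  + have -> : i = rshift 1 i' by apply/val_inj.
    by move: (Ld i'); rewrite -(block_mxEdr (Num.sqrt a)%:M 0 ((Num.sqrt a)^-1 *: c) L).
- suff: @mulmx R (1 + n) (1 + n) (1 + n) L1 (@trmx R (1 + n) (1 + n) L1) = G' by [].
  rewrite GE /L1 tr_block_mx mulmx_block !trmx0 !mul0mx !mulmx0 !addr0.
  rewrite tr_scalar_mx linearZ /= LL; congr block_mx.
  + by rewrite -scalar_mxM -expr2 sqr_sqrtr// ltW.
  + by rewrite mul_scalar_mx scalerA mulfV// scale1r.
  + by rewrite mul_mx_scalar scalerA mulfV// scale1r.
  + rewrite -scalemxAl -scalemxAr scalerA -expr2 exprVn sqr_sqrtr ?ltW//.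
    by rewrite addrC subrK.
Qed.

(** The reflection that exchanges u and the first basis vector. *)
Lemma householder n (u : 'cV[R]_n.+1) : dotp u u = 1 ->
  exists U : 'M[R]_n.+1, U *m U^T = 1%:M /\ U *m delta_mx 0 0 = u.
Proof.
move=> u1; set e : 'cV[R]_n.+1 := delta_mx 0 0.
have ee : dotp e e = 1.
  rewrite dotpE (bigD1 0)//= !mxE !eqxx mulr1 big1 ?addr0// => i i0.
  by rewrite !mxE (negbTE i0) mul0r.
have [->|ue] := eqVneq u e; first by exists 1%:M; rewrite trmx1 mulmx1 mul1mx.
(* Reflect in the hyperplane orthogonal to u - e. *)
pose w := u - e.
have w0 : w != 0 by rewrite subr_eq0.
pose N := dotp w w; have N0 : N != 0 by rewrite dotp_eq0.
have NE : N = 2 - 2 * dotp u e.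
  rewrite /N /w -scaleN1r !dotpDl !dotpDr !dotpZl !dotpZr u1 ee (dotpC e u); ring.
have wu : dotp w e = - (N / 2).
  by rewrite NE /w -scaleN1r dotpDl dotpZl ee; field.
pose P := (2 / N) *: (w *m w^T).
exists (1%:M - P).
have PT : P^T = P by rewrite /P linearZ /= trmx_mul trmxK.
have PP : P *m P = 2 *: P.
  rewrite /P -scalemxAl -scalemxAr !scalerA.
  rewrite mulmxA -[w *m w^T *m w]mulmxA (mx11_scalar (w^T *m w)) -/(dotp w w) -/N mul_mx_scalar.
  by rewrite -scalemxAl scalerA; congr (_ *: _); field.
split.
  rewrite linearB /= trmx1 PT mulmxBl !mulmxBr !mul1mx mulmx1 PP scaler_nat mulr2n.
  by apply/matrixP => i j; rewrite !mxE; ring.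
rewrite mulmxBl mul1mx /P -scalemxAl -mulmxA (mx11_scalar (w^T *m e)) -/(dotp w e) wu.
rewrite mul_mx_scalar scalerA.
have -> : 2 / N * - (N / 2) = -1 by field.
by rewrite scaleN1r opprK /w addrC subrK.
Qed.

(** A square root L of G can be multiplied on the right by any orthogonal
    matrix. Choosing the one that maps the first basis vector to the direction
    of L^-1 q makes L e_0 proportional to q, and the factor is the norm of
    L^-1 q. *)
Lemma spd_adapted n (G : 'M[R]_n.+1) (q : 'cV[R]_n.+1) : spd G -> q != 0 ->
  exists L : 'M[R]_n.+1, [/\ L *m L^T = G, 0 < dotp q (invmx G *m q) &
     q = Num.sqrt (dotp q (invmx G *m q)) *: (L *m delta_mx 0 0)].
Proof.
move=> spdG q0; have [L1 [_ _ LL]] := cholesky spdG.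
have uG := spd_unit spdG.
have uL : L1 \in unitmx by move: uG; rewrite -LL unitmx_mul => /andP[].
have uLT : L1^T \in unitmx by rewrite unitmx_tr.
have GI : invmx G = (invmx L1)^T *m invmx L1.
  rewrite -LL trmx_inv; apply: (can_inj (mulKmx (_ : L1 *m L1^T \in unitmx))).
    by rewrite LL.
  by rewrite mulmxV ?LL// -LL mulmxA mulmxK// mulmxV.
pose p := invmx L1 *m q.
have p0 : p != 0 by apply: contraNneq q0 => p0; rewrite -(mulKVmx uL q) -/p p0 mulmx0.
have bE : dotp q (invmx G *m q) = dotp p p.
  by rewrite GI -mulmxA /p -/p dotp_mull -[RHS]/(dotp _ _) mulmxA /dotp.
have b0 : 0 < dotp q (invmx G *m q) by rewrite bE dotp_gt0.
set b := dotp _ _ in bE b0 *.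
have sb : Num.sqrt b != 0 by rewrite lt0r_neq0// sqrtr_gt0.
pose u := (Num.sqrt b)^-1 *: p.
have u1 : dotp u u = 1.
  by rewrite dotpZl dotpZr -bE mulrA -invfM -expr2 sqr_sqrtr ?ltW// mulVf// lt0r_neq0.
have [U [UU Ue]] := householder u1.
exists (L1 *m U); split => //.
- by rewrite trmx_mul mulmxA -(mulmxA L1) UU mulmx1.
- by rewrite -mulmxA Ue -scalemxAr scalerA mulfV// scale1r /p mulKVmx.
Qed.

End LinAlg.

(** * Orders of vanishing at 0 from the right *)
Section IsO.
Context {R : realType}.
Implicit Types (f g : R -> R).

(** The elementary form of f = O(t^m) at 0+, with an explicit constant;
    [isO_bigO] translates it into the Landau notation. *)
Definition isO (m : nat) f := exists C, \forall t \near (0:R)^'+, `|f t| <= C * t ^+ m.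

Lemma near0_pos : \forall t \near (0:R)^'+, 0 < t.
Proof. exact: nbhs_right_gt. Qed.

Lemma near0_lt (e : R) : 0 < e -> \forall t \near (0:R)^'+, t < e.
Proof. by move=> e0; exact: nbhs_right_lt. Qed.

Lemma near0_le1 : \forall t \near (0:R)^'+, t <= 1.
Proof. by apply: filterS (near0_lt ltr01) => t /ltW. Qed.

Lemma isO_near m f g : isO m f -> (\forall t \near (0:R)^'+, f t = g t) -> isO m g.
Proof. by move=> [C hC] fg; exists C; apply: filterS2 hC fg => t h <-. Qed.

Lemma isO_eq m f g : isO m f -> (forall t, f t = g t) -> isO m g.
Proof. by move=> h fg; apply: (isO_near h); apply: nearW. Qed.

Lemma isOD m f g : isO m f -> isO m g -> isO m (fun t => f t + g t).
Proof.
move=> [C hC] [D hD]; exists (C + D); apply: filterS2 hC hD => t h k.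
by rewrite mulrDl (le_trans (ler_normD _ _))// lerD.
Qed.

Lemma isON m f : isO m f -> isO m (fun t => - f t).
Proof. by move=> [C hC]; exists C; apply: filterS hC => t; rewrite normrN. Qed.

Lemma isOB m f g : isO m f -> isO m g -> isO m (fun t => f t - g t).
Proof. by move=> hf hg; apply: isOD => //; exact: isON. Qed.

Lemma isOM m k f g : isO m f -> isO k g -> isO (m + k) (fun t => f t * g t).
Proof.
move=> [C hC] [D hD]; exists (C * D); apply: filterS2 hC hD => t h k'.
by rewrite exprD mulrACA normrM ler_pM.
Qed.

Lemma isO_cst (c : R) : isO 0 (fun=> c).
Proof. by exists `|c|; apply: nearW => t; rewrite expr0 mulr1. Qed.

Lemma isO_0 m : isO m (fun=> 0).
Proof. by exists 0; apply: nearW => t; rewrite normr0 mul0r. Qed.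

Lemma isOZ m (c : R) f : isO m f -> isO m (fun t => c * f t).
Proof. by move=> h; have := isOM (isO_cst c) h; rewrite add0n. Qed.

Lemma isOX m : isO m (fun t => t ^+ m).
Proof.
exists 1; apply: filterS near0_pos => t t0.
by rewrite mul1r ger0_norm// exprn_ge0// ltW.
Qed.

Lemma isO_le m k f : (k <= m)%N -> isO m f -> isO k f.
Proof.
move=> km [C hC]; exists `|C|; apply: filterS3 hC near0_pos near0_le1 => t h t0 t1.
apply: (le_trans h); apply: (@le_trans _ _ (`|C| * t ^+ m)).
  by rewrite ler_wpM2r ?ler_norm// exprn_ge0// ltW.
by rewrite ler_wpM2l// ler_wiXn2l// ltW.
Qed.

Lemma isO_sum (I : Type) (r : seq I) (P : pred I) m (F : I -> R -> R) :
  (forall i, P i -> isO m (F i)) -> isO m (fun t => \sum_(i <- r | P i) F i t).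
Proof.
move=> h; elim: r => [|i r IH].
  by apply: (isO_eq (isO_0 m)) => t; rewrite big_nil.
case Pi: (P i).
  by apply: (isO_eq (isOD (h i Pi) IH)) => t; rewrite big_cons Pi.
by apply: (isO_eq IH) => t; rewrite big_cons Pi.
Qed.

Lemma isO_prod (I : Type) (r : seq I) (P : pred I) (F : I -> R -> R) :
  (forall i, P i -> isO 0 (F i)) -> isO 0 (fun t => \prod_(i <- r | P i) F i t).
Proof.
move=> h; elim: r => [|i r IH].
  by apply: (isO_eq (isO_cst 1)) => t; rewrite big_nil.
case Pi: (P i).
  by apply: (isO_eq (isOM (h i Pi) IH)) => t; rewrite big_cons Pi.
by apply: (isO_eq IH) => t; rewrite big_cons Pi.
Qed.

(** Telescoping over the factors. *)
Lemma isO_prodB (I : Type) (r : seq I) (P : pred I) m (F G : I -> R -> R) :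
  (forall i, P i -> isO 0 (F i)) -> (forall i, P i -> isO 0 (G i)) ->
  (forall i, P i -> isO m (fun t => F i t - G i t)) ->
  isO m (fun t => \prod_(i <- r | P i) F i t - \prod_(i <- r | P i) G i t).
Proof.
move=> hF hG hFG; elim: r => [|i r IH].
  by apply: (isO_eq (isO_0 m)) => t; rewrite !big_nil subrr.
case Pi: (P i); last by apply: (isO_eq IH) => t; rewrite !big_cons Pi.
have h1 := isOM (hFG i Pi) (isO_prod r hF); rewrite addn0 in h1.
have h2 := isOM (hG i Pi) IH; rewrite add0n in h2.
by apply: (isO_eq (isOD h1 h2)) => t; rewrite !big_cons Pi; ring.
Qed.

Lemma isO_small m f (e : R) : isO m.+1 f -> 0 < e -> \forall t \near (0:R)^'+, `|f t| < e.
Proof.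
move=> [C hC] e0; have d0 : 0 < e / (`|C| + 1) by rewrite divr_gt0// ltr_wpDl.
apply: filterS3 hC near0_le1 (filterI near0_pos (near0_lt d0)) => t h t1 [t0 td].
apply: (le_lt_trans h); apply: (@le_lt_trans _ _ ((`|C| + 1) * t)); last first.
  by rewrite mulrC -ltr_pdivlMr// ltr_wpDl.
rewrite exprS mulrA; apply: (@le_trans _ _ ((`|C| + 1) * t * t ^+ m)).
  rewrite ler_wpM2r ?exprn_ge0 ?(ltW t0)// ler_wpM2r ?(ltW t0)//.
  by rewrite (le_trans (ler_norm _))// lerDl.
by rewrite ler_piMr ?mulr_ge0 ?addr_ge0 ?(ltW t0)// exprn_ile1// ltW.
Qed.

Lemma isO_inv (c : R) m f : c != 0 -> isO m.+1 (fun t => f t - c) ->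
  isO m.+1 (fun t => (f t)^-1 - c^-1).
Proof.
move=> c0 h; have [C hC] := h.
have e0 : 0 < `|c| / 2 by rewrite divr_gt0// normr_gt0.
exists (C * (2 / `|c| ^+ 2)); apply: filterS2 hC (isO_small h e0) => t h1 h2.
have fc : `|c| / 2 <= `|f t|.
  have := ler_normD (f t) (c - f t); rewrite addrC subrK distrC => h3.
  by lra.
have f0 : f t != 0 by rewrite -normr_gt0 (lt_le_trans e0).
have -> : (f t)^-1 - c^-1 = - (f t - c) / (f t * c) by field; rewrite f0 c0.
rewrite normrM normrN normfV normrM.
rewrite mulrAC ler_pM ?invr_ge0 ?mulr_ge0//.
have -> : 2 / `|c| ^+ 2 = (`|c| / 2 * `|c|)^-1 by field; rewrite normr_eq0.
rewrite lef_pV2 ?posrE ?mulr_gt0 ?normr_gt0//.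
by rewrite ler_wpM2r.
Qed.

Lemma isO_bounded (c : R) m f : isO m (fun t => f t - c) -> isO 0 f.
Proof.
move=> h; apply: (isO_eq (isOD (isO_le (leq0n m) h) (isO_cst c))) => t.
by rewrite subrK.
Qed.

Lemma det_isO n m (M N : R -> 'M[R]_n) :
  (forall i j, isO 0 (fun t => M t i j)) -> (forall i j, isO 0 (fun t => N t i j)) ->
  (forall i j, isO m (fun t => M t i j - N t i j)) ->
  isO m (fun t => \det (M t) - \det (N t)).
Proof.
move=> hM hN hMN.
have H (s : {perm 'I_n}) : isO m (fun t => (-1) ^+ s * (\prod_i M t i (s i) - \prod_i N t i (s i))).
  by apply: isOZ; apply: isO_prodB.
apply: (isO_eq (isO_sum (index_enum _) (P := predT) (fun s _ => H s))) => t.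
by rewrite /determinant -sumrB; apply: eq_bigr => s _; rewrite mulrBr.
Qed.

(** A permutation other than the identity moves at least two points, so its
    term contains at least two off-diagonal factors of size O(t). *)
Lemma det_diag_isO n (M : R -> 'M[R]_n) :
  (forall i, isO 0 (fun t => M t i i)) ->
  (forall i j, i != j -> isO 1 (fun t => M t i j)) ->
  isO 2 (fun t => \det (M t) - \prod_i M t i i).
Proof.
move=> hd ho.
have hb i j : isO 0 (fun t => M t i j).
  by have [->|ij] := eqVneq i j => //; apply: isO_le (ho _ _ ij).
have H (s : {perm 'I_n}) : s != 1%g -> isO 2 (fun t => (-1) ^+ s * \prod_i M t i (s i)).
  move=> s1; apply: isOZ.
  have [i si] : exists i, s i != i.
    apply/existsP; apply: contraR s1 => /existsPn h; apply/eqP/permP => i.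
    by rewrite perm1; apply/eqP; have := h i; rewrite negbK.
  have ssi : s (s i) != s i by rewrite (inj_eq perm_inj).
  have h1 := isOM (ho i (s i) _) (isOM (ho (s i) (s (s i)) _) (isO_prod (index_enum _) (P := fun j => (j != i) && (j != s i)) (fun j _ => hb j (s j)))).
  rewrite eq_sym si eq_sym ssi in h1.
  apply: (isO_eq (h1 isT isT)) => t.
  by rewrite [RHS](bigD1 i)//= [in RHS](bigD1 (s i))//=.
apply: (isO_eq (isO_sum (index_enum _) H)) => t.
rewrite /determinant [X in _ = X - _](bigD1 1%g)//= odd_perm1 expr0 mul1r.
rewrite (eq_bigr (fun i => M t i i)) => [|i _]; last by rewrite perm1.
by rewrite addrC addrK.
Qed.

End IsO.

(** * The matrix exponential *)
Section Expmx.
Context {R : realType} {n : nat}.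
Implicit Types (A : 'M[R]_n).

(** A submultiplicative bound for the entries of powers. *)
Definition absum A : R := \sum_i \sum_j `|A i j|.

Lemma absum_ge0 A : 0 <= absum A.
Proof. by apply: sumr_ge0 => i _; apply: sumr_ge0. Qed.

Lemma absumZ (s : R) A : absum (s *: A) = `|s| * absum A.
Proof.
rewrite /absum big_distrr; apply: eq_bigr => i _; rewrite big_distrr; apply: eq_bigr => j _.
by rewrite mxE normrM.
Qed.

Lemma absum_exp A k i j : `|(A ^+ k) i j| <= absum A ^+ k.
Proof.
suff H : forall i, \sum_j `|(A ^+ k) i j| <= absum A ^+ k.
  apply: le_trans (H i); rewrite (bigD1 j)//= lerDl; exact: sumr_ge0.
elim: k {i j} => [|k IH] i.
  rewrite !expr0 (bigD1 i)//= !mxE eqxx normr1 big1 ?addr0// => j ji.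
  by rewrite mxE eq_sym (negbTE ji) normr0.
apply: (@le_trans _ _ (\sum_l `|A i l| * absum A ^+ k)).
  apply: (@le_trans _ _ (\sum_j \sum_l `|A i l| * `|(A ^+ k) l j|)).
    apply: ler_sum => j _; rewrite exprS mxE (le_trans (ler_norm_sum _ _ _))//.
    by apply: ler_sum => l _; rewrite normrM.
  rewrite exchange_big; apply: ler_sum => l _; rewrite -big_distrr/=.
  by rewrite ler_wpM2l.
rewrite exprS -big_distrl/= ler_wpM2r ?exprn_ge0 ?absum_ge0//.
by rewrite /absum [leRHS](bigD1 i)//= lerDl; apply: sumr_ge0 => l _; exact: sumr_ge0.
Qed.

Lemma exprZmx (s : R) A k : (s *: A) ^+ k = s ^+ k *: A ^+ k.
Proof.
elim: k => [|k IH]; first by rewrite !expr0 scale1r.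
rewrite [LHS]exprS IH [LHS]/(_ *m _) -[LHS]scalemxAl -scalemxAr scalerA -exprS.
by rewrite [A ^+ _ in RHS](exprS A).
Qed.

Lemma trmxX A k : (A ^+ k)^T = A^T ^+ k.
Proof.
elim: k => [|k IH]; first by rewrite !expr0 trmx1.
by rewrite exprS exprSr [LHS]trmx_mul IH.
Qed.

Lemma cvg_mx_entries (F : nat -> 'M[R]_n) (L : 'M[R]_n) :
  (forall i j, (fun k => F k i j) @ \oo --> L i j) -> F @ \oo --> L.
Proof.
move=> h B [P hP PB]; rewrite nbhs_filterE.
have H : \forall k \near \oo, forall ij : 'I_n * 'I_n, P ij.1 ij.2 (F k ij.1 ij.2).
  by apply: filter_forall => -[i j]; exact: (h i j _ (hP i j)).
by apply: filterS H => k Hk; apply: PB => i j; exact: (Hk (i, j)).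
Qed.

Definition xterm A i j k : R := (k`!%:R)^-1 * (A ^+ k) i j.

Lemma xterm_le A i j k : `|xterm A i j k| <= exp_coeff (absum A) k.
Proof.
rewrite exp_coeffE /xterm normrM ger0_norm ?invr_ge0 ?ler0n//.
by rewrite ler_wpM2l ?invr_ge0 ?ler0n// absum_exp.
Qed.

Lemma is_cvg_xterm A i j : cvgn (series (xterm A i j)).
Proof.
apply: normed_cvg; apply: (series_le_cvg _ _ _ (is_cvg_series_exp_coeff (absum A))) => k //.
- exact: normr_ge0.
- exact: exp_coeff_ge0 (absum_ge0 A).
- exact: xterm_le.
Qed.

Lemma expmx_entry A i j : expmx A i j = limn (series (xterm A i j)).
Proof.
have : series (fun k => (k`!%:R)^-1 *: A ^+ k) @ \oo -->
    (\matrix_(i, j) limn (series (xterm A i j)) : 'M[R]_n).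
  apply: cvg_mx_entries => i' j'; rewrite mxE.
  rewrite (_ : (fun k => _) = series (xterm A i' j')); first exact: is_cvg_xterm.
  apply/funext => k; rewrite /series /= summxE; apply: eq_bigr => l _.
  by rewrite mxE.
by move=> /cvg_lim => /(_ (@norm_hausdorff _ _)); rewrite /expmx => ->; rewrite mxE.
Qed.

Lemma expR_partial_le (x : R) N : 0 <= x -> \sum_(0 <= k < N) exp_coeff x k <= expR x.
Proof.
move=> x0.
have nd : {homo series (exp_coeff x) : m k / (m <= k)%N >-> m <= k}.
  by apply: nondecreasing_series => k _ _; exact: exp_coeff_ge0.
exact: (nondecreasing_cvgn_le nd (@is_cvg_series_exp_coeff R x)).
Qed.

Lemma squeeze0 (f g : nat -> R) : (\forall N \near \oo, `|f N| <= g N) ->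
  g @ \oo --> 0 -> f @ \oo --> 0.
Proof.
move=> fg g0; apply/norm_cvg0P.
apply: (squeeze_cvgr _ (cvg_cst 0) g0).
by apply: filterS fg => N ->; rewrite normr_ge0.
Qed.

(** The tail of the exponential series of the number absum A. *)
Lemma expmx_trunc A i j m :
  `|expmx A i j - \sum_(0 <= k < m) xterm A i j k| <= absum A ^+ m * expR (absum A).
Proof.
rewrite expmx_entry; set c := \sum_(0 <= k < m) _.
have cv : (fun N => `|series (xterm A i j) N - c|) @ \oo --> `|limn (series (xterm A i j)) - c|.
  by apply: cvg_norm; apply: cvgB; [exact: is_cvg_xterm|exact: cvg_cst].
rewrite -(cvg_lim (@norm_hausdorff _ _) cv); apply: limr_le; first by apply: cvgP cv.
near=> N; have mN : (m <= N)%N by near: N; exact: nbhs_infty_ge.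
rewrite /series /= (@big_cat_nat _ _ _ m)//= -/c [c + _]addrC addrK.
apply: (le_trans (ler_norm_sum _ _ _)).
apply: (@le_trans _ _ (\sum_(m <= k < N) absum A ^+ m * exp_coeff (absum A) (k - m)%N)).
  apply: ler_sum_nat => k /andP[mk kN]; apply: (le_trans (xterm_le _ _ _ _)).
  rewrite !exp_coeffE -[in leLHS](subnK mk) exprD mulrCA mulrA mulrAC.
  set p := absum A ^+ (k - m); set q := absum A ^+ m.
  have -> : q * ((k - m)`!%:R^-1 * p) = p * q / (k - m)`!%:R by ring.
  rewrite ler_wpM2l ?mulr_ge0 ?exprn_ge0 ?absum_ge0//.
  rewrite lef_pV2 ?posrE ?ltr0n ?fact_gt0// ler_nat.
  by apply: leq_fact; rewrite leq_addr.
rewrite -big_distrr/= ler_wpM2l ?exprn_ge0 ?absum_ge0//.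
rewrite -{1}(add0n m) big_addn.
under eq_bigr do rewrite addnK.
exact: expR_partial_le (absum_ge0 A).
Unshelve. all: by end_near. Qed.

Lemma expmx_tr A : expmx A^T = (expmx A)^T.
Proof.
apply/matrixP => i j; rewrite mxE !expmx_entry; congr (limn (series _)).
by apply/funext => k; rewrite /xterm -trmxX mxE.
Qed.

Lemma measurable_expmx A i j :
  measurable_fun [set: measurableTypeR R] (fun s : measurableTypeR R => expmx (s *: A) i j).
Proof.
apply: (@measurable_fun_cvg _ _ _ _ (fun N (s : measurableTypeR R) => series (xterm (s *: A) i j) N)).
  move=> N; rewrite /series /=.
  apply: measurable_sum => k; rewrite /xterm.
  apply: measurable_funM; first exact: measurable_cst.
  under eq_fun do rewrite exprZmx mxE.
  apply: measurable_funM; last exact: measurable_cst.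
  exact: measurable_funX.
by move=> s _; rewrite expmx_entry; exact: is_cvg_xterm.
Qed.

Lemma det_cvg (F : nat -> 'M[R]_n) (L : 'M[R]_n) :
  (forall i j, (fun k => F k i j) @ \oo --> L i j) -> (fun k => \det (F k)) @ \oo --> \det L.
Proof.
move=> h; rewrite /determinant.
apply: cvg_big => [|s _]; first exact: add_continuous.
apply: cvgM; first exact: cvg_cst.
by apply: cvg_big => [|i _]; [exact: mul_continuous|exact: h].
Qed.

Lemma pow_sub_le (p q M : R) N : `|p| <= M -> `|q| <= M -> 1 <= M ->
  `|p ^+ N - q ^+ N| <= N%:R * M ^+ N * `|p - q|.
Proof.
move=> pM qM M1; have M0 : 0 <= M by apply: le_trans M1.
rewrite subrXX normrM mulrC ler_wpM2r//.
apply: (le_trans (ler_norm_sum _ _ _)).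
apply: (@le_trans _ _ (\sum_(i < N) M ^+ N)).
  apply: ler_sum => i _; rewrite normrM !normrX.
  apply: (@le_trans _ _ (M ^+ (N.-1 - i) * M ^+ i)).
    by apply: ler_pM; rewrite ?exprn_ge0// lerXn2r// nnegrE.
  by rewrite -exprD; apply: ler_weXn2l => //; have := ltn_ord i; lia.
by rewrite sumr_const card_ord mulr_natl.
Qed.

Lemma binom_fact_le N k : (k <= N.+1)%N ->
  `|('C(N.+1, k))%:R / N.+1%:R ^+ k - (k`!%:R)^-1| <= 4 ^+ k / k`!%:R / N.+1%:R :> R.
Proof.
move=> kN.
have N0 : (N.+1%:R : R) != 0 by rewrite pnatr_eq0.
have k0 : (k`!%:R : R) != 0 by rewrite pnatr_eq0 -lt0n fact_gt0.
have ff (m : nat) : (m <= N.+1)%N -> 1 - (4 ^+ m) / N.+1%:R <= (N.+1 ^_ m)%:R / N.+1%:R ^+ m :> R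
    /\ (N.+1 ^_ m)%:R / N.+1%:R ^+ m <= 1 :> R.
  elim: m => [_|m IH mN].
    by rewrite ffactn0 !expr0 divr1 gerBl divr_ge0//.
  have [h1 h2] := IH (ltnW mN).
  have E : (N.+1 ^_ m.+1)%:R / N.+1%:R ^+ m.+1 =
     (N.+1 ^_ m)%:R / N.+1%:R ^+ m * (1 - m%:R / N.+1%:R) :> R.
    rewrite ffactnSr natrM natrB ?(ltnW mN)// exprSr.
    by move: N0 (expf_neq0 m N0) => /= + +; move: (N.+1%:R : R) => u u0 um; field; rewrite u0 um.
  rewrite E; set x := (N.+1 ^_ m)%:R / N.+1%:R ^+ m in h1 h2 *.
  have x0 : 0 <= x by rewrite divr_ge0// ?exprn_ge0.
  have m4 : m%:R <= 4 ^+ m :> R.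
    by rewrite -natrX ler_nat ltnW// ltn_expl.
  have y0 : 0 <= m%:R / N.+1%:R :> R by rewrite divr_ge0.
  split.
    have : x * (m%:R / N.+1%:R) <= 4 ^+ m / N.+1%:R.
      by apply: (@le_trans _ _ (m%:R / N.+1%:R)); rewrite ?ler_piMl// ler_pM2r ?invr_gt0.
    have : 0 <= 4 ^+ m / N.+1%:R :> R by rewrite divr_ge0// exprn_ge0.
    rewrite (_ : 4 ^+ m.+1 / N.+1%:R = 4 * (4 ^+ m / N.+1%:R) :> R); last by rewrite exprS mulrA.
    rewrite mulrBr mulr1; clearbody x; move: h1.
    move: (4 ^+ m / N.+1%:R) (x * (m%:R / N.+1%:R)) => u w; lra.
  by rewrite mulrBr mulr1; apply: le_trans h2; rewrite gerBl mulr_ge0.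
have [h1 h2] := ff k kN.
have E : ('C(N.+1, k))%:R / N.+1%:R ^+ k = (k`!%:R)^-1 * ((N.+1 ^_ k)%:R / N.+1%:R ^+ k) :> R.
  rewrite -bin_ffact natrM; move: N0 (expf_neq0 k N0) k0 => /= + +; move: (N.+1%:R : R) (k`!%:R : R) => u w u0 um w0.
  by field; rewrite w0 um.
rewrite E -[X in _ - X]mulr1 -mulrBr normrM ger0_norm ?invr_ge0//.
rewrite [4 ^+ k / _]mulrC -mulrA ler_wpM2l ?invr_ge0//.
by rewrite ler0_norm ?subr_le0// opprB lerBlDr addrC -lerBlDr.
Qed.

(** Compare the binomial expansion of (1 + A / N)^N with the series termwise:
    the k-th coefficients differ by O(4^k / (k! N)), a bound that is summable
    against |A|^k. *)
Lemma expmx_euler A i j :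
  (fun N => ((1 + N.+1%:R^-1 *: A) ^+ N.+1) i j) @ \oo --> expmx A i j.
Proof.
have E N : ((1 + N.+1%:R^-1 *: A) ^+ N.+1) i j =
   series (xterm A i j) N.+2 + \sum_(0 <= k < N.+2) (('C(N.+1, k))%:R / N.+1%:R ^+ k - (k`!%:R)^-1) * (A ^+ k) i j.
  rewrite exprDn_comm; last by rewrite /GRing.comm mul1r mulr1.
  rewrite summxE /series /= -big_split big_mkord; apply: eq_bigr => k _.
  rewrite expr1n mul1r exprZmx /xterm.
  have -> : ((N.+1%:R^-1 ^+ k *: A ^+ k) *+ 'C(N.+1, k)) i j = 'C(N.+1, k)%:R * (N.+1%:R^-1 ^+ k * (A ^+ k) i j).
    by rewrite -scaler_nat !mxE.
  by rewrite exprVn /=; ring.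
rewrite (_ : (fun N => _) = fun N => series (xterm A i j) N.+2 + \sum_(0 <= k < N.+2) (('C(N.+1, k))%:R / N.+1%:R ^+ k - (k`!%:R)^-1) * (A ^+ k) i j); last exact/funext.
rewrite -[expmx A i j]addr0; apply: cvgD.
  have h := @is_cvg_xterm A i j; rewrite (expmx_entry A i j).
  by rewrite (cvg_shiftS (fun N => series (xterm A i j) N.+1)) (cvg_shiftS (series (xterm A i j))).
apply: (@squeeze0 _ (fun N => expR (4 * absum A) * N.+1%:R^-1)).
- apply: nearW => N.
  apply: (le_trans (ler_norm_sum _ _ _)).
  apply: (@le_trans _ _ (\sum_(0 <= k < N.+2) exp_coeff (4 * absum A) k * N.+1%:R^-1)).
    apply: ler_sum_nat => k /andP[_ kN]; rewrite normrM exp_coeffE exprMn.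
    apply: (@le_trans _ _ (4 ^+ k / k`!%:R / N.+1%:R * absum A ^+ k)).
      by apply: ler_pM => //; [exact: binom_fact_le|exact: absum_exp].
    by rewrite le_eqVlt; apply/orP; left; apply/eqP; ring.
  rewrite -big_distrl/= ler_wpM2r ?invr_ge0//.
  apply: expR_partial_le.
  by rewrite mulr_ge0// absum_ge0.
- rewrite -(mulr0 (expR (4 * absum A))); apply: cvgM; first exact: cvg_cst.
  exact: cvg_harmonic.
Qed.

Lemma expR_trunc2 (x : R) : `|expR x - (1 + x)| <= x ^+ 2 * expR `|x|.
Proof.
have h0 := expR_ge1Dx x; have h1 := expR_ge1Dx (- x).
rewrite ger0_norm ?subr_ge0//.
have h2 : expR x * (1 - x) <= 1.
  by have := ler_wpM2l (expR_ge0 x) h1; rewrite -expRD subrr expR0.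
have e1 : 1 <= expR `|x| by rewrite -expR0 ler_expR.
have [x0|x0] := leP 0 x.
  rewrite ger0_norm//; have := ler_wpM2l x0 h2; have := expR_ge0 x; nra.
have : x ^+ 2 * 1 <= x ^+ 2 * expR `|x| by rewrite ler_wpM2l ?sqr_ge0.
have : x * (expR x - 1 - x) <= 0 by rewrite nmulr_rle0//; lra.
nra.
Qed.

(** The determinant agrees with the product of the diagonal entries 1 + t A_ii
    up to O(t^2) by [det_diag_isO]. *)
Lemma det1D_isO A : isO 2 (fun t => \det (1 + t *: A) - expR (t * \tr A)).
Proof.
have h1 : isO 2 (fun t => \det (1 + t *: A) - \prod_i (1 + t *: A) i i).
  apply: det_diag_isO => [i|i j ij].
    apply: (isO_eq (isOD (isO_cst 1) (isO_le (leq0n 1) (isOZ (A i i) (isOX 1))))) => t.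
    by rewrite !mxE eqxx expr1 mulrC.
  by apply: (isO_eq (isOZ (A i j) (isOX 1))) => t; rewrite !mxE (negbTE ij) add0r expr1 mulrC.
have ex (c : R) : isO 2 (fun t => (1 + t * c) - expR (t * c)).
  exists (c ^+ 2 * expR `|c|); apply: filterS2 near0_pos near0_le1 => t t0 t1.
  rewrite distrC; apply: (le_trans (expR_trunc2 _)).
  rewrite (_ : c ^+ 2 * expR `|c| * t ^+ 2 = (t * c) ^+ 2 * expR `|c|); last by ring.
  apply: ler_wpM2l; rewrite ?sqr_ge0//.
  by rewrite ler_expR normrM ger0_norm ?(ltW t0)// ler_piMl.
have b1 (c : R) : isO 0 (fun t => 1 + t * c).
  apply: (isO_eq (isOD (isO_cst 1) (isO_le (leq0n 1) (isOZ c (isOX 1))))) => t.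
  by rewrite expr1 mulrC.
have h2 : isO 2 (fun t => \prod_i (1 + t * A i i) - \prod_i expR (t * A i i)).
  apply: isO_prodB => i _ //.
  apply: (isO_eq (isOB (b1 (A i i)) (isO_le (leq0n 2) (ex (A i i))))) => t.
  by rewrite opprB addrC subrK.
apply: (isO_eq (isOD h1 h2)) => t.
rewrite (eq_bigr (fun i => 1 + t * A i i)) => [|i _]; last by rewrite !mxE eqxx.
by rewrite -expR_sum -mulr_sumr /mxtrace; ring.
Qed.

(** By multiplicativity the determinant is the limit of det (1 + A / N)^N, and
    det (1 + A / N) = exp (tr A / N) + O(1 / N^2); as N-th powers of both stay
    bounded, raising to this power multiplies the error by N only. *)
Lemma det_expmx A : \det (expmx A) = expR (\tr A).
Proof.
have h1 : (fun N => \det (1 + N.+1%:R^-1 *: A) ^+ N.+1) @ \oo --> \det (expmx A).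
  rewrite (_ : (fun N => _) = fun N => \det ((1 + N.+1%:R^-1 *: A) ^+ N.+1)).
    by apply: det_cvg => i j; exact: expmx_euler.
  apply/funext => N; move: (N.+1%:R^-1) => u; elim: N.+1 => [|m IH]; first by rewrite !expr0 det1.
  by rewrite !exprS IH [in RHS]/GRing.mul/= det_mulmx.
apply: (cvg_unique _ h1) => //.
have [C hC] := det1D_isO A.
pose a := `|\tr A| + `|C|.
have near1 (P : R -> Prop) : (\forall t \near (0:R)^'+, P t) -> \forall N \near \oo, P (N.+1%:R^-1).
  move=> [e /= e0 he]; have := near_infty_natSinv_lt (PosNum e0).
  apply: filterS => N /= Ne; apply: he; rewrite ?invr_gt0//.
  by rewrite /ball_/= sub0r normrN ger0_norm ?invr_ge0.
suff h2 : (fun N => \det (1 + N.+1%:R^-1 *: A) ^+ N.+1 - expR (\tr A)) @ \oo --> 0.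
  rewrite -[expR _]add0r (_ : (fun N => _) = fun N => (\det (1 + N.+1%:R^-1 *: A) ^+ N.+1 - expR (\tr A)) + expR (\tr A)).
    by apply: cvgD => //; exact: cvg_cst.
  by apply/funext => N; rewrite subrK.
apply: (@squeeze0 _ (fun N => expR a * `|C| * N.+1%:R^-1)); last first.
  rewrite -(mulr0 (expR a * `|C|)); apply: cvgM; first exact: cvg_cst.
  exact: cvg_harmonic.
apply: filterS2 (near1 _ hC) (near1 _ near0_le1) => N hN N1.
set u : R := N.+1%:R^-1 in hN N1 *.
have u0 : 0 < u by rewrite invr_gt0.
have uN : N.+1%:R * u = 1 by rewrite mulfV.
have eN : expR (\tr A) = expR (u * \tr A) ^+ N.+1.
  by rewrite -expRM_natl mulrA uN mul1r.
have q1 : `|expR (u * \tr A)| <= expR (u * a).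
  rewrite ger0_norm ?expR_ge0// ler_expR ler_wpM2l ?(ltW u0)//.
  by rewrite (le_trans (ler_norm _))// lerDl.
have hN' : `|\det (1 + u *: A) - expR (u * \tr A)| <= `|C| * u ^+ 2.
  by apply: (le_trans hN); rewrite ler_wpM2r ?sqr_ge0// ler_norm.
have p1 : `|\det (1 + u *: A)| <= expR (u * a).
  have := ler_normD (\det (1 + u *: A) - expR (u * \tr A)) (expR (u * \tr A)).
  rewrite subrK => /le_trans; apply.
  rewrite (_ : u * a = u * `|\tr A| + u * `|C|); last by rewrite mulrDr.
  rewrite expRD; have x1 := expR_ge1Dx (u * `|C|).
  have x2 : 1 <= expR (u * `|\tr A|) by rewrite -expR0 ler_expR mulr_ge0 // ltW.
  have x3 : `|expR (u * \tr A)| <= expR (u * `|\tr A|).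
    by rewrite ger0_norm ?expR_ge0// ler_expR ler_wpM2l ?(ltW u0)// ler_norm.
  have x4 : `|C| * u ^+ 2 <= u * `|C|.
    by rewrite mulrC ler_wpM2r// expr2 ler_piMl // ltW.
  have x5 : 0 <= u * `|C| by rewrite mulr_ge0// ltW.
  have : 1 * (u * `|C|) <= expR (u * `|\tr A|) * (u * `|C|) by rewrite ler_wpM2r.
  have : expR (u * `|\tr A|) * (1 + u * `|C|) <= expR (u * `|\tr A|) * expR (u * `|C|) by rewrite ler_wpM2l// expR_ge0.
  rewrite mulrDr mulr1; lra.
rewrite eN; apply: (le_trans (pow_sub_le _ p1 q1 _)).
  by rewrite -expR0 ler_expR mulr_ge0 ?addr_ge0// ltW.
rewrite -expRM_natl mulrA uN mul1r.
apply: (@le_trans _ _ (N.+1%:R * expR a * (`|C| * u ^+ 2))).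
  by rewrite ler_wpM2l ?mulr_ge0 ?expR_ge0.
rewrite (_ : _ * _ = (N.+1%:R * u) * (expR a * `|C| * u)); last by ring.
by rewrite uN mul1r.
Qed.

End Expmx.

(** * The controllability Gramian *)
Section Itv.
Context {R : realType}.
Notation T := (measurableTypeR R).
Notation mu := (@lebesgue_measure R).
Implicit Types (f g : T -> R) (t : R).

Lemma itv_integrable f t (C : R) : measurable_fun setT f -> 
  (forall s : T, 0 <= s <= t -> `|f s| <= C) -> mu.-integrable `[0, t] (EFin \o f).
Proof.
move=> mf fC; apply: measurable_bounded_integrable => //.
- by rewrite /= lebesgue_measure_itv/=; case: ifP => // _; rewrite -EFinB ltry.
- exact: measurable_funTS.
- exists C; split; first exact: num_real.
  by move=> M CM s /=; rewrite in_itv/= => /fC /le_trans; apply; exact: ltW.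
Qed.

Lemma itv_integrableZ f t (c : R) : mu.-integrable `[0, t] (EFin \o f) ->
  mu.-integrable `[0, t] (EFin \o (fun s => c * f s)).
Proof.
move=> i; have mI : measurable (`[0, t]%classic : set T) by exact: measurable_itv.
by apply: (@eq_integrable _ _ _ mu _ mI _ _ _ (integrableZl mI c i)) => x _ /=; rewrite EFinM.
Qed.

Lemma itv_integrableD f g t : mu.-integrable `[0, t] (EFin \o f) ->
  mu.-integrable `[0, t] (EFin \o g) -> mu.-integrable `[0, t] (EFin \o (fun s => f s + g s)).
Proof.
move=> i j; have mI : measurable (`[0, t]%classic : set T) by exact: measurable_itv.
by apply: (@eq_integrable _ _ _ mu _ mI _ _ _ (integrableD mI i j)) => x _ /=; rewrite EFinD.
Qed.

Lemma itv_integrable_pow t m : 0 < t -> mu.-integrable `[0, t] (EFin \o (fun s : T => s ^+ m)).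
Proof.
move=> t0; apply: (@itv_integrable _ _ (t ^+ m)); first exact: measurable_funX.
by move=> s /andP[s0 st]; rewrite ger0_norm ?exprn_ge0// lerXn2r// nnegrE (le_trans s0).
Qed.

Lemma int_pow t m : 0 < t -> \int[mu]_(s in `[0, t]) (s : T) ^+ m = t ^+ m.+1 / m.+1%:R.
Proof.
move=> t0; pose F := fun s : R => s ^+ m.+1 / m.+1%:R.
have dF (x : R) : is_derive x 1 F (x ^+ m).
  have h : is_derive x 1 (fun s : R => s ^+ m.+1) (m.+1%:R * x ^+ m).
    have := exp_derive m.+1 x 1; rewrite /= scaler_nat.
    move=> h0; apply: DeriveDef; first exact: exprn_derivable.
    by rewrite h0 mulr_natl /GRing.scale/= mulr1.
  rewrite (_ : F = (m.+1%:R)^-1 \*: (fun s : R => s ^+ m.+1)); last first.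
    by apply/funext => s /=; rewrite /F mulrC.
  apply: (is_derive_eq (is_deriveZ (m.+1%:R)^-1 h)).
  by rewrite /GRing.scale/= mulrA mulVf ?mul1r// pnatr_eq0.
rewrite /Rintegral (@continuous_FTC2 _ (fun s => s ^+ m) F 0 t)//.
- by rewrite /F /= expr0n /= mul0r subr0.
- by apply: continuous_subspaceT => x; exact: exprn_continuous.
- split => //.
  + apply: cvg_at_right_filter; apply: differentiable_continuous; apply/derivable1_diffP.
    exact: (@ex_derive _ _ _ _ _ _ _ (dF 0)).
  + apply: cvg_at_left_filter; apply: differentiable_continuous; apply/derivable1_diffP.
    exact: (@ex_derive _ _ _ _ _ _ _ (dF t)).
- by move=> x _; rewrite derive1E; exact: (@derive_val _ _ _ _ _ _ _ (dF x)).
Qed.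

Lemma int_le_pow f t m (C : R) : 0 < t -> measurable_fun setT f ->
  (forall s : T, 0 <= s <= t -> `|f s| <= C * s ^+ m) ->
  `|\int[mu]_(s in `[0, t]) f s| <= C * (t ^+ m.+1 / m.+1%:R).
Proof.
move=> t0 mf fC.
have C0 : 0 <= C.
  have := fC t; rewrite (ltW t0) lexx => /(_ isT) /(le_trans (normr_ge0 _)).
  by rewrite pmulr_lge0// exprn_gt0.
have if_ : mu.-integrable `[0, t] (EFin \o f).
  apply: (@itv_integrable _ _ (C * t ^+ m)) => // s st; apply: (le_trans (fC _ st)).
  move/andP: st => [s0 st]; rewrite ler_wpM2l// lerXn2r// nnegrE.
  exact: le_trans st.
have iC : mu.-integrable `[0, t] (EFin \o (fun s : T => C * s ^+ m)).
  apply: (@itv_integrable _ _ (C * t ^+ m)).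
    by apply: measurable_funM => //; exact: measurable_funX.
  move=> s /andP[s0 st]; rewrite ger0_norm ?mulr_ge0 ?exprn_ge0// ler_wpM2l// lerXn2r// nnegrE.
  exact: le_trans st.
apply: (le_trans (le_normr_Rintegral _ if_)) => //.
rewrite -int_pow// -RintegralZl//; last exact: itv_integrable_pow.
apply: le_Rintegral => //.
  apply: (@itv_integrable _ _ (C * t ^+ m)); first exact: measurableT_comp.
  move=> s st; rewrite normr_id; apply: (le_trans (fC _ st)).
  move/andP: st => [s0 st]; rewrite ler_wpM2l// lerXn2r// nnegrE.
  exact: le_trans st.
Qed.

End Itv.

Section Gram.
Context {R : realType} {n : nat} (A : 'M[R]_n) (b : 'cV[R]_n).
Notation T := (measurableTypeR R).
Notation mu := (@lebesgue_measure R).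
Implicit Types (u v : 'cV[R]_n) (t : R).

(** The quadratic form of the Gramian is the integral of flow u squared; see
    [gramianE]. *)
Definition flow u (s : T) : R := dotp u (expmx (s *: A) *m b).

(** The Taylor coefficients at 0 of [flow], up to factorials. *)
Definition moment u k : R := dotp u (A ^+ k *m b).

Lemma flowE u s : flow u s = \sum_i \sum_j u i 0 * (expmx (s *: A) i j * b j 0).
Proof. by rewrite /flow dotpE; apply: eq_bigr => i _; rewrite mxE big_distrr. Qed.

Lemma measurable_flow u : measurable_fun setT (flow u).
Proof.
rewrite (_ : flow u = fun s : T => \sum_i \sum_j u i 0 * (expmx (s *: A) i j * b j 0)).
  apply: measurable_sum => i; apply: measurable_sum => j.
  apply: measurable_funM => //; apply: measurable_funM => //.
  exact: measurable_expmx.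
by apply/funext => s; exact: flowE.
Qed.

Lemma flow_trunc u m t : exists C, forall s, 0 <= s <= t ->
  `|flow u s - \sum_(0 <= k < m) s ^+ k * (moment u k / k`!%:R)| <= C * s ^+ m.
Proof.
exists (\sum_i \sum_j `|u i 0| * (absum A ^+ m * expR (t * absum A) * `|b j 0|)).
move=> s /andP[s0 st].
have -> : \sum_(0 <= k < m) s ^+ k * (moment u k / k`!%:R) =
    \sum_i \sum_j u i 0 * ((\sum_(0 <= k < m) xterm (s *: A) i j k) * b j 0).
  rewrite (eq_bigr (fun k => \sum_i \sum_j u i 0 * (xterm (s *: A) i j k * b j 0))).
    rewrite exchange_big/=; apply: eq_bigr => i _; rewrite exchange_big/=; apply: eq_bigr => j _.
    by rewrite -big_distrr -big_distrl.
  move=> k _; rewrite /moment dotpE mulrCA mulr_suml.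
  apply: eq_bigr => i _; rewrite mxE mulr_sumr mulr_suml.
  by apply: eq_bigr => j _; rewrite /xterm exprZmx mxE; ring.
rewrite flowE -sumrB big_distrl; apply: (le_trans (ler_norm_sum _ _ _)).
apply: ler_sum => i _; rewrite -sumrB big_distrl; apply: (le_trans (ler_norm_sum _ _ _)).
apply: ler_sum => j _ /=; rewrite -mulrBr -mulrBl !normrM -!mulrA ler_wpM2l//.
rewrite [leRHS](_ : _ = absum A ^+ m * expR (t * absum A) * s ^+ m * `|b j 0|); last by ring.
rewrite ler_wpM2r//; apply: (le_trans (expmx_trunc _ _ _ _)).
rewrite absumZ ger0_norm// exprMn.
have -> : absum A ^+ m * expR (t * absum A) * s ^+ m = s ^+ m * absum A ^+ m * expR (t * absum A) by ring.
apply: ler_wpM2l; first by rewrite mulr_ge0 ?exprn_ge0 ?absum_ge0.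
by rewrite ler_expR ler_wpM2r ?absum_ge0.
Qed.

Lemma flow_bounded u t : exists C, forall s : T, 0 <= s <= t -> `|flow u s| <= C.
Proof.
have [C h] := flow_trunc u 0 t; exists C => s st.
by have := h s st; rewrite big_geq// subr0 expr0 mulr1.
Qed.

Lemma flow_integrable u v t : mu.-integrable `[0, t] (EFin \o (fun s : T => flow u s * flow v s)).
Proof.
have [C hC] := flow_bounded u t; have [D hD] := flow_bounded v t.
apply: (@itv_integrable _ _ _ (C * D)).
  by apply: measurable_funM; exact: measurable_flow.
by move=> s st; rewrite normrM ler_pM// ?hC ?hD.
Qed.

Lemma Rint_sum (I : Type) (r : seq I) t (F : I -> T -> R) :
  (forall i, mu.-integrable `[0, t] (EFin \o F i)) ->
  mu.-integrable `[0, t] (EFin \o (fun s => \sum_(i <- r) F i s)) /\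
  \int[mu]_(s in `[0, t]) (\sum_(i <- r) F i s) = \sum_(i <- r) \int[mu]_(s in `[0, t]) F i s.
Proof.
move=> h; elim: r => [|i r [IH1 IH2]].
  rewrite big_nil (_ : (fun s => _) = fun=> 0); last by apply/funext => s; rewrite big_nil.
  by split; [exact: integrable0|rewrite Rintegral_cst// mul0r].
rewrite big_cons -IH2 -RintegralD//.
rewrite (_ : (fun s => _) = (fun s => F i s + \sum_(i <- r) F i s)); last first.
  by apply/funext => s; rewrite big_cons.
split => //; exact: integrableD (h i) IH1.
Qed.

Lemma dotp_delta (w : 'cV[R]_n) i : dotp (delta_mx i 0) w = w i 0.
Proof.
rewrite dotpE (bigD1 i)//= mxE !eqxx mul1r big1 ?addr0// => j ji.
by rewrite mxE (negbTE ji) mul0r.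
Qed.

Lemma flow_coord u s : flow u s = \sum_i u i 0 * flow (delta_mx i 0) s.
Proof.
rewrite /flow dotpE; apply: eq_bigr => i _; congr (_ * _).
by rewrite dotp_delta.
Qed.

Lemma gramianE u v t : dotp u (gramian A b t *m v) = \int[mu]_(s in `[0, t]) (flow u s * flow v s).
Proof.
have fi i s : (expmx (s *: A) *m b) i 0 = flow (delta_mx i 0) s.
  by rewrite /flow dotp_delta.
have gE i j : gramian A b t i j = \int[mu]_(s in `[0, t]) (flow (delta_mx i 0) s * flow (delta_mx j 0) s).
  rewrite mxE; apply: eq_Rintegral => s _.
  have -> : s *: A^T = (s *: A)^T by rewrite linearZ.
  rewrite expmx_tr -mulmxA -trmx_mul -!fi.
  by rewrite mxE big_ord1 !mxE.
transitivity (\int[mu]_(s in `[0, t]) \sum_i \sum_j (u i 0 * v j 0) * (flow (delta_mx i 0) s * flow (delta_mx j 0) s)).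
  have H i j : mu.-integrable `[0, t] (EFin \o (fun s : T => (u i 0 * v j 0) * (flow (delta_mx i 0) s * flow (delta_mx j 0) s))).
    exact: itv_integrableZ (flow_integrable (delta_mx i 0) (delta_mx j 0) t).
  rewrite (Rint_sum (index_enum _) (fun i => (Rint_sum (index_enum _) (H i)).1)).2 dotpE.
  apply: eq_bigr => i _; rewrite (Rint_sum (index_enum _) (H i)).2 mxE big_distrr.
  apply: eq_bigr => j _; rewrite RintegralZl//; last exact: flow_integrable.
  rewrite -gE /=; ring.
apply: eq_Rintegral => s _; rewrite (flow_coord u) (flow_coord v) big_distrl.
by apply: eq_bigr => i _; rewrite big_distrr; apply: eq_bigr => j _ /=; ring.
Qed.

(** The first n moments are the coordinates of the row vector u^T times the
    Kalman matrix, whose rows are independent. *)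
Lemma kalman_moment u : kalman A b -> (forall k, (k < n)%N -> moment u k = 0) -> u = 0.
Proof.
rewrite /kalman; set K := \matrix_(_, _) _ => rK h.
have fK : row_free K by rewrite /row_free rK.
have : u^T *m K = 0.
  apply/matrixP => i j; rewrite ord1 [RHS]mxE -(h j (ltn_ord j)) /moment dotpE mxE.
  by apply: eq_bigr => l _; rewrite !mxE.
rewrite -(mul0mx _ K) => /(row_free_inj fK) /(congr1 (fun M => M^T)).
by rewrite trmxK trmx0.
Qed.

(** If u is nonzero, let m be the order of its first nonzero moment: near 0
    the function flow u is at least a multiple of s^m in absolute value, so
    its square has a positive integral. *)
Lemma gramian_spd t : kalman A b -> 0 < t -> spd (gramian A b t).
Proof.
move=> kal t0; split.
  apply/matrixP => i j; rewrite !mxE; apply: eq_Rintegral => s _.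
  have -> : s *: A^T = (s *: A)^T by rewrite linearZ.
  rewrite expmx_tr -!mulmxA -trmx_mul mulmxA.
  by rewrite mxE big_ord1 mxE [RHS]mxE big_ord1 mxE mulrC !mxE.
move=> u u0; rewrite gramianE.
have [m mn mm] : exists2 m, moment u m != 0 & forall k, (k < m)%N -> moment u k = 0.
  have ex : exists m, moment u m != 0.
    apply: contrapT => /forallNP h; move/eqP: u0; apply; apply: kalman_moment => // k _.
    by apply/eqP; apply: contrapT => /negP; exact: h.
  case: (ex_minnP ex) => m h1 h2; exists m => // k km.
  by apply/eqP; apply: contraTT km => /h2; rewrite -leqNgt.
have [C hC] := flow_trunc u m.+1 t.
pose c := `|moment u m / m`!%:R|.
have c0 : 0 < c by rewrite normr_gt0 mulf_neq0// invr_neq0// pnatr_eq0 -lt0n fact_gt0.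
(* Up to d the error C s^(m+1) is at most half of the leading term c s^m. *)
pose d := Num.min t (c / 2 / (`|C| + 1)).
have C1 : 0 < `|C| + 1 by rewrite ltr_wpDl.
have d0 : 0 < d by rewrite lt_min t0 !divr_gt0.
have flow_lb s : 0 <= s <= d -> c / 2 * s ^+ m <= `|flow u s|.
  move=> /andP[s0]; rewrite le_min => /andP[st sd].
  have := hC s; rewrite s0 st => /(_ isT).
  rewrite big_nat_recr//= big_nat_cond big1 ?add0r; last first.
    by move=> k /andP[/andP[_ km] _]; rewrite mm// mul0r mulr0.
  have : `|C| * s <= c / 2.
    move: sd; rewrite ler_pdivlMr// => sd; apply: le_trans sd.
    by rewrite mulrC ler_wpM2l// lerDl.
  have sm0 : 0 <= s ^+ m by rewrite exprn_ge0.
  move=> /(ler_wpM2r sm0) h1 h2.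
  have h3 : C * s ^+ m.+1 <= `|C| * s * s ^+ m.
    by rewrite exprS mulrA ler_wpM2r// ler_wpM2r// ler_norm.
  have h4 : `|s ^+ m * (moment u m / m`!%:R)| = c * s ^+ m.
    by rewrite normrM ger0_norm// mulrC.
  have h5 := ler_normD (flow u s) (s ^+ m * (moment u m / m`!%:R) - flow u s).
  rewrite addrC subrK h4 distrC in h5; nra.
have sub : `[0, d]%classic `<=` `[0, t]%classic.
  by move=> s /=; rewrite !in_itv/= => /andP[-> /le_trans]; apply; rewrite ge_min lexx.
have i1 := flow_integrable u u.
apply: (@lt_le_trans _ _ (\int[mu]_(s in `[0, d]) (flow u s * flow u s))).
  apply: (@lt_le_trans _ _ (\int[mu]_(s in `[0, d]) ((c / 2) ^+ 2 * (s : T) ^+ (m + m)))).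
    rewrite RintegralZl//; last exact: itv_integrable_pow.
    by rewrite int_pow// mulr_gt0 ?exprn_gt0 ?divr_gt0 ?exprn_gt0.
  apply: le_Rintegral => //.
    exact: itv_integrableZ (itv_integrable_pow (m + m) d0).
  move=> s /=; rewrite in_itv/= => sd; have := flow_lb s sd => h.
  rewrite -[flow u s * _]expr2 -[leRHS]real_normK ?num_real// exprD -expr2 -exprMn.
  apply: lerXn2r => //; rewrite nnegrE// mulr_ge0// ?exprn_ge0// ?divr_ge0// ?(ltW c0)//.
  by case/andP: sd.
rewrite /Rintegral; apply: fine_le.
- exact: integrable_fin_num.
- exact: integrable_fin_num.
- apply: ge0_subset_integral => //; last by move=> s _; rewrite lee_fin -expr2 sqr_ge0.
  by have /integrableP[] := i1 t.
Qed.

(** Multiply the two expansions and integrate. *)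
Lemma gram_expand u v i j (al be x y C D : R) :
  (forall s : T, 0 <= s <= 1 -> `|flow u s - al * s ^+ i * (1 + x * s)| <= C * s ^+ i.+2) ->
  (forall s : T, 0 <= s <= 1 -> `|flow v s - be * s ^+ j * (1 + y * s)| <= D * s ^+ j.+2) ->
  isO (i + j).+3 (fun t => dotp u (gramian A b t *m v) -
     al * be * (t ^+ (i + j).+1 / (i + j).+1%:R + (x + y) * (t ^+ (i + j).+2 / (i + j).+2%:R))).
Proof.
move=> hu hv; pose h (s : T) := s ^+ (i + j) + (x + y) * s ^+ (i + j).+1.
have mp m : measurable_fun [set: T] (fun s : T => s ^+ m) by exact: measurable_funX.
have mh : measurable_fun setT h.
  by apply: measurable_funD => //; apply: measurable_funM.
pose E := C * (`|be| * (1 + `|y|) + D) + `|al| * (1 + `|x|) * D + `|al * be * x * y|.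
have main (s : T) : 0 <= s <= 1 -> `|flow u s * flow v s - al * be * h s| <= E * s ^+ (i + j).+2.
  move=> s01; have := hu s s01; have := hv s s01; move/andP: s01 => [s0 s1].
  set p := al * s ^+ i * (1 + x * s); set q := be * s ^+ j * (1 + y * s) => hq hp.
  have lin (c z : R) m : `|c * s ^+ m * (1 + z * s)| <= `|c| * (1 + `|z|) * s ^+ m.
    rewrite !normrM (ger0_norm (exprn_ge0 _ s0)) mulrAC ler_wpM2r ?exprn_ge0//.
    rewrite ler_wpM2l// (le_trans (ler_normD _ _))// normr1 lerD2l normrM (ger0_norm s0).
    by rewrite ler_piMr.
  have hq' : `|flow v s| <= (`|be| * (1 + `|y|) + D) * s ^+ j.
    have := ler_normD q (flow v s - q); rewrite addrC subrK => /le_trans; apply.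
    rewrite mulrDl lerD ?lin//; apply: (le_trans hq).
    have D0 : 0 <= D.
      by have := le_trans (normr_ge0 _) (hv 1 _); rewrite expr1n mulr1; apply; rewrite ler01 lexx.
    rewrite ler_wpM2l// !exprS mulrA ler_piMl ?exprn_ge0//.
    by rewrite mulr_ile1.
  have -> : flow u s * flow v s - al * be * h s =
      (flow u s - p) * flow v s + p * (flow v s - q) + al * be * x * y * s ^+ (i + j).+2.
    by rewrite /p /q /h !exprS exprD; ring.
  rewrite (_ : E * _ = (C * s ^+ i.+2) * ((`|be| * (1 + `|y|) + D) * s ^+ j) +
     (`|al| * (1 + `|x|) * s ^+ i) * (D * s ^+ j.+2) + `|al * be * x * y| * s ^+ (i + j).+2); last first.
    by rewrite /E !exprS exprD; ring.
  apply: (le_trans (ler_normD _ _)); apply: lerD; last first.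
    by rewrite normrM (ger0_norm (exprn_ge0 _ s0)).
  apply: (le_trans (ler_normD _ _)); rewrite (normrM (flow u s - p)) (normrM p).
  by apply: lerD; apply: ler_pM => //; exact: lin.
have ih t : 0 < t -> mu.-integrable `[0, t] (EFin \o h).
  move=> t0; apply: itv_integrableD; first exact: itv_integrable_pow.
  by apply: itv_integrableZ; exact: itv_integrable_pow.
exists (E / (i + j).+3%:R); apply: filterS2 near0_pos near0_le1 => t t0 t1.
have <- : \int[mu]_(s in `[0, t]) (flow u s * flow v s - al * be * h s) = dotp u (gramian A b t *m v) -
     al * be * (t ^+ (i + j).+1 / (i + j).+1%:R + (x + y) * (t ^+ (i + j).+2 / (i + j).+2%:R)).
  rewrite RintegralB//; [|exact: flow_integrable|exact: itv_integrableZ (ih t t0)].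
  rewrite RintegralZl//; last exact: ih.
  rewrite gramianE; congr (_ - _ * _).
  rewrite RintegralD//; [|exact: itv_integrable_pow|by apply: itv_integrableZ; exact: itv_integrable_pow].
  by rewrite RintegralZl ?int_pow//; exact: itv_integrable_pow.
rewrite mulrAC -mulrA; apply: int_le_pow => //.
  apply: measurable_funB; last exact: measurable_funM.
  by apply: measurable_funM; exact: measurable_flow.
by move=> s /andP[s0 st]; apply: main; rewrite s0 (le_trans st).
Qed.

End Gram.

(** * The norm of the directional derivative *)
Section L2facts.
Context {R : realType} {n : nat}.
Notation mu := (lebesgue_cV n : {sigma_finite_measure set 'cV[R]_n -> \bar R}).
Implicit Types rho : 'cV[R]_n -> R.

Lemma abse_sqr (r : R) : (`|r%:E| `^ 2 = (r ^+ 2)%:E)%E.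
Proof.
rewrite -[`|_|%E]/(`|r|%:E) poweR_EFin; congr (_%:E).
by rewrite -[2]/(2%:R) powR_mulrn// real_normK// num_real.
Qed.

Lemma L2P rho : rho \in L2 <-> sqint mu rho.
Proof.
split.
  move=> h; split.
    by have := sub_Lfun_mfun h; rewrite inE.
  exact: (Lfun2_integrable_sqr h).
move=> [mf if_]; rewrite inE/=; apply/andP; split; rewrite inE//=.
rewrite /finite_norm unlock /Lnorm; apply: poweR_lty.
rewrite (eq_integral (fun x => (rho x ^+ 2)%:E)) => [|x _]; last exact: abse_sqr.
have /integrableP[_ ] := if_; apply: le_lt_trans.
by under [leRHS]eq_integral do rewrite /= ger0_norm ?sqr_ge0//.
Qed.

Lemma L2normE rho : sqint mu rho -> L2norm rho = (Num.sqrt (\int[mu]_x (rho x ^+ 2)))%:E.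
Proof.
move=> [mf if_]; rewrite /L2norm unlock /Lnorm.
rewrite (eq_integral (fun x => (rho x ^+ 2)%:E)) => [|x _]; last exact: abse_sqr.
by rewrite -EFin_Rintegral// poweR_EFin powR12_sqrt// Rintegral_ge0// => x _; exact: sqr_ge0.
Qed.
End L2facts.

Section GradFokkerPlanck.
Context {R : realType} {n : nat}.
Notation mu := (lebesgue_cV n.+1 : {sigma_finite_measure set 'cV[R]_n.+1 -> \bar R}).
Implicit Types (rho F : 'cV[R]_n.+1 -> R) (x y : 'cV[R]_n.+1).

Lemma Rint_ext (g f : 'cV[R]_n.+1 -> R) : (forall x, f x = g x) ->
  \int[mu]_x f x = \int[mu]_x g x.
Proof. by move=> fg; apply: eq_Rintegral => x _; exact: fg. Qed.

Lemma std_smooth_integrable F x : sqint mu F ->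
  mu.-integrable setT (EFin \o (fun y => gaussn 1 (x - y) * F y)).
Proof.
move=> sF; apply: sqint_mul sF.
exact: (scales_sqint ler01 (scales_cV_reflect x) (sqint_gaussn n.+1 ltr01)).
Qed.

Lemma std_gradZ a F : sqint mu F -> std_grad (fun y => a * F y) = (fun x => a * std_grad F x).
Proof.
move=> sF; apply/funext => x.
have h1 := @std_smooth_derive R n F x sF.
have h2 := @std_smooth_derive R n _ x (sqintZ a sF).
have sm z : std_smooth (fun y => a * F y) z = a * std_smooth F z.
  rewrite /std_smooth -RintegralZl//; last exact: std_smooth_integrable.
  by apply: eq_Rintegral => y _; rewrite mulrCA.
apply: (cvg_unique _ h2) => //.
rewrite (_ : (fun h => _) = (fun h => a * (h^-1 *: (std_smooth F (x + h *: delta_mx 0 0) - std_smooth F x)))); last first.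
  by apply/funext => h; rewrite !sm /GRing.scale/= -mulrBr mulrCA.
by apply: cvgM => //; exact: cvg_cst.
Qed.

(** A square root L of the covariance turns the density into the standard one.
    *)
Lemma gauss_density_gaussn (G L : 'M[R]_n.+1) (z : 'cV[R]_n.+1) : L *m L^T = G -> L \in unitmx ->
  gauss_density G (L *m z) = `|\det L|^-1 * gaussn 1 z.
Proof.
move=> LG uL; have uLT : L^T \in unitmx by rewrite unitmx_tr.
have dG : \det G = (\det L) ^+ 2 by rewrite -LG det_mulmx det_tr expr2.
have uG : G \in unitmx by rewrite -LG unitmx_mul uL.
have qE : dotp (L *m z) (invmx G *m (L *m z)) = dotp z z.
  rewrite dotp_mull !mulmxA.
  have -> : L^T *m invmx G *m L = 1%:M.
    have -> : invmx G = invmx L^T *m invmx L.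
      apply: (can_inj (mulKmx uG)); rewrite mulmxV// -LG mulmxA mulmxK// mulmxV//.
    by rewrite mulmxA mulmxV// mul1mx mulVmx.
  by rewrite mul1mx.
rewrite /gauss_density qE dG sqrtrM ?exprn_ge0 ?mulr_ge0 ?pi_ge0// sqrtr_sqr invfM -mulrA mulrCA.
congr (_ * _); rewrite /gaussn /gauss big_split/= -expR_sum prodr_const card_ord mulr1.
congr (_ * expR _).
  rewrite exprVn; congr (_^-1).
  by elim: (n.+1) => [|m IH]; rewrite ?expr0 ?sqrtr1// !exprS sqrtrM ?IH// mulr_ge0// pi_ge0.
rewrite dotpE sumrN big_distrl/=; congr (- _); apply: eq_bigr => i _.
by rewrite mulr1 expr2.
Qed.

Lemma scale_inv_scale (s h z : R) : s != 0 -> s * ((h * s)^-1 *: z) = h^-1 *: z.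
Proof. by move=> s0; rewrite /GRing.scale/= invfM -mulrA mulrCA mulVKf. Qed.

Section op.
Variables (G E : 'M[R]_n.+1) (q : 'cV[R]_n.+1) (c : R).
Hypotheses (spdG : spd G) (uE : E \in unitmx) (c0 : 0 < c) (q0 : q != 0).

Let smear rho x := \int[mu]_y (gauss_density G (x - y) * (c * rho (E *m y))).
Let beta := dotp q (invmx G *m q).

(** In the coordinates w = L^-1 x, with L adapted to the covariance G and to
    q, the gaussian becomes standard and the derivative along q becomes the
    square root of beta times the first partial derivative. *)
Lemma smear_grad : exists L : 'M[R]_n.+1, [/\ L \in unitmx, 0 < beta &
  forall rho, sqint mu rho -> let F := fun w => c * rho (E *m (L *m w)) in
    [/\ sqint mu F, 
      \int[mu]_x (F x ^+ 2) = c ^+ 2 * (`|\det E|^-1 * `|\det L|^-1 * \int[mu]_x (rho x ^+ 2)) &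
      forall x, is_derive x q (smear rho) (Num.sqrt beta * std_grad F (invmx L *m x))]].
Proof.
have [L [LG b0 qE]] := spd_adapted spdG q0.
have uG := spd_unit spdG.
have uL : L \in unitmx by move: uG; rewrite -LG unitmx_mul => /andP[].
exists L; split=> // rho srho F.
have uEL : E *m L \in unitmx by rewrite unitmx_mul uE.
have sEL := scales_cV_affine 0 uEL.
have sF0 : sqint mu (fun w => rho (E *m L *m w + 0)).
  by apply: (scales_sqint _ sEL srho); rewrite invr_ge0.
have FE : F = fun w => c * rho (E *m L *m w + 0).
  by apply/funext => w; rewrite /F mulmxA addr0.
have sF : sqint mu F by rewrite FE; exact: sqintZ.
have uLV : invmx L \in unitmx by rewrite unitmx_inv.
have sLV := scales_cV_affine 0 uLV.
split => //.
  have [_ irho] := srho.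
  have r0 : 0 <= `|\det (E *m L)|^-1 by rewrite invr_ge0.
  have [i1 E1] := scales_Rintegral (f := fun x => rho x ^+ 2) r0 sEL irho.
  rewrite (Rint_ext (g := fun x => c ^+ 2 * rho (E *m L *m x + 0) ^+ 2)) => [|x]; last by rewrite FE exprMn.
  by rewrite RintegralZl// E1 det_mulmx normrM invfM.
have smE x : smear rho x = std_smooth F (invmx L *m x).
  have isq := std_smooth_integrable (invmx L *m x) sF.
  have r0 : 0 <= `|\det (invmx L)|^-1 by rewrite invr_ge0.
  have [i1 E1] := scales_Rintegral r0 sLV isq.
  rewrite det_inv normfV invrK in E1.
  rewrite /std_smooth /smear.
  have dL : `|\det L| != 0 by rewrite normr_eq0 -unitfE -unitmxE.
  rewrite -[RHS](mulKf dL) -E1 -RintegralZl//.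
  apply: eq_Rintegral => y _.
  by rewrite addr0 -mulmxBr /F (mulKVmx uL) -{1}(mulKVmx uL (x - y)) (gauss_density_gaussn _ LG uL) -mulrA.
move=> x; have iq : invmx L *m q = Num.sqrt beta *: delta_mx 0 0.
  by rewrite [in LHS]qE -scalemxAr mulKmx.
have sb : 0 < Num.sqrt beta by rewrite sqrtr_gt0.
have cv : h^-1 *: (smear rho (h *: q + x) - smear rho x) @[h --> (0:R)^'] -->
    Num.sqrt beta * std_grad F (invmx L *m x).
  have h1 := @std_smooth_derive R n F (invmx L *m x) sF.
  have h2 : (h * Num.sqrt beta) @[h --> (0:R)^'] --> (0:R)^'.
    move=> B [e /= e0 he]; exists (e / Num.sqrt beta); first exact: divr_gt0.
    move=> h /= hh hn0; apply: he; last by rewrite mulf_neq0 ?(lt0r_neq0 sb).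
    by move: hh; rewrite /= !sub0r !normrN normrM (gtr0_norm sb) ltr_pdivlMr.
  rewrite (_ : (fun h => _) = (fun h => Num.sqrt beta * ((h * Num.sqrt beta)^-1 *:
      (std_smooth F (invmx L *m x + (h * Num.sqrt beta) *: delta_mx 0 0) - std_smooth F (invmx L *m x))))).
    by apply: cvgM; [exact: cvg_cst|exact: (cvg_comp _ _ h2 h1)].
  have EL h : invmx L *m (h *: q + x) = invmx L *m x + (h * Num.sqrt beta) *: delta_mx 0 0.
    by rewrite mulmxDr -scalemxAr iq scalerA addrC.
  by apply/funext => h; rewrite !smE EL; apply/esym/scale_inv_scale; exact: lt0r_neq0.
apply: DeriveDef; last exact: (cvg_lim _ cv).
by apply: cvgP cv.
Qed.

(** The change of coordinates multiplies L^2 norms by constants, and is onto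
    L^2, so that both bounds on [std_grad] transfer. The supremum is a real
    number, because it is at most K and at least the value 0 at the zero
    function. *)
Lemma smear_opnorm :
  (forall rho, rho \in L2 ->
          (forall x, derivable (smear rho) x q) /\ 'D_q (smear rho) \in L2) /\
  L2opnorm (fun rho => 'D_q (smear rho)) =
    (expR (- 2^-1) * (c / Num.sqrt `|\det E|) * Num.sqrt beta)%:E.
Proof.
have [L [uL b0 H]] := smear_grad.
have dE : 0 < `|\det E| by rewrite normr_gt0 -unitfE -unitmxE.
have dL : 0 < `|\det L| by rewrite normr_gt0 -unitfE -unitmxE.
have uLV : invmx L \in unitmx by rewrite unitmx_inv.
have sLV := scales_cV_affine 0 uLV; rewrite det_inv normfV invrK in sLV.
have DE rho (srho : sqint mu rho) : let F := fun w => c * rho (E *m (L *m w)) in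
    sqint mu ('D_q (smear rho)) /\
    \int[mu]_x (('D_q (smear rho) x) ^+ 2) = beta * `|\det L| * \int[mu]_x (std_grad F x ^+ 2).
  move=> F; have := H rho srho; rewrite -/F /= => -[sF _ dF]; clearbody F.
  have DF x : 'D_q (smear rho) x = Num.sqrt beta * std_grad F (invmx L *m x + 0).
    by rewrite addr0; exact: (@derive_val _ _ _ _ _ _ _ (dF x)).
  have sg := std_grad_sqint sF; have [_ ig] := sg.
  have sg' := scales_sqint (ltW dL) sLV sg.
  split.
    rewrite (_ : 'D_q _ = fun x => Num.sqrt beta * std_grad F (invmx L *m x + 0)); last exact/funext.
    exact: sqintZ.
  have [_ E1] := scales_Rintegral (f := fun x => std_grad F x ^+ 2) (ltW dL) sLV ig.
  rewrite (Rint_ext (g := fun x => beta * std_grad F (invmx L *m x + 0) ^+ 2)) => [|x].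
    have [_ ig'] := sg'.
    apply: etrans (RintegralZl beta measurableT ig') _.
    apply: etrans (congr1 ( *%R beta) E1) _; exact: mulrA.
  by apply: etrans (congr1 (fun z => z ^+ 2) (DF x)) _; rewrite exprMn sqr_sqrtr// ltW.
pose K := expR (- 2^-1) * (c / Num.sqrt `|\det E|) * Num.sqrt beta.
have K0 : 0 <= K by rewrite !mulr_ge0 ?expR_ge0 ?invr_ge0// ltW.
have K2 : K ^+ 2 = beta * `|\det L| * (expR (- 1) * (c ^+ 2 * (`|\det E|^-1 * `|\det L|^-1))).
  rewrite /K !exprMn exprVn !sqr_sqrtr ?ltW// expr2 -expRD (_ : - 2^-1 - 2^-1 = -1 :> R); last by field.
  by field; rewrite !lt0r_neq0.
have up rho : sqint mu rho -> \int[mu]_x (('D_q (smear rho) x) ^+ 2) <= K ^+ 2 * \int[mu]_x (rho x ^+ 2).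
  move=> srho; have [sF iF _] := H rho srho; rewrite (DE rho srho).2 K2 -[leRHS]mulrA ler_wpM2l ?mulr_ge0 ?(ltW b0)//.
  apply: (le_trans (std_grad_le sF)); rewrite iF; by rewrite le_eqVlt; apply/orP; left; apply/eqP; ring.
split.
  move=> rho /L2P srho; split.
    by move=> x; have [_ _ dF] := H rho srho; exact: (@ex_derive _ _ _ _ _ _ _ (dF x)).
  by apply/L2P; exact: (DE rho srho).1.
rewrite -/K; set T := L2opnorm _.
have I0 rho : 0 <= \int[mu]_x (rho x ^+ 2) by apply: Rintegral_ge0 => x _; exact: sqr_ge0.
have leK : (T <= K%:E)%E.
  apply: ge_ereal_sup => _ [rho [/L2P srho nr] <-].
  rewrite L2normE; last exact: (DE rho srho).1.
  rewrite lee_fin -(ger0_norm K0) -sqrtr_sqr ler_sqrt ?sqr_ge0//.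
  apply: (le_trans (up _ srho)); rewrite -[leRHS]mulr1 ler_wpM2l ?sqr_ge0//.
  by move: nr; rewrite L2normE// lee_fin -{1}sqrtr1 ler_sqrt.
have s00 : sqint mu (fun=> 0).
  split; first exact: measurable_cst.
  rewrite (_ : _ \o _ = cst 0%E); first exact: integrable0.
  by apply/funext => x /=; rewrite expr0n.
have ge0T : (0 <= T)%E.
  apply: (@ereal_sup_ge _ _ 0%E); exists (L2norm ('D_q (smear (fun=> 0)))); last exact: Lnorm_ge0.
  exists (fun=> 0) => //; split; first exact/L2P.
  rewrite L2normE// lee_fin.
  rewrite (_ : (fun x => _) = fun=> 0); last by apply/funext => x; rewrite expr0n.
  by rewrite Rintegral_cst// mul0r sqrtr0.
have [r Tr] : exists r, T = r%:E.
  by exists (fine T); rewrite fineK// ge0_fin_numE// (le_lt_trans leK)// ltry.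
have r0 : 0 <= r by rewrite -lee_fin -Tr.
rewrite Tr; congr (_%:E); apply/eqP; rewrite eq_le -lee_fin -Tr leK/=.
pose k1 := (c / Num.sqrt `|\det E|) * Num.sqrt beta.
have k10 : 0 < k1 by rewrite !mulr_gt0 ?invr_gt0 ?sqrtr_gt0.
have k12 : k1 ^+ 2 = beta * c ^+ 2 / `|\det E|.
  by rewrite /k1 !exprMn exprVn !sqr_sqrtr ?ltW//; ring.
rewrite /K -mulrA -/k1 -ler_pdivlMr//.
apply: (std_grad_ge (n := n)); first by rewrite divr_ge0// ltW.
move=> F sF.
have [F0|F0] := eqVneq (\int[mu]_x (F x ^+ 2)) 0.
  by rewrite F0 mulr0; apply: (le_trans (std_grad_le sF)); rewrite F0 mulr0.
have Fp : 0 < \int[mu]_x (F x ^+ 2) by rewrite lt_def F0 I0.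
(* For the lower bound, pull an arbitrary F back to a function rho0 that the
   change of coordinates sends to F. *)
pose M := invmx L *m invmx E.
have uM : M \in unitmx by rewrite unitmx_mul uLV unitmx_inv.
pose rho0 y := c^-1 * F (M *m y + 0).
have sr0 : sqint mu rho0.
  by apply: sqintZ; apply: (scales_sqint _ (scales_cV_affine 0 uM) sF); rewrite invr_ge0.
pose N := Num.sqrt (\int[mu]_x (rho0 x ^+ 2)).
pose rho y := N^-1 * rho0 y.
have srho : sqint mu rho by exact: sqintZ.
have F0E : (fun w => c * rho0 (E *m (L *m w))) = F.
  apply/funext => w; rewrite /rho0 mulVKf ?lt0r_neq0// addr0 /M -!mulmxA (mulmxA (invmx E)).
  by rewrite mulVmx// mul1mx mulmxA mulVmx// mul1mx.
have FE : (fun w => c * rho (E *m (L *m w))) = (fun w => N^-1 * F w).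
  by apply/funext => w; rewrite -F0E /rho; ring.
have i0 : \int[mu]_x (F x ^+ 2) = c ^+ 2 * (`|\det E|^-1 * `|\det L|^-1 * \int[mu]_x (rho0 x ^+ 2)).
  by have [_ <- _] := H rho0 sr0; apply: Rint_ext => x; rewrite -F0E.
have N2 : N ^+ 2 = \int[mu]_x (rho0 x ^+ 2) by rewrite sqr_sqrtr.
have Np : 0 < N.
  rewrite sqrtr_gt0 lt_def I0 andbT; apply: contraTneq Fp => z.
  by rewrite i0 z !mulr0 ltxx.
have nrho : L2norm rho = 1%:E.
  rewrite L2normE//; congr (_%:E).
  rewrite (Rint_ext (g := fun x => N^-1 ^+ 2 * rho0 x ^+ 2)) => [|x]; last by rewrite exprMn.
  rewrite RintegralZl//; last by have [] := sr0.
  by rewrite -N2 -exprMn mulVf ?expr1n ?sqrtr1// lt0r_neq0.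
have : (L2norm ('D_q (smear rho)) <= r%:E)%E.
  rewrite -Tr; apply: ereal_sup_ubound; exists rho => //; split; first exact/L2P.
  by rewrite nrho.
have [sD iD] := DE rho srho; rewrite L2normE// lee_fin iD FE std_gradZ//.
rewrite -[X in _ <= X -> _](ger0_norm r0) -(sqrtr_sqr r) ler_sqrt ?sqr_ge0//.
rewrite (Rint_ext (g := fun x => N^-1 ^+ 2 * std_grad F x ^+ 2)) => [|x]; last by rewrite exprMn.
rewrite RintegralZl//; last by have [] := std_grad_sqint sF.
rewrite exprVn N2 => h.
rewrite expr_div_n k12 i0.
rewrite -N2 in h *; move: h; set S := \int[mu]_x _ => h.
have N2p : 0 < N ^+ 2 by rewrite exprn_gt0.
have -> : r ^+ 2 / (beta * c ^+ 2 / `|\det E|) * (c ^+ 2 * (`|\det E|^-1 * `|\det L|^-1 * N ^+ 2)) =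
   r ^+ 2 * (N ^+ 2 / (beta * `|\det L|)).
  by field; rewrite !lt0r_neq0.
have -> : S = beta * `|\det L| * ((N ^+ 2)^-1 * S) * (N ^+ 2 / (beta * `|\det L|)).
  by field; rewrite !lt0r_neq0.
by rewrite ler_wpM2r// divr_ge0 ?mulr_ge0 ?sqr_ge0// ltW.
Qed.

End op.

(** The case c = exp (- t tr A), E = exp (- t A) of [smear_opnorm], in which c
    / sqrt (det E) is the square root of c by [det_expmx]. *)
Theorem grad_fokker_planck_opnorm (A : 'M[R]_n.+1) (b q : 'cV[R]_n.+1) (t : R) :
  kalman A b -> enorm q = 1 -> 0 < t ->
  (forall rho, rho \in L2 ->
          (forall x, derivable (fokker_planck A b t rho) x q) /\
          grad_fokker_planck A b t q rho \in L2) /\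
        L2opnorm (grad_fokker_planck A b t q) =
          (expR (- 2^-1) * expR (- (t * \tr A / 2))
           * Num.sqrt (dotp q (invmx (gramian A b t) *m q)))%:E.
Proof.
move=> kal q1 t0.
have q0 : q != 0.
  apply/eqP => q0; move: q1; rewrite q0 /enorm /dotp mulmx0 mxE sqrtr0 => /eqP.
  by rewrite eq_sym oner_eq0.
have dE : \det (expmx ((- t) *: A)) = expR (- (t * \tr A)) by rewrite det_expmx linearZ /= mulNr.
have uE : expmx ((- t) *: A) \in unitmx by rewrite unitmxE dE unitfE lt0r_neq0// expR_gt0.
have c0 : 0 < expR (- (t * \tr A)) by exact: expR_gt0.
have [H1 H2] := smear_opnorm (gramian_spd kal t0) uE c0 q0.
split; first exact: H1.
apply: etrans H2 _; rewrite dE ger0_norm ?(ltW c0)//.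
have -> : expR (- (t * \tr A)) = expR (- (t * \tr A / 2)) ^+ 2.
  by rewrite expr2 -expRD; congr expR; field.
have s0 : expR (- (t * \tr A / 2)) != 0 by rewrite lt0r_neq0// expR_gt0.
by rewrite sqrtr_sqr (ger0_norm (expR_ge0 _)) expr2 mulfK.
Qed.

End GradFokkerPlanck.

(** * Legendre polynomials and the limit matrix *)
Section Legendre.
Context {R : realType}.

Lemma fact_neq0 m : (m`!%:R : R) != 0.
Proof. by rewrite pnatr_eq0 -lt0n fact_gt0. Qed.

Lemma fact_gt0R m : 0 < (m`!%:R : R).
Proof. by rewrite ltr0n fact_gt0. Qed.

Lemma factSR m : (m.+1`!%:R : R) = m.+1%:R * m`!%:R.
Proof. by rewrite factS natrM. Qed.

Lemma natS_neq0 m : (m.+1%:R : R) != 0.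
Proof. by rewrite pnatr_eq0. Qed.

Ltac nz := rewrite ?natr1 ?nat1r ?fact_neq0 ?natS_neq0 ?andbT //=.

Lemma fact1n : 1`! = 1%N. Proof. by []. Qed.

(** Coefficient of s^k in the Legendre polynomial P_i(2 s - 1) of the interval
    [0, 1]. *)
Definition leg_coef (i k : nat) : R :=
  if (k <= i)%N then (-1) ^+ (i + k) * (i + k)`!%:R / (k`!%:R ^+ 2 * (i - k)`!%:R) else 0.

Lemma leg_coef_gt i k : (i < k)%N -> leg_coef i k = 0.
Proof. by rewrite /leg_coef ltnNge => /negbTE ->. Qed.

Lemma sgn_add k m : (-1 : R) ^+ (k + k + m) = (-1) ^+ m.
Proof. by rewrite exprD addnn -[X in X * _]signr_odd odd_double mul1r. Qed.

Lemma leg_coef_add k m : leg_coef (k + m) k = (-1) ^+ m * (k + k + m)`!%:R / (k`!%:R ^+ 2 * m`!%:R).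
Proof.
rewrite /leg_coef leq_addr addKn; congr (_ * _`!%:R / _); last by lia.
by rewrite addnAC sgn_add.
Qed.

Lemma leg_coef_step i k : (k <= i)%N -> leg_coef i.+1 k * (i.+1 - k)%:R = - (i.+1 + k)%:R * leg_coef i k.
Proof.
move=> ki; rewrite -(subnKC ki); set m := (i - k)%N.
rewrite -addnS addKn !leg_coef_add addnS factSR factSR exprS.
rewrite (_ : (k + m.+1 + k = (k + k + m).+1)%N); last by lia.
by field; nz.
Qed.

(** P_i(1) = 1. The differences between consecutive i telescope, with the
    certificate d. *)
Lemma leg_coef_sum1 i : \sum_(0 <= k < i.+1) leg_coef i k = 1.
Proof.
elim: i => [|i IH]; first by rewrite big_nat1 /leg_coef leqnn addn0 subnn fact0 expr0; field.
(* The hypergeometric certificate of the difference leg_coef (i+1) k -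
   leg_coef i k. *)
pose d k : R := (-1) ^+ (i + k) * (2 / i.+1%:R) * k%:R ^+ 2 * (i + k)`!%:R / (k`!%:R ^+ 2 * (i.+1 - k)`!%:R).
have tel k : (k <= i)%N -> leg_coef i.+1 k - leg_coef i k = d k.+1 - d k.
  move=> ki; pose m := (i - k)%N.
  have ei : i = (k + m)%N by rewrite subnKC.
  have L1 : leg_coef i.+1 k = - (-1) ^+ m * ((k + k + m).+1%:R * (k + k + m)`!%:R) / (k`!%:R ^+ 2 * (m.+1%:R * m`!%:R)).
    by rewrite ei -addnS leg_coef_add addnS !factSR exprS mulN1r.
  have L2 : leg_coef i k = (-1) ^+ m * (k + k + m)`!%:R / (k`!%:R ^+ 2 * m`!%:R) by rewrite ei leg_coef_add.
  have e1 : (i.+1 - k = m.+1)%N by rewrite subSn.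
  have e2 : (i + k = k + k + m)%N by rewrite ei; lia.
  rewrite L1 L2 /d subSS -/m e1 addnS e2 !factSR !(exprS (-1)) sgn_add ei.
  by field; nz; rewrite -?natrD ?nat1r ?natr1 natS_neq0.
rewrite big_nat_recr//=.
have -> : \sum_(0 <= k < i.+1) leg_coef i.+1 k = \sum_(0 <= k < i.+1) leg_coef i k + \sum_(0 <= k < i.+1) (d k.+1 - d k).
  by rewrite -big_split; apply: eq_big_nat => k /andP[_ ki]; rewrite /= -tel// addrC subrK.
rewrite IH telescope_sumr// /d.
have -> : leg_coef i.+1 i.+1 = - ((-1) ^+ (i + i.+1) * (2 / i.+1%:R) * i.+1%:R ^+ 2 * (i + i.+1)`!%:R / (i.+1`!%:R ^+ 2 * (i.+1 - i.+1)`!%:R)).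
  have := leg_coef_add i.+1 0; rewrite addn0 => ->; rewrite subnn fact0 expr0 addn0.
  rewrite (_ : (-1 : R) ^+ (i + i.+1) = -1); last first.
    by rewrite addnS exprS addnn -signr_odd odd_double mulr1.
  rewrite addSn factSR (_ : ((i + i.+1).+1%:R : R) = 2 * i.+1%:R); last first.
    by rewrite -natrM; congr (_%:R); lia.
  by field; nz.
by rewrite expr0n /= mulr0 !mul0r subr0; ring.
Qed.

(** The integral of s^(x-1) P_i(2 s - 1) over [0, 1]. *)
Definition leg_sum i (x : R) := \sum_(0 <= k < i.+1) leg_coef i k / (x + k%:R).

(** Both sides have the same poles and residues in x, and the same limit at
    infinity by [leg_coef_sum1]. The recursion says that leg_sum i x is the
    product of (x - l) / (x + l) for l = 1..i, divided by x. *)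
Lemma leg_sum_rec i (x : R) : 0 < x -> (x + i.+1%:R) * leg_sum i.+1 x = (x - i.+1%:R) * leg_sum i x.
Proof.
move=> x0; have xk k : x + k%:R != 0 by rewrite lt0r_neq0// ltr_wpDr.
transitivity (1 - \sum_(0 <= k < i.+1) (i.+1 + k)%:R * leg_coef i k / (x + k%:R)).
  rewrite -[X in _ = X - _](leg_coef_sum1 i.+1) /leg_sum big_nat_recr//= [in RHS]big_nat_recr//= mulrDr big_distrr/=.
  rewrite [RHS]addrAC; congr (_ + _); last by rewrite mulrCA divff// mulr1.
  rewrite -sumrB; apply: eq_big_nat => k /andP[_ ki].
  have := @leg_coef_step i k ki; rewrite natrB ?(ltnW ki)// => E.
  have E' : (i.+1 + k)%:R * leg_coef i k = - (leg_coef i.+1 k * (i.+1%:R - k%:R)) by rewrite E mulNr opprK.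
  by rewrite E'; field; exact: xk.
rewrite -[X in X - _](leg_coef_sum1 i) /leg_sum big_distrr/= -sumrB; apply: eq_big_nat => k /andP[_ ki].
by rewrite natrD; field; exact: xk.
Qed.

(** Orthogonality of the Legendre polynomial of degree i to lower powers: the
    product has the zero x = j + 1. *)
Lemma leg_sum_lt i j : (j < i)%N -> leg_sum i j.+1%:R = 0.
Proof.
elim: i => [//|i IH ji].
have x0 : 0 < (j.+1%:R : R) by rewrite ltr0n.
have := leg_sum_rec i x0.
have [ji'|ij] := ltnP j i.
  rewrite IH// mulr0 => /eqP; rewrite mulf_eq0 => /orP[|/eqP//].
  by rewrite -natrD pnatr_eq0.
have -> : j = i by apply/eqP; rewrite eqn_leq ij andbT -ltnS.
rewrite subrr mul0r => /eqP; rewrite mulf_eq0 => /orP[|/eqP//].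
by rewrite -natrD pnatr_eq0.
Qed.

Lemma leg_sum_ge i j : (i <= j)%N -> leg_sum i j.+1%:R = (j`!%:R ^+ 2) / ((j - i)`!%:R * (i + j).+1`!%:R).
Proof.
elim: i => [_|i IH ij].
  rewrite /leg_sum big_nat1 /leg_coef leqnn addn0 !subn0 fact0 expr0 add0n factSR addr0.
  by field; nz.
have x0 : 0 < (j.+1%:R : R) by rewrite ltr0n.
have := leg_sum_rec i x0; rewrite IH ?(ltnW ij)//.
rewrite -natrD -natrB ?(leqW ij)//.
move=> E; apply: (@mulfI _ (j.+1 + i.+1)%:R); first by rewrite pnatr_eq0.
rewrite E; have -> : (j - i)%N = (j - i.+1).+1 by lia.
rewrite (_ : (j.+1 - i.+1)%N = (j - i.+1).+1); last by lia.
rewrite (_ : (j.+1 + i.+1 = (i + j).+2)%N); last by lia.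
rewrite addSn !factSR; field; nz.
by rewrite -!natrD nat1r natS_neq0 pnatr_eq0.
Qed.

(** The matrix frakH is the Gram matrix of the functions s^k / k! in L^2(0,
    1). In this basis, leg_entry i are the coordinates of the multiple of
    P_i(2 s - 1) whose leading coordinate is 1. *)
Definition leg_entry (i k : nat) : R := i`!%:R / (i.*2)`!%:R * (leg_coef i k * k`!%:R).

Lemma leg_entry_gt i k : (i < k)%N -> leg_entry i k = 0.
Proof. by move=> ik; rewrite /leg_entry leg_coef_gt// mul0r mulr0. Qed.

Lemma leg_entry_diag i : leg_entry i i = 1.
Proof.
rewrite /leg_entry; have := leg_coef_add i 0; rewrite addn0 => ->; rewrite fact0 expr0 addnn addn0.
by field; nz.
Qed.

Lemma leg_entry_sub i : leg_entry i.+1 i = - 2^-1.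
Proof.
rewrite /leg_entry; have := leg_coef_add i 1; rewrite addn1 => ->; rewrite fact1n expr1 doubleS addnn addn1 !factSR.
rewrite (_ : ((i.*2).+2%:R : R) = 2 * i.+1%:R); last by rewrite -natrM; congr (_%:R); lia.
by field; nz.
Qed.

(** The squared norm of the i-th orthogonal polynomial normalized as in
    [leg_entry]; on indices below n it is [kappa]. *)
Definition kappan (k : nat) : R := k`!%:R ^+ 2 / ((k.*2.+1)`!%:R * (k.*2)`!%:R).

Lemma kappan_gt0 k : 0 < kappan k.
Proof. by rewrite divr_gt0 ?exprn_gt0 ?mulr_gt0 ?fact_gt0R. Qed.

Lemma kappaE n (k : 'I_n) : kappa k = kappan k.
Proof. by rewrite /kappa /kappan natrX natrM. Qed.

Lemma sum_leg_entry n i (F : nat -> R) : (i < n)%N ->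
  \sum_(k < n) leg_entry i k * F k = \sum_(0 <= k < i.+1) leg_entry i k * F k.
Proof.
move=> i_n; rewrite -(big_mkord xpredT (fun k => leg_entry i k * F k)).
rewrite (@big_cat_nat _ _ _ i.+1)//= -[RHS]addr0; congr (_ + _).
rewrite big_nat_cond big1// => k /andP[/andP[ik _] _].
by rewrite leg_entry_gt// mul0r.
Qed.

Lemma leg_entry_sum n i j : (i < n)%N -> \sum_(k < n) leg_entry i k * (k`!%:R^-1 / (j + k).+1%:R) = i`!%:R / (i.*2)`!%:R * leg_sum i j.+1%:R.
Proof.
move=> i_n; rewrite (sum_leg_entry (fun k => k`!%:R^-1 / (j + k).+1%:R))// /leg_sum big_distrr/=; apply: eq_big_nat => k _.
rewrite /leg_entry -natrD addSn; move: (natS_neq0 (j + k)); move: ((j + k).+1%:R) => u u0.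
by field; rewrite !fact_neq0 ?u0.
Qed.

Definition leg_mx n : 'M[R]_n := \matrix_(i, k) leg_entry i k.

Lemma leg_mx_frakH n (i j : 'I_n) : (leg_mx n *m frakH) i j = j`!%:R^-1 * (i`!%:R / (i.*2)`!%:R * leg_sum i j.+1%:R).
Proof.
rewrite mxE -(leg_entry_sum _ (ltn_ord i)) big_distrr/=; apply: eq_bigr => k _.
rewrite !mxE !natrM (addnC k j); field; nz.
Qed.

Lemma leg_mx_frakH_lt n (i j : 'I_n) : (j < i)%N -> (leg_mx n *m frakH) i j = 0.
Proof. by move=> ji; rewrite leg_mx_frakH leg_sum_lt// !mulr0. Qed.

Lemma kappan_leg_sum i : i`!%:R / (i.*2)`!%:R * leg_sum i i.+1%:R = i`!%:R * kappan i.
Proof.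
by rewrite leg_sum_ge// subnn fact0 addnn /kappan; field; nz.
Qed.

Lemma leg_mx_frakH_diag n (i : 'I_n) : (leg_mx n *m frakH) i i = kappan i.
Proof. by rewrite leg_mx_frakH kappan_leg_sum mulKf// fact_neq0. Qed.

Lemma frakH_sym n : (frakH : 'M[R]_n)^T = frakH.
Proof. by apply/matrixP => i j; rewrite !mxE (mulnC j`!) (addnC j). Qed.

(** Gram-Schmidt for the Gram matrix: leg_mx frakH is upper triangular by
    orthogonality, and by symmetry the product with the lower triangular
    leg_mx transposed on the right is diagonal. *)
Lemma leg_mx_diag n : leg_mx n *m frakH *m (leg_mx n)^T = diag_mx (\row_i kappan i).
Proof.
set N := _ *m _ *m _.
have NT : N^T = N by rewrite /N !trmx_mul trmxK frakH_sym mulmxA.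
have lo (i j : 'I_n) : (j <= i)%N -> N i j = if i == j then kappan i else 0.
  move=> ji; rewrite mxE.
  case: eqP => [<-|/eqP ij].
    rewrite (bigD1 i)//= leg_mx_frakH_diag !mxE leg_entry_diag mulr1 big1 ?addr0// => k ki.
    have [k_i|i_k] := ltnP k i; first by rewrite leg_mx_frakH_lt// mul0r.
    by rewrite !mxE leg_entry_gt ?mulr0// ltn_neqAle i_k andbT eq_sym.
  rewrite big1// => k _; have [k_i|i_k] := ltnP k i; first by rewrite leg_mx_frakH_lt// mul0r.
  rewrite !mxE leg_entry_gt ?mulr0//; apply: leq_trans i_k.
  by rewrite ltn_neqAle ji andbT eq_sym.
apply/matrixP => i j; rewrite [RHS]mxE [X in X *+ _]mxE.
have [ji|/ltnW ij] := leqP j i.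
  by rewrite lo//; case: eqP => [->|]; rewrite ?mulr1n ?mulr0n.
rewrite -NT mxE lo// eq_sym; case: eqP => [->|]; rewrite ?mulr1n ?mulr0n//.
Qed.

Lemma det_leg_mx n : \det (leg_mx n) = 1.
Proof.
rewrite det_lower; last by move=> i j ij; rewrite mxE leg_entry_gt.
by rewrite big1// => i _; rewrite mxE leg_entry_diag.
Qed.

Lemma leg_mx_unit n : leg_mx n \in unitmx.
Proof. by rewrite unitmxE det_leg_mx unitr1. Qed.

Lemma diag_kappan_unit n : diag_mx (\row_(i < n) kappan i) \in unitmx.
Proof.
rewrite unitmxE det_diag unitfE; apply/prodf_neq0 => i _.
by rewrite mxE lt0r_neq0// kappan_gt0.
Qed.

Lemma frakH_unit n : (frakH : 'M[R]_n) \in unitmx.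
Proof.
have := diag_kappan_unit n; rewrite -leg_mx_diag !unitmx_mul => /andP[/andP[]] //.
Qed.

Lemma frakH_inv n : invmx (frakH : 'M[R]_n) = (leg_mx n)^T *m diag_mx (\row_i (kappan i)^-1) *m leg_mx n.
Proof.
have uT := leg_mx_unit n; have uTT : (leg_mx n)^T \in unitmx by rewrite unitmx_tr.
apply: (can_inj (mulKmx (frakH_unit n))); rewrite mulmxV ?frakH_unit//.
have HE : frakH = invmx (leg_mx n) *m diag_mx (\row_i kappan i) *m invmx (leg_mx n)^T.
  by rewrite -leg_mx_diag !mulmxA mulVmx// mul1mx -mulmxA mulmxV// mulmx1.
rewrite HE !mulmxA mulmxKV// -[_ *m diag_mx _ *m diag_mx _]mulmxA mulmx_diag.
have -> : diag_mx (\row_j (((\row_i kappan i) : 'rV_n) 0 j * ((\row_i (kappan i)^-1) : 'rV_n) 0 j)) = 1%:M.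
  apply/matrixP => i j; rewrite !mxE mulfV ?lt0r_neq0 ?kappan_gt0//.
by rewrite mulmx1 mulVmx.
Qed.

(** The right-hand side, as a function of n, increases by the summand. *)
Lemma leg_telescope n k : (k < n)%N ->
  \sum_(k <= i < n) (i.*2.+1)%:R * ((i + k)`!%:R / (i - k)`!%:R) ^+ 2 =
  ((n + k)`!%:R / (n - k.+1)`!%:R) ^+ 2 / (k.*2.+1)%:R :> R.
Proof.
move=> kn; rewrite -(subnKC kn); move: (n - k.+1)%N => m {n kn}.
elim: m => [|m IH].
  rewrite addn0 big_nat1 !subnn fact0 divr1 addnn addSn addnn factSR -!natr1.
  by field; rewrite natr1 natS_neq0.
rewrite addnS big_nat_recr/=; last by lia.
rewrite IH (_ : (k.+1 + m - k = m.+1)%N); last by lia.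
rewrite (_ : (k.+1 + m - k.+1 = m)%N); last by lia.
rewrite (_ : ((k.+1 + m).+1 - k.+1 = m.+1)%N); last by lia.
rewrite [((k.+1 + m).+1 + k)%N]addSn !factSR.
set F := (_`!%:R : R).
rewrite (_ : (((k.+1 + m + k).+1)%:R : R) = 2 * k%:R + m%:R + 2); last first.
  by rewrite -!natrM -!natrD; congr (_%:R); lia.
rewrite (_ : (((k.+1 + m).*2.+1)%:R : R) = 2 * k%:R + 2 * m%:R + 3); last first.
  by rewrite -!natrM -!natrD; congr (_%:R); lia.
rewrite (_ : ((k.*2.+1)%:R : R) = 2 * k%:R + 1); last first.
  by rewrite -muln2 -natr1 natrM mulrC.
have h1 : m.+1%:R != 0 :> R by [].
have h2 : (2 * k%:R + 1 : R) != 0 by rewrite -natrM natr1 natS_neq0.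
rewrite -(natr1 m) in h1 *; field; rewrite fact_neq0 h2.
by rewrite h1.
Qed.

Lemma frakH_inv_diag n (k : 'I_n) :
  (invmx (frakH : 'M[R]_n)) k k = ((n + k)`! ^ 2)%N%:R / (k.*2.+1 * (n - k.+1)`! ^ 2 * k`! ^ 2)%N%:R.
Proof.
rewrite frakH_inv -mulmxA mxE.
transitivity (\sum_(i < n) (kappan i)^-1 * leg_entry i k ^+ 2).
  apply: eq_bigr => i _; rewrite mul_diag_mx !mxE; ring.
rewrite -(big_mkord xpredT (fun i => (kappan i)^-1 * leg_entry i k ^+ 2)).
rewrite (@big_cat_nat _ _ _ k)//=; last by rewrite ltnW.
rewrite big_nat_cond big1 ?add0r; last first.
  by move=> i /andP[/andP[_ ik] _]; rewrite leg_entry_gt// expr0n mulr0.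
transitivity ((k`!%:R ^+ 2)^-1 * \sum_(k <= i < n) (i.*2.+1)%:R * ((i + k)`!%:R / (i - k)`!%:R) ^+ 2 : R).
  rewrite big_distrr/=; apply: eq_big_nat => i /andP[ki _].
  rewrite /leg_entry /leg_coef ki /kappan factSR [in LHS]exprMn.
  have -> : ((-1) ^+ (i + k) * (i + k)`!%:R / (k`!%:R ^+ 2 * (i - k)`!%:R) * k`!%:R : R) ^+ 2 =
     ((i + k)`!%:R / (k`!%:R * (i - k)`!%:R)) ^+ 2.
    rewrite !exprMn sqrr_sign; field; nz.
  by field; nz.
rewrite leg_telescope// !natrX natrM natrM !natrX; field; nz.
Qed.

(** By symmetry it suffices to take twice the part with sg i. There the sum
    over j is a value of [leg_sum], which vanishes by orthogonality unless i
    is k - 1 or k. *)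
Lemma leg_first_order n (sg : nat -> R) (k : 'I_n) :
  \sum_(i < n) \sum_(j < n) leg_entry k i * leg_entry k j * (i`!%:R^-1 * j`!%:R^-1 *
     (sg i / i.+1%:R + sg j / j.+1%:R) / (i + j).+2%:R) =
  kappan k * (sg k - (if (k : nat) is k'.+1 then sg k' else 0)).
Proof.
pose U i j : R := leg_entry k i * (i`!%:R^-1 * (sg i / i.+1%:R)) * (leg_entry k j * (j`!%:R^-1 / (i.+1 + j).+1%:R)).
transitivity (2 * \sum_(i < n) \sum_(j < n) U i j).
  have -> : 2 * \sum_(i < n) \sum_(j < n) U i j = \sum_(i < n) \sum_(j < n) (U i j + U j i).
    rewrite mulr_natl mulr2n; under [RHS]eq_bigr do rewrite big_split; rewrite big_split/=; congr (_ + _).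
    exact: exchange_big.
  apply: eq_bigr => i _; apply: eq_bigr => j _.
  rewrite /U (addSn i) (addSn j) (addnC j); ring.
under eq_bigr do rewrite -big_distrr/= leg_entry_sum//.
rewrite (eq_bigr (fun i : 'I_n => leg_entry k i * (i`!%:R^-1 * (sg i / i.+1%:R) * (k`!%:R / (k.*2)`!%:R * leg_sum k i.+2%:R)))); last first.
  by move=> i _; rewrite -mulrA.
rewrite (sum_leg_entry (fun i => i`!%:R^-1 * (sg i / i.+1%:R) * (k`!%:R / (k.*2)`!%:R * leg_sum k i.+2%:R)))//.
have last_term : 2 * (leg_entry k k * (k`!%:R^-1 * (sg k / k.+1%:R) * (k`!%:R / (k.*2)`!%:R * leg_sum k k.+2%:R))) = kappan k * sg k.
  rewrite leg_entry_diag leg_sum_ge// subSnn fact1n /kappan addnS !factSR addnn.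
  rewrite (_ : ((k.*2.+2)%:R : R) = 2 * k.+1%:R); last by rewrite -natrM; congr (_%:R); lia.
  by field; nz.
rewrite big_nat_recr//= mulrDr last_term addrC mulrBr; congr (_ + _).
case: (nat_of_ord k) => [|k']; first by rewrite big_geq// !mulr0 oppr0.
rewrite big_nat_recr//= big_nat_cond big1 ?add0r; last first.
  by move=> i /andP[/andP[_ ik] _]; rewrite leg_sum_lt// !mulr0.
rewrite leg_entry_sub kappan_leg_sum !factSR; field; nz.
Qed.

End Legendre.

(** * The Krylov basis *)
Section Krylov.
Context {R : realType} {n : nat} (A : 'M[R]_n) (b : 'cV[R]_n).
Local Notation q := (krylov_vec A b).
Local Notation mom := (moment A b).

Lemma krylovP m (v : 'cV[R]_n) : v \in krylov A b m ->
  exists c : nat -> R, v = \sum_(j < m) c j *: (A ^+ j *m b).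
Proof.
rewrite /krylov => h; set X := [seq _ | j <- _] in h.
have sX : size X = m by rewrite size_map size_iota.
have := coord_span (X := in_tuple X) h.
exists (fun j => if insub j is Some i then coord (in_tuple X) i v else 0).
rewrite {1}H -sX; apply: eq_bigr => i _; rewrite valK /=; congr (_ *: _).
by rewrite (nth_map 0%N) ?size_iota -?sX// nth_iota// -sX.
Qed.

Lemma krylov_gen m j : (j < m)%N -> A ^+ j *m b \in krylov A b m.
Proof. by move=> jm; apply: memv_span; apply: map_f; rewrite mem_iota. Qed.

Lemma krylov_sub m m' v : (m <= m')%N -> v \in krylov A b m -> v \in krylov A b m'.
Proof.
move=> mm /krylovP[c ->]; apply: memv_suml => j _; apply: memvZ; apply: krylov_gen.
exact: leq_trans mm.
Qed.

Lemma krylov_mul m v : v \in krylov A b m -> A *m v \in krylov A b m.+1.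
Proof.
move=> /krylovP[c ->]; rewrite mulmx_sumr; apply: memv_suml => j _.
rewrite -scalemxAr mulmxA -[A *m _]/(A * _) -exprS; apply: memvZ; apply: krylov_gen.
by rewrite ltnS.
Qed.

Lemma dotp_sumr (I : Type) (r : seq I) (P : pred I) (u : 'cV[R]_n) (F : I -> 'cV[R]_n) :
  dotp u (\sum_(i <- r | P i) F i) = \sum_(i <- r | P i) dotp u (F i).
Proof. by rewrite /dotp mulmx_sumr summxE. Qed.

Hypothesis kal : kalman A b.

Let Z : 'M[R]_n := \matrix_(i, j) (A ^+ j *m b) i 0.

(** The Gram-Schmidt process as a QR factorization: with L the Cholesky factor
    of Z^T Z, the columns of Z L^-T are orthonormal, and L is triangular with
    a positive diagonal. *)
Lemma krylov_exists (k : 'I_n) : exists q, [/\ enorm q = 1, q \in krylov A b k.+1,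
    forall v, v \in krylov A b k -> dotp q v = 0 & 0 < dotp q (A ^+ k *m b)].
Proof.
have uZ : Z \in unitmx by rewrite -row_free_unit /row_free kal.
have spdZ : spd (Z^T *m Z).
  split; first by rewrite trmx_mul trmxK.
  move=> x x0; rewrite -mulmxA -dotp_mull.
  apply: dotp_gt0; apply: contraNneq x0 => h.
  by rewrite -(mulKmx uZ x) h mulmx0.
have [L [Ll Ld LL]] := cholesky spdZ.
have uL : L \in unitmx.
  by rewrite unitmxE det_lower// unitfE; apply/prodf_neq0 => i _; rewrite lt0r_neq0.
have uLT : L^T \in unitmx by rewrite unitmx_tr.
pose Q := Z *m invmx L^T.
have ZQ : Z = Q *m L^T by rewrite /Q mulmxKV.
have QQ : Q^T *m Q = 1%:M.
  rewrite /Q trmx_mul trmx_inv trmxK !mulmxA -(mulmxA (invmx L)) -LL mulmxA mulVmx// mul1mx mulmxV//.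
pose qv (k : 'I_n) : 'cV[R]_n := col k Q.
have qq i j : dotp (qv i) (qv j) = (i == j)%:R.
  have : (Q^T *m Q) i j = (i == j)%:R by rewrite QQ mxE.
  move=> <-; rewrite dotpE mxE; apply: eq_bigr => l _; by rewrite !mxE.
have ZE (j : 'I_n) : A ^+ j *m b = \sum_i L j i *: qv i.
  apply/matrixP => i l; rewrite ord1 summxE.
  have : Z i j = (Q *m L^T) i j by rewrite -ZQ.
  by rewrite mxE => ->; rewrite mxE; apply: eq_bigr => l' _; rewrite !mxE mulrC.
have qA (i j : 'I_n) : dotp (qv i) (A ^+ j *m b) = L j i.
  rewrite ZE dotp_sumr (bigD1 i)//= dotpZr qq eqxx mulr1 big1 ?addr0// => l li.
  by rewrite dotpZr qq eq_sym (negbTE li) mulr0.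
have qk m : forall k : 'I_n, (k < m)%N -> qv k \in krylov A b k.+1.
  elim: m => [//|m IH] k0 km.
  have : A ^+ k0 *m b = \sum_i L k0 i *: qv i by exact: ZE.
  rewrite (bigD1 k0)//= => E.
  have -> : qv k0 = (L k0 k0)^-1 *: (A ^+ k0 *m b - \sum_(i < n | i != k0) L k0 i *: qv i).
    by rewrite E addrK scalerA mulVf ?scale1r// lt0r_neq0.
  apply: memvZ; apply: memvB; first exact: krylov_gen.
  apply: memv_suml => i ik; have [ki|] := ltnP k0 i; first by rewrite Ll// scale0r mem0v.
  rewrite leq_eqVlt (inj_eq val_inj) (negbTE ik) /= => ik'; apply: memvZ.
  apply: (krylov_sub (m := i.+1)); first by rewrite ltnS ltnW.
  by apply: IH; apply: leq_trans ik' _; rewrite -ltnS.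
exists (qv k); split.
- by rewrite /enorm qq eqxx sqrtr1.
- exact: (qk k.+1).
- move=> v /krylovP[c ->]; rewrite dotp_sumr big1// => j _; rewrite dotpZr.
  by rewrite -[nat_of_ord j]/(nat_of_ord (widen_ord (ltnW (ltn_ord k)) j)) qA Ll ?mulr0//=.
- by rewrite qA.
Qed.

Lemma krylov_vecP (k : 'I_n) : [/\ enorm (q k) = 1, q k \in krylov A b k.+1,
    forall v, v \in krylov A b k -> dotp (q k) v = 0 & 0 < krylov_d A b k].
Proof.
exact: (xgetPex 0 (krylov_exists k)).
Qed.

Lemma krylov_orthonormal (i j : 'I_n) : dotp (q i) (q j) = (i == j)%:R.
Proof.
wlog ij : i j / (i <= j)%N.
  by move=> H; have [/H//|/ltnW/H] := leqP i j; rewrite dotpC eq_sym.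
have [E1 _ h _] := krylov_vecP j; have [_ qi _ _] := krylov_vecP i.
case: eqP => [->|/eqP ne]; first exact: enorm1_dotp.
rewrite dotpC h//; apply: krylov_sub qi.
by rewrite ltn_neqAle ij andbT (inj_eq val_inj).
Qed.

Definition krylov_mx : 'M[R]_n := \matrix_(i, k) q k i 0.

Lemma krylov_mxTK : krylov_mx^T *m krylov_mx = 1%:M.
Proof.
apply/matrixP => i j; rewrite [RHS]mxE -krylov_orthonormal dotpE mxE.
by apply: eq_bigr => l _; rewrite !mxE.
Qed.

Lemma krylov_expand v : v = \sum_j dotp (q j) v *: q j.
Proof.
have QQ : krylov_mx *m krylov_mx^T = 1%:M by apply: mulmx1C; exact: krylov_mxTK.
rewrite -[LHS]mul1mx -QQ -mulmxA; apply/matrixP => i l; rewrite ord1 mxE summxE.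
apply: eq_bigr => j _; rewrite !mxE dotpE mulrC; congr (_ * _).
by apply: eq_bigr => k _; rewrite !mxE.
Qed.

Lemma moment_lt (k : 'I_n) j : (j < k)%N -> mom (q k) j = 0.
Proof. by move=> jk; have [_ _ h _] := krylov_vecP k; apply: h; exact: krylov_gen. Qed.

Lemma moment_d (k : 'I_n) : mom (q k) k = krylov_d A b k.
Proof. by []. Qed.

Lemma krylov_d_gt0 (k : 'I_n) : 0 < krylov_d A b k.
Proof. by have [] := krylov_vecP k. Qed.

(** Trace of the compression of A to the span of the first k + 1 basis
    vectors. *)
Definition krylov_trace (k : nat) : R := \sum_(j < n | (j <= k)%N) krylov_a A b j.

Lemma krylov_trace_step (k : 'I_n) :
  krylov_trace k - (if (k : nat) is k'.+1 then krylov_trace k' else 0) = krylov_a A b k.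
Proof.
rewrite /krylov_trace (bigD1 k)//= [X in _ + X - _](_ : _ = if (k : nat) is k'.+1 then krylov_trace k' else 0).
  by rewrite addrK.
case E: (nat_of_ord k) => [|k'].
  rewrite big1// => i /andP[]; rewrite leqn0 => /eqP i0 /eqP[]; apply/val_inj; by rewrite /= E.
apply: eq_bigl => i; rewrite -(inj_eq val_inj) /= E; lia.
Qed.

(** In the Krylov basis A is an upper Hessenberg matrix: q (k+1) is orthogonal
    to A q i for i < k. Hence d (k+1) = d k * <q (k+1), A q k>, and applying A
    to the expansion of A^(k+1) b adds the diagonal entry a (k+1) to the
    partial trace. *)
Lemma moment_next (k : 'I_n) : mom (q k) k.+1 = krylov_d A b k * krylov_trace k.
Proof.
case: k => k; elim: k => [|k IH] kn.
  set k0 := Ordinal kn.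
  rewrite /moment exprS -mulmxA [_ *m _ in LHS](_ : _ = A *m (A ^+ 0 *m b))// [A ^+ 0 *m b]krylov_expand.
  rewrite mulmx_sumr dotp_sumr (bigD1 k0)//= big1 ?addr0; last first.
    move=> i i0; rewrite -scalemxAr dotpZr -[dotp (q i) _]/(mom (q i) 0) moment_lt ?mul0r//.
    by rewrite lt0n; apply: contraNneq i0 => i0; apply/eqP/val_inj.
  rewrite -scalemxAr dotpZr; congr (_ * _).
  rewrite /krylov_trace (bigD1 k0)//= big1 ?addr0// => i /andP[]; rewrite leqn0 => /eqP i0 /eqP[].
  exact/val_inj.
set k1 := Ordinal kn; pose k0 := Ordinal (ltnW kn).
have {}IH := IH (ltnW kn); rewrite -/k0 in IH.
have kk : k0 != k1 by rewrite -(inj_eq val_inj) /= neq_ltn ltnSn.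
have q_krylov (v : 'cV[R]_n) : v \in krylov A b k -> dotp (q k1) (A *m v) = 0.
  by move=> hv; have [_ _ h _] := krylov_vecP k1; apply: h; exact: krylov_mul.
have lowq (i : 'I_n) : (i < k)%N -> dotp (q k1) (A *m q i) = 0.
  by move=> ik; apply: q_krylov; have [_ hi _ _] := krylov_vecP i; exact: krylov_sub hi.
have up (m : nat) (i : 'I_n) : (m < i)%N -> dotp (q i) (A ^+ m *m b) = 0 by exact: moment_lt.
have sub : krylov_d A b k1 = krylov_d A b k0 * dotp (q k1) (A *m q k0).
  rewrite {1}/krylov_d exprS -[A * _]/(A *m _) -mulmxA [A ^+ k *m b]krylov_expand.
  rewrite mulmx_sumr dotp_sumr (bigD1 k0)//= -scalemxAr dotpZr big1 ?addr0// => i i0.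
  rewrite -scalemxAr dotpZr; have [ik|ki] := ltnP i k; first by rewrite lowq// mulr0.
  by rewrite up ?mul0r// ltn_neqAle ki andbT; apply: contraNneq i0 => e; apply/eqP/val_inj.
rewrite /moment exprS -[A * _]/(A *m _) -mulmxA [A ^+ k1 *m b]krylov_expand.
rewrite mulmx_sumr dotp_sumr (bigD1 k1)//= (bigD1 k0)//= big1 ?addr0; last first.
  move=> i /andP[i1 i0]; rewrite -scalemxAr dotpZr.
  have [ik|ki] := ltnP i k; first by rewrite lowq// mulr0.
  rewrite up ?mul0r//= ltn_neqAle; apply/andP; split.
    by apply: contraNneq i1 => e; apply/eqP/val_inj.
  by rewrite ltn_neqAle ki andbT; apply: contraNneq i0 => e; apply/eqP/val_inj.
rewrite -!scalemxAr !dotpZr -[dotp (q k0) _]/(mom (q k0) k0.+1) IH.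
have := krylov_trace_step k1; rewrite /= => /(canRL (subrK _)) ->.
rewrite sub; rewrite -/(krylov_a A b k1) -sub /= -[dotp (q k1) (A ^+ _ *m b)]/(krylov_d A b k1).
rewrite mulrDr; congr (_ + _); rewrite sub; ring.
Qed.

(** The Gramian in the Krylov basis. *)
Definition krylov_gram (i j : 'I_n) t : R := dotp (q i) (gramian A b t *m q j).

Lemma krylov_flow (i : 'I_n) : exists C, forall s : measurableTypeR R, 0 <= s <= 1 ->
  `|flow A b (q i) s - (krylov_d A b i / i`!%:R) * s ^+ i * (1 + (krylov_trace i / i.+1%:R) * s)| <= C * s ^+ i.+2.
Proof.
have [C h] := flow_trunc A b (q i) i.+2 1; exists C => s s01.
have := h s s01; rewrite !big_nat_recr//= big_nat_cond big1 ?add0r; last first.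
  by move=> j /andP[/andP[_ ji] _]; rewrite moment_lt// mul0r mulr0.
rewrite moment_next moment_d factS natrM => H; apply: le_trans H.
rewrite le_eqVlt; apply/orP; left; apply/eqP; congr (`|_ - _|).
rewrite exprS; field; rewrite !pnatr_eq0 -lt0n fact_gt0 //=.
Qed.

(** The i-th flow starts at order i with leading coefficient d i / i!, and its
    relative first-order correction is given by the partial trace. So the
    Gramian is graded, with limit frakH after rescaling. *)
Lemma krylov_gram_expand (i j : 'I_n) : isO (i + j).+3 (fun t => krylov_gram i j t -
  krylov_d A b i * krylov_d A b j * t ^+ (i + j).+1 *
   (frakH i j + t * (i`!%:R^-1 * j`!%:R^-1 * (krylov_trace i / i.+1%:R + krylov_trace j / j.+1%:R) / (i + j).+2%:R))).
Proof.
have [C hC] := krylov_flow i; have [D hD] := krylov_flow j.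
apply: (isO_eq (gram_expand hC hD)) => t; rewrite /krylov_gram mxE; congr (_ - _).
rewrite !natrM !exprS.
have n0 (m : nat) : (m.+1%:R : R) != 0 by rewrite pnatr_eq0.
have f0 (m : nat) : (m`!%:R : R) != 0 by rewrite pnatr_eq0 -lt0n fact_gt0.
move: (n0 (i + j)%N) (n0 (i + j).+1) (f0 i) (f0 j).
move: ((i + j).+1%:R : R) ((i + j).+2%:R : R) (i`!%:R : R) (j`!%:R : R) => u v w z u0 v0 w0 z0.
move: (krylov_trace i / _) (krylov_trace j / _) => x y.
by field; rewrite u0 v0 w0 z0.
Qed.

End Krylov.

(** * Eigenvalues of a graded symmetric matrix *)
Section IsOmore.
Context {R : realType}.
Implicit Types f : R -> R.

Lemma isO_divX m p f : isO (m + p) f -> isO p (fun t => f t / t ^+ m).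
Proof.
move=> [C hC]; exists C; apply: filterS2 hC near0_pos => t h t0.
have tm : 0 < t ^+ m by rewrite exprn_gt0.
rewrite normrM normfV (gtr0_norm tm) ler_pdivrMr// (le_trans h)// exprD.
by rewrite mulrCA mulrC.
Qed.

(** The counterpart of [isO], needed to divide by the irrelevant factors of a
    determinant. *)
Definition bounded_away f := exists2 c : R, 0 < c & \forall t \near (0:R)^'+, c <= `|f t|.

Lemma bounded_away_prod (I : Type) (r : seq I) (Q : pred I) (F : I -> R -> R) :
  (forall i, Q i -> bounded_away (F i)) -> bounded_away (fun t => \prod_(i <- r | Q i) F i t).
Proof.
move=> h; elim: r => [|i r [c c0 hc]].
  by exists 1 => //; apply: nearW => t; rewrite big_nil normr1.
case Qi: (Q i); last by exists c => //; apply: filterS hc => t; rewrite big_cons Qi.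
have [e e0 he] := h i Qi; exists (e * c); first exact: mulr_gt0.
apply: filterS2 hc he => t h1 h2; rewrite big_cons Qi normrM.
by apply: ler_pM => //; exact: ltW.
Qed.

Lemma bounded_away_isO m f g : bounded_away g -> isO m.+1 (fun t => f t - g t) -> bounded_away f.
Proof.
move=> [c c0 hc] h; exists (c / 2); first exact: divr_gt0.
have c2 : 0 < c / 2 by exact: divr_gt0.
apply: filterS2 hc (isO_small h c2) => t h1 h2.
have := ler_normD (f t) (g t - f t); rewrite addrC subrK distrC => h3; lra.
Qed.

Lemma bounded_away_neq0 f : bounded_away f -> \forall t \near (0:R)^'+, f t != 0.
Proof. by move=> [c c0]; apply: filterS => t h; rewrite -normr_gt0 (lt_le_trans c0). Qed.

Lemma bounded_away_cst (c : R) : c != 0 -> bounded_away (fun=> c).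
Proof. by move=> c0; exists `|c|; [rewrite normr_gt0|apply: nearW]. Qed.

Lemma isO_div_bounded_away m f g : bounded_away g -> isO m (fun t => f t * g t) -> isO m f.
Proof.
move=> [c c0 hc] [C hC]; exists (C / c); apply: filterS3 hc hC near0_pos => t h1 h2 t0.
rewrite mulrAC ler_pdivlMr//; apply: le_trans h2; rewrite normrM.
by rewrite ler_wpM2l.
Qed.

(** By [det_diag_isO] the determinant is the product of the diagonal up to
    O(t^2). *)
Lemma det_bounded_away n (M : R -> 'M[R]_n) :
  (forall i, isO 0 (fun t => M t i i)) -> (forall i, bounded_away (fun t => M t i i)) ->
  (forall i j, i != j -> isO 1 (fun t => M t i j)) -> bounded_away (fun t => \det (M t)).
Proof. by move=> hd hl ho; exact: (bounded_away_isO (bounded_away_prod (index_enum _) (fun i _ => hl i)) (det_diag_isO hd ho)). Qed.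

Lemma isO_pos m f (c : R) : 0 < c -> isO m.+1 (fun t => f t - c) -> \forall t \near (0:R)^'+, 0 < f t.
Proof.
move=> c0 h; apply: filterS (isO_small h c0) => t.
by rewrite ltr_norml => /andP[h1 _]; lra.
Qed.

Lemma isO_exp m p (hp : (p <= m)%N) : isO p (fun t : R => t ^+ m).
Proof. exact: isO_le hp (isOX m). Qed.

End IsOmore.

Section Spectral.
Context {R : realType} {n : nat} (d : 'I_n -> R) (sg : nat -> R) (gram_mx : R -> 'M[R]_n).
Hypothesis d0 : forall i, 0 < d i.
Let X1 (i j : 'I_n) : R := i`!%:R^-1 * j`!%:R^-1 * (sg i / i.+1%:R + sg j / j.+1%:R) / (i + j).+2%:R.
Hypothesis gram_mx_expand : forall i j : 'I_n, isO (i + j).+3 (fun t => gram_mx t i j -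
  d i * d j * t ^+ (i + j).+1 * (frakH i j + t * X1 i j)).

(** For the Gramian this is the diagonal entry a k of A in the Krylov basis,
    see [first_coefE]. *)
Definition first_coef (k : nat) : R := sg k - (if k is k'.+1 then sg k' else 0).

(** Removes the grading: conjugation by the diagonal matrix of the d i t^i,
    and division by t. *)
Definition rescaled t : 'M[R]_n := \matrix_(i, j) (gram_mx t i j / (d i * d j * t ^+ (i + j).+1)).

Lemma rescaled_expand i j : isO 2 (fun t => rescaled t i j - (frakH i j + t * X1 i j)).
Proof.
have h : isO ((i + j).+1 + 2) (fun t => gram_mx t i j - d i * d j * t ^+ (i + j).+1 * (frakH i j + t * X1 i j)).
  by rewrite addn2.
have h2 := isOZ (d i * d j)^-1 (isO_divX h).
apply: (isO_near h2); apply: filterS near0_pos => t t0; rewrite !mxE.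
have tm : t ^+ (i + j).+1 != 0 by rewrite lt0r_neq0// exprn_gt0.
move: tm (lt0r_neq0 (d0 i)) (lt0r_neq0 (d0 j)); move: (t ^+ _) (gram_mx t i j) (d i) (d j) (X1 i j) => u g x y z u0 x0 y0.
move: ((_%:R)^-1) => w.
by field; rewrite u0 x0 y0.
Qed.

(** Legendre polynomials diagonalize the limit of [rescaled]. *)
Definition normalized t : 'M[R]_n := leg_mx n *m rescaled t *m (leg_mx n)^T.

Lemma normalizedE t i j : normalized t i j = \sum_(l < n) \sum_(m < n) leg_entry i l * leg_entry j m * rescaled t l m.
Proof.
rewrite mxE exchange_big/=; apply: eq_bigr => m _; rewrite mxE big_distrl/=.
by apply: eq_bigr => l _; rewrite [(leg_mx n)^T _ _]mxE [leg_mx n j m]mxE [leg_mx n i l]mxE mulrAC.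
Qed.

Lemma normalized_expand i j :
  isO 2 (fun t => normalized t i j - ((i == j)%:R * kappan i + t * \sum_(l < n) \sum_(m < n) leg_entry i l * leg_entry j m * X1 l m)).
Proof.
have h : isO 2 (fun t => \sum_(l < n) \sum_(m < n) leg_entry i l * leg_entry j m * (rescaled t l m - (frakH l m + t * X1 l m))).
  by apply: isO_sum => l _; apply: isO_sum => m _; apply: isOZ; exact: rescaled_expand.
apply: (isO_eq h) => t; rewrite normalizedE.
have E : (i == j)%:R * kappan i = \sum_(l < n) \sum_(m < n) leg_entry i l * leg_entry j m * (frakH l m : R).
  have : (leg_mx n *m frakH *m (leg_mx n)^T) i j = (diag_mx (\row_i kappan i)) i j := congr1 (fun N : 'M[R]_n => N i j) (@leg_mx_diag R n).
  rewrite [RHS]mxE [X in _ = X *+ _]mxE mulr_natl => <-.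
  rewrite mxE exchange_big/=; apply: eq_bigr => m _; rewrite mxE big_distrl/=.
  by apply: eq_bigr => l _; rewrite [(leg_mx n)^T _ _]mxE [leg_mx n j m]mxE [leg_mx n i l]mxE mulrAC.
rewrite E big_distrr/= -big_split -sumrB; apply: eq_bigr => l _.
rewrite big_distrr/= -big_split -sumrB; apply: eq_bigr => m _ /=; ring.
Qed.

Lemma normalized_diag k : isO 2 (fun t => normalized t k k - kappan k * (1 + first_coef k * t)).
Proof.
apply: (isO_eq (normalized_expand k k)) => t.
rewrite eqxx mul1r (leg_first_order sg k) -/(first_coef k); ring.
Qed.

Lemma normalized_off i j : i != j -> isO 1 (fun t => normalized t i j).
Proof.
move=> ij; have h := isOD (isO_le (leqnSn 1) (normalized_expand i j)) (isOZ (\sum_(l < n) \sum_(m < n) leg_entry i l * leg_entry j m * X1 l m) (isOX 1)).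
apply: (isO_eq h) => t; rewrite (negbTE ij) mul0r add0r expr1 mulrC.
by rewrite mulrC subrK.
Qed.

Lemma normalized_diag1 k : isO 1 (fun t => normalized t k k - kappan k).
Proof.
apply: (isO_eq (isOD (isO_le (leqnSn 1) (normalized_diag k)) (isOZ (kappan k * first_coef k) (isOX 1)))) => t.
by rewrite expr1; ring.
Qed.

Lemma normalized_bounded i j : isO 0 (fun t => normalized t i j).
Proof.
have [->|ij] := eqVneq i j; last exact: isO_le (normalized_off ij).
exact: (isO_bounded (normalized_diag1 j)).
Qed.

Section secular.
Variable k : 'I_n.

(** The power of t in the l-th summand of [secular]. The truncation of the
    subtraction only matters for l > i or l > j, where the Legendre
    coefficient vanishes. *)
Definition gap (i j l : nat) : nat := (maxn i k + maxn j k - l.*2)%N.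

(** The matrix of which mu is a zero of the determinant exactly when mu
    t^(2k+1) is an eigenvalue, see [secular_conj], but scaled in such a way
    that as t -> 0 it tends to a diagonal matrix: the eigenvalues before the
    k-th one contribute - kappa i, the later ones mu / d i^2, and the k-th one
    mu / d k^2 - kappa k, which is the only factor that can vanish. *)
Definition secular (mu t : R) : 'M[R]_n := \matrix_(i, j)
  (mu * (\sum_(l < n) leg_entry i l * leg_entry j l / d l ^+ 2 * t ^+ gap i j l)
   - t ^+ ((maxn i k - k) + (maxn j k - k)) * normalized t i j).

(** Undoes the grading in the columns, passes to Legendre polynomials in the
    rows, and damps the rows after the k-th to the size at which the k-th
    eigenvalue is seen. *)
Definition scaling t : 'M[R]_n := \matrix_(i, l) (t ^+ (maxn i k - k) * leg_entry i l / (d l * t ^+ l)).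

Lemma secular_conj mu t : 0 < t ->
  secular mu t = t^-1 *: (scaling t *m ((mu * t ^+ (k.*2).+1)%:M - gram_mx t) *m (scaling t)^T).
Proof.
move=> t0; have tn m : t ^+ m != 0 by rewrite lt0r_neq0// exprn_gt0.
have t1 : t != 0 by rewrite lt0r_neq0.
apply/matrixP => i j; rewrite mulmxBr mulmxBl scalerBr [in RHS]mxE [in LHS]mxE [X in _ = _ + X]mxE.
congr (_ - _).
  rewrite mul_mx_scalar -scalemxAl scalerA mxE [X in _ = _ * X]mxE mulrA [t^-1 * mu]mulrC.
  rewrite -!mulrA; congr (_ * _); rewrite !big_distrr/=; apply: eq_bigr => l _.
  have [il|li] := ltnP i l; first by rewrite !mxE leg_entry_gt// !(mul0r, mulr0).
  have [jl|lj] := ltnP j l; first by rewrite !mxE [leg_entry j l]leg_entry_gt// !(mul0r, mulr0).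
  rewrite !mxE.
  have -> : t ^+ gap i j l = t ^+ (maxn i k - k) * t ^+ (maxn j k - k) * t ^+ (k.*2) / (t ^+ l * t ^+ l).
    apply: (@mulIf _ (t ^+ l * t ^+ l)); first by rewrite mulf_neq0.
    rewrite mulfVK ?mulf_neq0// -!exprD; congr (_ ^+ _); rewrite /gap.
    by move: (leq_maxl i k) (leq_maxl j k) (leq_maxr i k) (leq_maxr j k); lia.
  rewrite (exprS t); move: (tn l) t1 (lt0r_neq0 (d0 l)); move: (t ^+ l) (t ^+ (maxn i k - k)) (t ^+ (maxn j k - k)) (t ^+ k.*2) (d l) => u v w z x u0 t1' x0.
  by field; rewrite u0 x0 t1'.
rewrite normalizedE [RHS]mxE [X in _ = _ * X]mxE exchange_big !big_distrr/=; apply: eq_bigr => m _.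
rewrite [X in _ = _ * (X * _)]mxE !big_distrl !big_distrr/=; apply: eq_bigr => l _.
rewrite [rescaled t l m]mxE [(scaling t)^T m j]mxE [scaling t i l]mxE [scaling t j m]mxE.
rewrite exprD exprS exprD; move: (tn l) (tn m) t1 (lt0r_neq0 (d0 l)) (lt0r_neq0 (d0 m)).
move: (t ^+ l) (t ^+ m) (t ^+ (maxn i k - k)) (t ^+ (maxn j k - k)) (d l) (d m) (gram_mx t l m) (leg_entry i l) (leg_entry j m) => x y z w p q r u v x0 y0 t1' p0 q0.
by field; rewrite x0 y0 p0 q0 t1'.
Qed.

Lemma scaling_det t : 0 < t -> 0 < \det (scaling t).
Proof.
move=> t0; rewrite det_lower; last by move=> i j ij; rewrite mxE leg_entry_gt// mulr0 mul0r.
apply: prodr_gt0 => i _; rewrite mxE leg_entry_diag mulr1 divr_gt0 ?mulr_gt0 ?exprn_gt0//.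
Qed.

Lemma secular_det mu t : 0 < t ->
  exists2 c, 0 < c & \det (secular mu t) = c * \det ((mu * t ^+ (k.*2).+1)%:M - gram_mx t).
Proof.
move=> t0; exists (t^-1 ^+ n * \det (scaling t) ^+ 2).
  by rewrite mulr_gt0 ?exprn_gt0 ?invr_gt0 ?scaling_det.
rewrite secular_conj// detZ !det_mulmx det_tr; ring.
Qed.

Lemma gap_off (i j : 'I_n) (l : nat) : i != j -> (l <= i)%N -> (l <= j)%N -> (0 < gap i j l)%N.
Proof.
move=> ij li lj; have {}ij : nat_of_ord i != nat_of_ord j := ij.
by rewrite /gap; move: (leq_maxl i k) (leq_maxl j k); lia.
Qed.

Lemma secular_sum_bounded (i j : 'I_n) : isO 0 (fun t => \sum_(l < n) leg_entry i l * leg_entry j l / d l ^+ 2 * t ^+ gap i j l).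
Proof. by apply: isO_sum => l _; apply: isOZ; exact: isO_exp. Qed.

Lemma secular_off (mu : R -> R) (i j : 'I_n) : isO 0 mu -> i != j -> isO 1 (fun t => secular (mu t) t i j).
Proof.
move=> hmu ij.
have h1 : isO 1 (fun t => \sum_(l < n) leg_entry i l * leg_entry j l / d l ^+ 2 * t ^+ gap i j l).
  apply: isO_sum => l _.
  have [il|li] := ltnP i l; first by apply: (isO_eq (isO_0 1)) => t; rewrite leg_entry_gt// !mul0r.
  have [jl|lj] := ltnP j l; first by apply: (isO_eq (isO_0 1)) => t; rewrite [leg_entry j l]leg_entry_gt// mulr0 !mul0r.
  by apply: isOZ; apply: isO_exp; exact: gap_off.
have h2 := isOM (@isO_exp R ((maxn i k - k) + (maxn j k - k)) 0 (leq0n _)) (normalized_off ij).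
by apply: (isO_eq (isOB (isOM hmu h1) h2)) => t; rewrite [RHS]mxE.
Qed.

Lemma secular_sum (i : 'I_n) : isO 2 (fun t => \sum_(l < n) leg_entry i l * leg_entry i l / d l ^+ 2 * t ^+ gap i i l
   - (k <= i)%N%:R / d i ^+ 2).
Proof.
have hl : forall l : 'I_n, l != i -> isO 2 (fun t => leg_entry i l * leg_entry i l / d l ^+ 2 * t ^+ gap i i l).
  move=> l li; have [il|] := ltnP i l; first by apply: (isO_eq (isO_0 2)) => t; rewrite leg_entry_gt// !mul0r.
  rewrite leq_eqVlt (inj_eq val_inj) (negbTE li) /= => l_i.
  by apply: isOZ; apply: isO_exp; rewrite /gap; move: (leq_maxl i k); lia.
have hi : isO 2 (fun t : R => (d i ^+ 2)^-1 * t ^+ gap i i i - (k <= i)%N%:R / d i ^+ 2).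
  have [ki|ik] := leqP k i.
    apply: (isO_eq (isO_0 2)) => t; rewrite /gap (maxn_idPl ki) addnn subnn expr0 mulr1 mul1r.
    by rewrite subrr.
  apply: (isO_eq (isOZ (d i ^+ 2)^-1 (@isO_exp R (gap i i i) 2 _))) => [|t].
    by rewrite /gap (maxn_idPr (ltnW ik)); lia.
  by rewrite mul0r subr0.
apply: (isO_eq (isOD hi (isO_sum (index_enum _) hl))) => t.
by rewrite [in RHS](bigD1 i)//= leg_entry_diag !mul1r addrAC.
Qed.

Lemma secular_diag (mu : R -> R) (i : 'I_n) : isO 0 mu -> (i < k)%N -> isO 1 (fun t => secular (mu t) t i i + kappan i).
Proof.
move=> hmu ik; have h := isOB (isOM hmu (isO_le (leqnSn 1) (secular_sum i))) (normalized_diag1 i).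
apply: (isO_eq h) => t; rewrite [secular _ _ _ _]mxE leqNgt ik /= mul0r subr0.
by rewrite (maxn_idPr (ltnW ik)) subnn expr0 mul1r opprB addrA addrAC.
Qed.

Lemma secular_diag_gt (mu : R -> R) (i : 'I_n) : isO 0 mu -> (k < i)%N ->
  isO 1 (fun t => secular (mu t) t i i - mu t / d i ^+ 2).
Proof.
move=> hmu ki.
have h2 := isOM (@isO_exp R ((maxn i k - k) + (maxn i k - k)) 1 _) (normalized_bounded i i).
have h := isOB (isOM hmu (isO_le (leqnSn 1) (secular_sum i))) (h2 _).
apply: (isO_eq (h _)) => [|t]; first by rewrite (maxn_idPl (ltnW ki)); lia.
rewrite [secular _ _ _ _]mxE (ltnW ki) /=; ring.
Qed.

Lemma secular_diag_eq (mu : R -> R) : isO 0 mu ->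
  isO 2 (fun t => secular (mu t) t k k - (mu t / d k ^+ 2 - kappan k * (1 + first_coef k * t))).
Proof.
move=> hmu; have h := isOB (isOM hmu (secular_sum k)) (normalized_diag k).
apply: (isO_eq h) => t; rewrite [secular _ _ _ _]mxE leqnn maxnn subnn addn0 expr0 /=; ring.
Qed.

Lemma secular_diag_bounded (mu : R -> R) (i : 'I_n) : isO 0 mu -> isO 0 (fun t => secular (mu t) t i i).
Proof.
move=> hmu.
have h2 := isOM (@isO_exp R ((maxn i k - k) + (maxn i k - k)) 0 (leq0n _)) (normalized_bounded i i).
by apply: (isO_eq (isOB (isOM hmu (secular_sum_bounded i i)) h2)) => t; rewrite [RHS]mxE.
Qed.

Lemma bounded_away_mu (mu : R -> R) (c0 c : R) : 0 < c0 -> 0 < c -> (\forall t \near (0:R)^'+, c0 <= mu t) ->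
  bounded_away (fun t => mu t / c ^+ 2).
Proof.
move=> h0 hc h; exists (c0 / c ^+ 2); first by rewrite divr_gt0 ?exprn_gt0.
apply: filterS h => t ht; rewrite normrM normfV (gtr0_norm (exprn_gt0 2 hc)).
by rewrite ler_wpM2r ?invr_ge0 ?exprn_ge0 ?(ltW hc)// ger0_norm// (le_trans (ltW h0)).
Qed.

Lemma secular_bounded_away (mu : R -> R) (c0 : R) (i : 'I_n) : isO 0 mu -> 0 < c0 ->
  (\forall t \near (0:R)^'+, c0 <= mu t) -> i != k -> bounded_away (fun t => secular (mu t) t i i).
Proof.
move=> hmu c00 hc ik; have [ik'|] := ltnP i k.
  apply: (@bounded_away_isO _ 0 _ (fun=> - kappan i)); first by apply: bounded_away_cst; rewrite oppr_eq0 lt0r_neq0// kappan_gt0.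
  by apply: (isO_eq (secular_diag hmu ik')) => t; rewrite opprK.
rewrite leq_eqVlt (inj_eq val_inj) eq_sym (negbTE ik) /= => ki.
by apply: bounded_away_isO (secular_diag_gt hmu ki); exact: bounded_away_mu hc.
Qed.

(** The determinant is the product of the diagonal entries up to O(t^2), and
    all of them but the k-th one stay away from 0. So the k-th one is O(t^2),
    which is an equation for mu. *)
Lemma secular_root (mu : R -> R) (c0 : R) : isO 0 mu -> 0 < c0 ->
  (\forall t \near (0:R)^'+, c0 <= mu t) ->
  (\forall t \near (0:R)^'+, \det (secular (mu t) t) = 0) ->
  isO 2 (fun t => mu t - kappan k * d k ^+ 2 * (1 + first_coef k * t)).
Proof.
move=> hmu c00 hc hdet.
have h1 := det_diag_isO (fun i => secular_diag_bounded i hmu) (fun i j => secular_off hmu (i := i) (j := j)).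
have h2 : isO 2 (fun t => secular (mu t) t k k * \prod_(i | i != k) secular (mu t) t i i).
  apply: (isO_near (isON h1)); apply: filterS hdet => t ->.
  by rewrite sub0r opprK (bigD1 k).
have h3 := isO_div_bounded_away (bounded_away_prod (index_enum _) (fun i ik => secular_bounded_away hmu c00 hc ik)) h2.
have h4 := isOZ (d k ^+ 2) (isOB h3 (secular_diag_eq hmu)).
apply: (isO_eq h4) => t; move: (lt0r_neq0 (d0 k)) (secular _ _ _ _) => dk s.
by field.
Qed.

(** Suppose x is an eigenvector with x k = 0. In the coordinates w given by
    [scaling] it solves secular w = 0, whose k-th equation degenerates in the
    limit. Replacing this equation by the suitably scaled x k = 0 gives a
    matrix with nearly diagonal and invertible limit, hence w = 0. *)
Lemma secular_component (mu : R -> R) (c0 : R) : isO 0 mu -> 0 < c0 ->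
  (\forall t \near (0:R)^'+, c0 <= mu t) ->
  \forall t \near (0:R)^'+, forall x : 'cV[R]_n,
    gram_mx t *m x = (mu t * t ^+ (k.*2).+1) *: x -> x k 0 = 0 -> x = 0.
Proof.
move=> hmu c00 hc.
(* Row k is the linear form w |-> d k t^k x k, where x is the image of w under
   the transposed scaling. *)
pose M t : 'M[R]_n := \matrix_(i, j) if i == k then (if (k <= j)%N then leg_entry j k * t ^+ (j - k) else 0)
   else secular (mu t) t i j.
have lowM : bounded_away (fun t => \det (M t)).
  apply: det_bounded_away => [i|i|i j ij].
  - have [->|ik] := eqVneq i k.
      by apply: (isO_eq (isO_cst 1)) => t; rewrite mxE eqxx leqnn leg_entry_diag subnn expr0 mulr1.
    by apply: (isO_eq (secular_diag_bounded i hmu)) => t; rewrite [RHS]mxE (negbTE ik).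
  - have [->|ik] := eqVneq i k.
      exists 1 => //; apply: nearW => t; rewrite mxE eqxx leqnn leg_entry_diag subnn expr0 mulr1 normr1 //.
    have [c c0' hc'] := secular_bounded_away hmu c00 hc ik; exists c => //.
    by apply: filterS hc' => t; rewrite [M _ _ _]mxE (negbTE ik).
  - have [ik|ik] := eqVneq i k; last first.
      by apply: (isO_eq (secular_off hmu ij)) => t; rewrite [RHS]mxE (negbTE ik).
    rewrite {i}ik in ij *.
    have [kj|jk] := leqP k j; last first.
      by apply: (isO_eq (isO_0 1)) => t; rewrite mxE eqxx leqNgt jk.
    apply: (isO_eq (isOZ (leg_entry j k) (@isO_exp R (j - k) 1 _))) => [|t].
      by rewrite subn_gt0 ltn_neqAle kj andbT.
    by rewrite mxE eqxx kj.
apply: filterS2 (bounded_away_neq0 lowM) near0_pos => t hM t0 x hx xk.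
have t1 : t != 0 by rewrite lt0r_neq0.
have uP : (scaling t)^T \in unitmx by rewrite unitmx_tr unitmxE unitfE lt0r_neq0// scaling_det.
pose w := invmx (scaling t)^T *m x.
have xw : x = (scaling t)^T *m w by rewrite mulKVmx.
suff w0 : w = 0 by rewrite xw w0 mulmx0.
have uM : M t \in unitmx by rewrite unitmxE unitfE.
rewrite -(mulKmx uM w); apply/(canLR (mulKmx uM)); rewrite mulmx0.
have Bw : secular (mu t) t *m w = 0.
  rewrite secular_conj// -scalemxAl -mulmxA -xw -mulmxA mulmxBl mul_scalar_mx hx subrr mulmx0 scaler0 //.
apply/matrixP => i j; rewrite ord1 [RHS]mxE; have [->|ik] := eqVneq i k; last first.
  have := congr1 (fun N : 'cV[R]_n => N i 0) Bw; rewrite !mxE => h; rewrite -[RHS]h.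
  by apply: eq_bigr => l _; rewrite mxE (negbTE ik) [secular _ _ _ _]mxE.
have := xk; rewrite xw mxE => h.
have tk : d k * t ^+ k != 0 by rewrite mulf_neq0 ?expf_neq0// lt0r_neq0.
apply: (mulfI (invr_neq0 tk)); rewrite mulr0 -h mxE big_distrr/=; apply: eq_bigr => l _.
rewrite [M _ _ _]mxE eqxx [(scaling t)^T _ _]mxE [scaling t _ _]mxE.
have [kl|lk] := leqP k l; last by rewrite [leg_entry _ _]leg_entry_gt// !(mulr0, mul0r).
by ring.
Qed.

(** The determinant of the limit of [secular] at a constant mu. *)
Definition limit_det (mu : R) : R := \prod_(i < n)
  (if (i < k)%N then - kappan i else if i == k then mu / d k ^+ 2 - kappan k else mu / d i ^+ 2).

Lemma secular_det_cst (m : R) : isO 1 (fun t => \det (secular m t) - limit_det m).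
Proof.
have hm : isO 0 (fun=> m) by exact: isO_cst.
have h1 := det_diag_isO (fun i => secular_diag_bounded i hm) (fun i j => secular_off hm (i := i) (j := j)).
have h2 : isO 1 (fun t => \prod_i secular m t i i - limit_det m).
  apply: isO_prodB => i _; [exact: (secular_diag_bounded i hm)|exact: isO_cst|].
  have [ik|] := ltnP i k.
    by apply: (isO_eq (secular_diag hm ik)) => t; rewrite opprK.
  rewrite leq_eqVlt (inj_eq val_inj); case/predU1P => [<-|ki].
    rewrite eqxx.
    apply: (isO_eq (isOB (isO_le (leqnSn 1) (secular_diag_eq hm)) (isOZ (kappan k * first_coef k) (isOX 1)))) => t.
    by rewrite expr1; ring.
  rewrite -(inj_eq val_inj) /= gtn_eqF//; exact: (secular_diag_gt hm ki).
by apply: (isO_eq (isOD (isO_le (leqnSn 1) h1) h2)) => t; rewrite addrA subrK.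
Qed.

(** Between half and twice the root kappa k d k^2 only the k-th factor changes
    sign. *)
Lemma limit_det_sign : limit_det (kappan k * d k ^+ 2 / 2) * limit_det (kappan k * d k ^+ 2 * 2) < 0.
Proof.
rewrite /limit_det -big_split/= (bigD1 k)//= ltnn eqxx.
have dk := lt0r_neq0 (d0 k); have kk := kappan_gt0 (R := R) k.
rewrite pmulr_llt0; last first.
  apply: prodr_gt0 => i ik; case: ltnP => _; first by rewrite mulrNN mulr_gt0// kappan_gt0.
  by rewrite (negbTE ik) mulr_gt0 ?divr_gt0 ?mulr_gt0 ?exprn_gt0.
have -> : (kappan k * d k ^+ 2 / 2 / d k ^+ 2 - kappan k) * (kappan k * d k ^+ 2 * 2 / d k ^+ 2 - kappan k) = - (kappan k ^+ 2 / 2) :> R.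
  by field.
by rewrite oppr_lt0 divr_gt0 ?exprn_gt0.
Qed.

(** So there is an eigenvalue of order t^(2k+1) between the two values. *)
Lemma secular_sign : \forall t \near (0:R)^'+,
  \det ((kappan k * d k ^+ 2 / 2 * t ^+ (k.*2).+1)%:M - gram_mx t) *
  \det ((kappan k * d k ^+ 2 * 2 * t ^+ (k.*2).+1)%:M - gram_mx t) < 0.
Proof.
set m1 := _ / 2; set m2 := _ * 2.
have h : isO 1 (fun t => - (\det (secular m1 t) * \det (secular m2 t)) - - (limit_det m1 * limit_det m2)).
  have h1 := secular_det_cst m1; have h2 := secular_det_cst m2.
  have e1 := isOM h1 (isO_bounded h2); have e2 := isOM (isO_cst (limit_det m1)) h2.
  by apply: (isO_eq (isON (isOD e1 e2))) => t; ring.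
have s : 0 < - (limit_det m1 * limit_det m2) by rewrite oppr_gt0 limit_det_sign.
apply: filterS2 (isO_pos s h) near0_pos => t; rewrite oppr_gt0 => ht t0.
have [c1 c10 E1] := secular_det m1 t0; have [c2 c20 E2] := secular_det m2 t0.
by move: ht; rewrite E1 E2 mulrACA pmulr_rlt0// mulr_gt0.
Qed.

End secular.
End Spectral.

(** * The asymptotics *)
Section Eigen.
Context {R : realType} {n : nat}.
Implicit Types G : 'M[R]_n.

Lemma horner_char_poly G (x : R) : (char_poly G).[x] = \det (x%:M - G).
Proof.
rewrite /char_poly -horner_evalE -det_map_mx; congr (\det _).
apply/matrixP => i j; rewrite !mxE /= horner_evalE hornerD hornerN hornerC hornerMn hornerX //.
Qed.

(** The intermediate value theorem for the characteristic polynomial. *)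
Lemma det_sub_root G (a b : R) : a <= b -> \det (a%:M - G) * \det (b%:M - G) < 0 ->
  exists x, a <= x <= b /\ \det (x%:M - G) = 0.
Proof.
move=> ab; rewrite -!horner_char_poly => h.
wlog: / exists p : {poly R}, [/\ forall x, root p x -> root (char_poly G) x & p.[a] <= 0 <= p.[b]].
  apply; have [a0|a0] := leP (char_poly G).[a] 0.
    exists (char_poly G); split => //; rewrite a0 /=.
    have a1 : (char_poly G).[a] < 0 by rewrite lt_def a0 andbT; apply: contraTneq h => <-; rewrite mul0r ltxx.
    by move: h; rewrite nmulr_rlt0// => /ltW.
  exists (- char_poly G); split; first by move=> x; rewrite rootN.
  by rewrite !hornerN oppr_le0 (ltW a0) oppr_ge0; move: h; rewrite pmulr_rlt0// => /ltW.
move=> [p [pr hp]]; have [x xab /pr rx] := poly_ivt ab hp.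
by exists x; split => //; rewrite -horner_char_poly; apply/eqP.
Qed.

(** The characteristic polynomial has degree n, so these are all its roots,
    with multiplicity one; a sorted list is determined by its elements. *)
Lemma eigenvalues_unique G (f : 'I_n -> R) :
  (forall i j : 'I_n, (i < j)%N -> f j < f i) -> (forall i, \det ((f i)%:M - G) = 0) ->
  forall i : 'I_n, (eigenvalues G)`_i = f i.
Proof.
move=> dec rt; pose s := [seq f i | i <- enum 'I_n].
have ss : size s = n by rewrite size_map size_enum_ord.
have sn (i : 'I_n) : s`_i = f i by rewrite (nth_map i) ?size_enum_ord// nth_ord_enum.
have fi : injective f.
  move=> i j fij; apply/eqP; case: (ltngtP i j) => [/dec|/dec|/val_inj->//]; by rewrite fij ltxx.
have tr : transitive (fun x y : R => y <= x) by move=> x y z yx xz; exact: le_trans xz yx.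
have srt : sorted (fun x y : R => y <= x) s.
  apply/(sortedP 0) => i; rewrite ss => i1.
  by have := dec (Ordinal (ltnW i1)) (Ordinal i1) (ltnSn i); rewrite -!sn => /ltW.
have pr : char_poly G = \prod_(x <- s) ('X - x%:P).
  have := @all_roots_prod_XsubC R (char_poly G) s.
  rewrite (monicP (char_poly_monic G)) scale1r; apply.
  - by rewrite size_char_poly ss.
  - by apply/allP => x /mapP[i _ ->]; rewrite /root horner_char_poly rt.
  - by rewrite uniq_rootsE map_inj_uniq// enum_uniq.
have [srt' pr'] := xgetPex [::] (ex_intro (fun s : seq R => sorted (fun x y => y <= x) s /\
    char_poly G = \prod_(x <- s) ('X - x%:P)) s (conj srt pr)).
move=> i; rewrite -sn; congr (nth 0 _ i); rewrite /eigenvalues.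
apply: (sorted_eq tr _ srt' srt); first by move=> x y /andP[h1 h2]; apply/le_anti; rewrite h1 h2.
by apply: prod_XsubC_eq; rewrite -pr' -pr.
Qed.

End Eigen.

Section SqrtAsymp.
Context {R : realType}.
Implicit Types f : R -> R.

Lemma isO_bigO m f : isO m f -> f =O_ ((0:R)^'+) (fun t : R => t ^+ m).
Proof.
move=> [C hC]; apply/eqO_exP; exists (`|C| + 1); first by rewrite ltr_wpDl.
apply: filterS2 hC near0_pos => t h t0; apply: (le_trans h).
have tm : 0 <= t ^+ m by rewrite exprn_ge0// ltW.
by rewrite (ger0_norm tm) ler_wpM2r// (le_trans (ler_norm C))// lerDl.
Qed.

Lemma sqrt_isO m (f : R -> R) (c : R) : 0 < c -> isO m.+1 (fun t => f t - c) ->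
  isO m.+1 (fun t => Num.sqrt (f t) / Num.sqrt c - 1).
Proof.
move=> c0 h; have [C hC] := h; exists (C / c).
have sc : 0 < Num.sqrt c by rewrite sqrtr_gt0.
have scE : Num.sqrt c ^+ 2 = c by rewrite sqr_sqrtr// ltW.
apply: filterS2 hC (isO_pos c0 h) => t ht f0.
have sfE : Num.sqrt (f t) ^+ 2 = f t by rewrite sqr_sqrtr// ltW.
have sf : 0 < Num.sqrt (f t) by rewrite sqrtr_gt0.
have -> : Num.sqrt (f t) / Num.sqrt c - 1 = (f t - c) / (Num.sqrt c * (Num.sqrt (f t) + Num.sqrt c)).
  rewrite -{2}sfE -{2}scE; field; rewrite !lt0r_neq0 ?addr_gt0//.
have p0 : 0 < Num.sqrt c * (Num.sqrt (f t) + Num.sqrt c) by rewrite mulr_gt0 ?addr_gt0.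
rewrite normrM normfV (gtr0_norm p0) mulrAC; apply: ler_pM => //; rewrite ?invr_ge0 ?(ltW p0)//.
rewrite lef_pV2 ?posrE// -[leLHS]scE expr2 ler_wpM2l ?(ltW sc)// lerDr ltW//.
Qed.

(** The square of the left-hand term is m0 / mu = 1 - a t + O(t^2), which
    agrees with (1 - a t / 2)^2; divide the difference of squares by the sum
    of the roots. *)
Lemma rsqrt_isO (mu : R -> R) (m0 a : R) : 0 < m0 ->
  isO 2 (fun t => mu t - m0 * (1 + a * t)) ->
  isO 2 (fun t => Num.sqrt m0 * Num.sqrt (mu t)^-1 - (1 - a / 2 * t)).
Proof.
move=> m00 h.
have h1 : isO 1 (fun t => mu t - m0).
  apply: (isO_eq (isOD (isO_le (leqnSn 1) h) (isOZ (m0 * a) (isOX 1)))) => t.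
  by rewrite expr1; ring.
have bi : isO 0 (fun t => (mu t)^-1) := isO_bounded (isO_inv (lt0r_neq0 m00) h1).
have hw : isO 2 (fun t => m0 * (mu t)^-1 - (1 - a * t)).
  have e1 := isOM (isOB (isOZ (m0 * a ^+ 2) (isOX 2)) (isOM (isOD (isO_cst 1) (isO_le (leq0n 1) (isOZ (- a) (isOX 1)))) h)) bi.
  rewrite addn0 in e1; apply: (isO_near e1).
  apply: filterS (isO_pos m00 h1) => t mt /=; rewrite expr1.
  by field; exact: lt0r_neq0.
(* The square of 1 - a t / 2 differs from 1 - a t by a^2 t^2 / 4. *)
have hz : isO 2 (fun t => (m0 * (mu t)^-1 - (1 - a / 2 * t) ^+ 2)).
  apply: (isO_eq (isOB hw (isOZ (a ^+ 2 / 4) (isOX 2)))) => t; move: (m0 / mu t) => u; by field.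
have lw : bounded_away (fun t => Num.sqrt m0 * Num.sqrt (mu t)^-1 + (1 - a / 2 * t)).
  exists (1 / 2) => //; have e0 : 0 < 1 / 2 :> R by [].
  apply: filterS (isO_small (isOZ (a / 2) (isOX 1)) e0) => t; rewrite expr1 => ht.
  rewrite (le_trans _ (ler_norm _))//.
  have : 0 <= Num.sqrt m0 * Num.sqrt (mu t)^-1 by rewrite mulr_ge0.
  by move: ht; rewrite ltr_norml => /andP[h2 h3] h4; lra.
apply: (isO_div_bounded_away lw); apply: (isO_near hz).
apply: filterS (isO_pos m00 h1) => t mt.
have -> : m0 * (mu t)^-1 = (Num.sqrt m0 * Num.sqrt (mu t)^-1) ^+ 2.
  by rewrite exprMn !sqr_sqrtr// ?invr_ge0 ltW.
by ring.
Qed.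

Lemma expR_isO (c : R) : isO 2 (fun t => expR (- (t * c)) - (1 - c * t)).
Proof.
exists (c ^+ 2 * expR `|c|); apply: filterS2 near0_pos near0_le1 => t t0 t1.
have -> : 1 - c * t = 1 + - (t * c) by ring.
apply: (le_trans (expR_trunc2 _)); rewrite sqrrN normrN exprMn.
rewrite (_ : c ^+ 2 * expR `|c| * t ^+ 2 = t ^+ 2 * c ^+ 2 * expR `|c|); last by ring.
apply: ler_wpM2l; first by rewrite mulr_ge0 ?sqr_ge0.
by rewrite ler_expR normrM ger0_norm ?(ltW t0)// ler_piMl.
Qed.

Lemma powR_half (k : nat) (t : R) : 0 < t ->
  t `^ (- k.+1%:R + 2^-1) = Num.sqrt ((t ^+ (k.*2).+1)^-1).
Proof.
move=> t0; have t1 := lt0r_neq0 t0; rewrite /powR (negbTE t1).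
set y := _ * ln t.
have -> : (t ^+ (k.*2).+1)^-1 = expR y ^+ 2.
  have -> : t ^+ (k.*2).+1 = expR ((k.*2).+1%:R * ln t) by rewrite expRM_natl lnK.
  rewrite -expRN expr2 -expRD; congr expR; rewrite /y.
  rewrite -!natr1 -mul2n natrM; by field.
by rewrite sqrtr_sqr ger0_norm// expR_ge0.
Qed.

End SqrtAsymp.

Section Asymptotics.
Context {R : realType} {n : nat} (A : 'M[R]_n.+1) (b : 'cV[R]_n.+1).
Hypothesis kal : kalman A b.
Local Notation q := (krylov_vec A b).
Local Notation d := (krylov_d A b).
Local Notation G := (gramian A b).
Local Notation Q := (krylov_mx A b).

(** The Gramian as a matrix in the orthonormal Krylov basis; it has the same
    eigenvalues. *)
Definition gram_mx t : 'M[R]_n.+1 := \matrix_(i, j) krylov_gram A b i j t.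

Lemma gram_mxE t : gram_mx t = Q^T *m G t *m Q.
Proof.
apply/matrixP => i j; rewrite mxE /krylov_gram /dotp mulmxA mxE [RHS]mxE; apply: eq_bigr => l _.
rewrite [Q l j]mxE; congr (_ * _); rewrite mxE [RHS]mxE; apply: eq_bigr => m _; by rewrite !mxE.
Qed.

Let QTQ : Q^T *m Q = 1%:M := krylov_mxTK kal.
Let QQT : Q *m Q^T = 1%:M := mulmx1C QTQ.

Lemma det_sub_gram_mx (x t : R) : \det (x%:M - gram_mx t) = \det (x%:M - G t).
Proof.
have -> : x%:M - gram_mx t = Q^T *m (x%:M - G t) *m Q.
  by rewrite gram_mxE mulmxBr mulmxBl mul_mx_scalar -scalemxAl QTQ scalemx1.
by rewrite !det_mulmx mulrAC -det_mulmx QTQ det1 mul1r.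
Qed.

Let d0 := krylov_d_gt0 kal.

Lemma gram_mx_expand (i j : 'I_n.+1) : isO (i + j).+3 (fun t => gram_mx t i j -
  d i * d j * t ^+ (i + j).+1 * (frakH i j + t * (i`!%:R^-1 * j`!%:R^-1 *
    (krylov_trace A b i / i.+1%:R + krylov_trace A b j / j.+1%:R) / (i + j).+2%:R))).
Proof. by apply: (isO_eq (krylov_gram_expand kal i j)) => t; rewrite [gram_mx _ _ _]mxE. Qed.

Lemma first_coefE (k : 'I_n.+1) : first_coef (krylov_trace A b) k = krylov_a A b k.
Proof. exact: krylov_trace_step. Qed.

(** Converges to kappa k d k^2. *)
Definition scaled_eig t (k : 'I_n.+1) : R := (eigenvalues (G t))`_k / t ^+ (k.*2).+1.

Let m0 (k : 'I_n.+1) := kappan k * d k ^+ 2.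

Let m00 k : 0 < m0 k.
Proof. by rewrite mulr_gt0 ?kappan_gt0 ?exprn_gt0. Qed.

(** For small t the n intervals of [secular_sign] are disjoint because their
    orders t^(2k+1) differ. Each contains an eigenvalue, so these are all of
    them, in decreasing order. *)
Lemma scaled_eig_near : \forall t \near (0:R)^'+, forall k,
  m0 k / 2 <= scaled_eig t k <= m0 k * 2 /\ \det ((scaled_eig t k * t ^+ (k.*2).+1)%:M - G t) = 0.
Proof.
have S1 : \forall t \near (0:R)^'+, forall k : 'I_n.+1,
   \det ((m0 k / 2 * t ^+ (k.*2).+1)%:M - gram_mx t) * \det ((m0 k * 2 * t ^+ (k.*2).+1)%:M - gram_mx t) < 0.
  by apply: filter_forall => k; exact: (secular_sign d0 gram_mx_expand k).
have S2 : \forall t \near (0:R)^'+, forall ij : 'I_n.+1 * 'I_n.+1,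
   m0 ij.2 * 2 * t ^+ 2 < m0 ij.1 / 2.
  apply: filter_forall => -[i j] /=.
  have e0 : 0 < m0 i / 2 by rewrite divr_gt0.
  by apply: filterS (isO_small (isOZ (m0 j * 2) (isOX 2)) e0) => t; apply: le_lt_trans; exact: ler_norm.
apply: filterS3 S1 S2 (filterI near0_pos near0_le1) => t s1 s2 [t0 t1].
have tk m : 0 < t ^+ m by rewrite exprn_gt0.
have [f hf] : {f : 'I_n.+1 -> R & forall k : 'I_n.+1, m0 k / 2 * t ^+ (k.*2).+1 <= f k <= m0 k * 2 * t ^+ (k.*2).+1 /\
    \det ((f k)%:M - G t) = 0}.
  have hex (k : 'I_n.+1) : exists x, m0 k / 2 * t ^+ (k.*2).+1 <= x <= m0 k * 2 * t ^+ (k.*2).+1 /\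
      \det (x%:M - G t) = 0.
    apply: det_sub_root; last by rewrite -!det_sub_gram_mx.
    rewrite ler_pM2r//; have := m00 k; lra.
  exact: (choice hex).
have ev := @eigenvalues_unique _ _ (G t) f _ (fun i => (hf i).2).
have {}ev (k : 'I_n.+1) : scaled_eig t k * t ^+ (k.*2).+1 = f k.
  rewrite /scaled_eig ev ?mulfVK ?lt0r_neq0// => i j ij.
  have [/andP[h1 _] _] := hf i; have [/andP[_ h2] _] := hf j.
  apply: (le_lt_trans h2); apply: lt_le_trans h1.
  apply: (@le_lt_trans _ _ (m0 j * 2 * t ^+ 2 * t ^+ (i.*2).+1)).
    have mj : 0 <= m0 j * 2 by apply: mulr_ge0 => //; exact: ltW.
    rewrite -[leRHS]mulrA -exprD; apply: ler_wpM2l => //.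
    by apply: ler_wiXn2l => //; [exact: ltW|lia].
  by rewrite ltr_pM2r//; exact: (s2 (i, j)).
move=> k; rewrite ev; have [/andP[h1 h2] h3] := hf k; split => //.
rewrite -(ler_pM2r (tk (k.*2).+1)) -[X in _ && X](ler_pM2r (tk (k.*2).+1)) ev.
by rewrite h1 h2.
Qed.

Lemma scaled_eig_bounded k : isO 0 (fun t => scaled_eig t k).
Proof.
exists (m0 k * 2); apply: filterS scaled_eig_near => t /(_ k)[/andP[h1 h2] _].
rewrite expr0 mulr1 ger0_norm// (le_trans _ h1)// divr_ge0// ltW//.
Qed.

Lemma scaled_eig_bounded_below k : \forall t \near (0:R)^'+, m0 k / 2 <= scaled_eig t k.
Proof. by apply: filterS scaled_eig_near => t /(_ k)[/andP[]]. Qed.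

Let mh k : 0 < m0 k / 2. Proof. by rewrite divr_gt0. Qed.

Lemma scaled_eig_isO k : isO 2 (fun t => scaled_eig t k - m0 k * (1 + krylov_a A b k * t)).
Proof.
rewrite -first_coefE; apply: (secular_root d0 gram_mx_expand (scaled_eig_bounded k) (mh k) (scaled_eig_bounded_below k)).
apply: filterS2 scaled_eig_near near0_pos => t /(_ k)[_ h] t0.
have [c c0 ->] := @secular_det _ _ d gram_mx d0 k (scaled_eig t k) t t0.
by rewrite det_sub_gram_mx h mulr0.
Qed.

(** An eigenvector exists, and by [secular_component] it is not orthogonal to
    q k, so it can be normalized and oriented. *)
Lemma principal_near k : \forall t \near (0:R)^'+,
  enorm (principal_direction A b t k) = 1 /\
  G t *m principal_direction A b t k = (scaled_eig t k * t ^+ (k.*2).+1) *: principal_direction A b t k.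
Proof.
have comp := secular_component d0 gram_mx_expand k (scaled_eig_bounded k) (mh k) (scaled_eig_bounded_below k).
apply: filterS3 scaled_eig_near comp near0_pos => t /(_ k)[_ h] hc t0.
have ee : scaled_eig t k * t ^+ (k.*2).+1 = (eigenvalues (G t))`_k.
  by rewrite /scaled_eig mulfVK// lt0r_neq0// exprn_gt0.
have [GT _] := gramian_spd kal t0.
suff ex : exists v, [/\ enorm v = 1, G t *m v = (eigenvalues (G t))`_k *: v & 0 < dotp v (q k)].
  by have [h1 h2 _] := xgetPex 0 ex; split => //; rewrite ee; exact: h2.
move/eqP/det0P: h => [w w0 hw].
pose x := w^T.
have x0 : x != 0 by rewrite -trmx0 (inj_eq trmx_inj).
have Gx : G t *m x = (scaled_eig t k * t ^+ (k.*2).+1) *: x.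
  move: hw; rewrite mulmxBr mul_mx_scalar => /eqP; rewrite subr_eq0 => /eqP hw.
  by rewrite -[G t]GT -trmx_mul -hw linearZ.
have yk : dotp x (q k) != 0.
  apply: contra_neq x0 => xk; pose y := Q^T *m x.
  have xy : x = Q *m y by rewrite mulmxA QQT mul1mx.
  rewrite xy (hc y) ?mulmx0//.
    by rewrite gram_mxE /y !mulmxA -(mulmxA _ Q) QQT mulmx1 -mulmxA Gx -scalemxAr.
  rewrite -xk dotpC dotpE mxE; apply: eq_bigr => l _; by rewrite !mxE.
have xx := dotp_gt0 x0.
have sx : 0 < Num.sqrt (dotp x x) by rewrite sqrtr_gt0.
pose c := Num.sg (dotp x (q k)) / Num.sqrt (dotp x x).
exists (c *: x); split.
- rewrite /enorm dotpZl dotpZr mulrA -expr2 /c exprMn exprVn sqr_sqrtr ?(ltW xx)//.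
  by rewrite sqr_sg yk mul1r mulVf ?sqrtr1// lt0r_neq0.
- by rewrite -ee -scalemxAr Gx !scalerA mulrC.
- by rewrite dotpZl /c mulrAC -normrEsg divr_gt0// normr_gt0.
Qed.

Lemma invmx_eigen t (v : 'cV[R]_n.+1) (lam : R) : 0 < t -> lam != 0 -> G t *m v = lam *: v -> invmx (G t) *m v = lam^-1 *: v.
Proof.
move=> t0 l0 h; have uG := spd_unit (gramian_spd kal t0).
have : invmx (G t) *m (G t *m v) = v by rewrite mulKmx.
by rewrite h -scalemxAr => /(congr1 (fun z => lam^-1 *: z)); rewrite scalerA mulVf// scale1r.
Qed.

(** On the eigenvector the quadratic form of the inverse Gramian is the
    inverse eigenvalue, expanded by [scaled_eig_isO]. *)
Lemma opnorm_principal k : exists2 e : R -> R,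
  isO 2 e & \forall t \near (0:R)^'+,
    L2opnorm (grad_fokker_planck A b t (principal_direction A b t k)) =
          (expR (- 2^-1) / (Num.sqrt (kappa k) * d k)
           * t `^ (- k.+1%:R + 2^-1)
           * (1 - (krylov_a A b k + \tr A) / 2 * t + e t))%:E.
Proof.
pose g t := Num.sqrt (m0 k) * Num.sqrt (scaled_eig t k)^-1.
pose x t := expR (- (t * (\tr A / 2))).
exists (fun t => x t * g t - (1 - (krylov_a A b k + \tr A) / 2 * t)).
  have hg : isO 2 (fun t => g t - (1 - krylov_a A b k / 2 * t)) := rsqrt_isO (m00 k) (scaled_eig_isO k).
  have hx : isO 2 (fun t => x t - (1 - \tr A / 2 * t)) := expR_isO (\tr A / 2).
  have bx : isO 0 (fun t => 1 - \tr A / 2 * t).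
    apply: (isO_eq (isOB (isO_cst 1) (isO_le (leq0n 1) (isOZ (\tr A / 2) (isOX 1))))) => t.
    by rewrite expr1.
  have bg : isO 0 g.
    apply: (isO_eq (isOD (isO_le (leq0n 2) hg) (isOB (isO_cst 1) (isO_le (leq0n 1) (isOZ (krylov_a A b k / 2) (isOX 1)))))) => t.
    by rewrite expr1 subrK.
  have e1 := isOM hx bg; have e2 := isOM bx hg; have e3 := isOZ (\tr A / 2 * (krylov_a A b k / 2)) (isOX 2).
  rewrite addn0 in e1; rewrite add0n in e2.
  by apply: (isO_eq (isOD (isOD e1 e2) e3)) => t; field.
apply: filterS3 (principal_near k) near0_pos (scaled_eig_bounded_below k) => t [v1 Gv] t0 mt.
have mu0 : 0 < scaled_eig t k by apply: lt_le_trans mt.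
have tk : 0 < t ^+ (k.*2).+1 by rewrite exprn_gt0.
have [_ ->] := grad_fokker_planck_opnorm kal v1 t0.
have l0 : scaled_eig t k * t ^+ (k.*2).+1 != 0 by rewrite mulf_neq0 ?lt0r_neq0.
rewrite (invmx_eigen t0 l0 Gv) dotpZr enorm1_dotp// mulr1.
rewrite invfM sqrtrM ?invr_ge0 ?(ltW mu0)// powR_half//.
rewrite addrC subrK; congr (_%:E); rewrite /x /g.
have -> : t * \tr A / 2 = t * (\tr A / 2) by rewrite mulrA.
have sd : Num.sqrt (m0 k) = Num.sqrt (kappa k) * d k.
  by rewrite kappaE /m0 sqrtrM ?(ltW (kappan_gt0 _))// sqrtr_sqr ger0_norm// ltW.
rewrite sd; have sk : Num.sqrt (kappa k) * d k != 0.
  by rewrite -sd lt0r_neq0// sqrtr_gt0.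
move: sk; rewrite mulf_eq0 negb_or => /andP[].
have aux (u v w y z p : R) : u != 0 -> v != 0 -> p * z * (w * y) = p / (u * v) * y * (z * (u * v * w)).
  by move=> u0 v0; field; rewrite u0 v0.
exact: aux.
Qed.

Lemma frakH_inv_gt0 (k : 'I_n.+1) : 0 < (invmx frakH : 'M[R]_n.+1) k k.
Proof.
rewrite frakH_inv_diag divr_gt0// ltr0n ?expn_gt0 ?fact_gt0// !muln_gt0 /= ?expn_gt0 ?fact_gt0//.
Qed.

Local Notation Hs := (rescaled d gram_mx).

(** Cramer's rule: the entry is a quotient of determinants, which depend
    polynomially on the entries. *)
Lemma rescaled_inv_isO k : isO 1 (fun t => (invmx (Hs t)) k k - (invmx frakH : 'M[R]_n.+1) k k) /\
  \forall t \near (0:R)^'+, Hs t \in unitmx.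
Proof.
have h1 i j : isO 1 (fun t => Hs t i j - (frakH : 'M[R]_n.+1) i j).
  have e := isOD (isO_le (leqnSn 1) (rescaled_expand d0 gram_mx_expand i j))
    (isOZ (i`!%:R^-1 * j`!%:R^-1 * (krylov_trace A b i / i.+1%:R + krylov_trace A b j / j.+1%:R) / (i + j).+2%:R) (isOX 1)).
  by apply: (isO_eq e) => t; rewrite expr1; ring.
have b1 i j : isO 0 (fun t => Hs t i j) := isO_bounded (h1 i j).
have hd : isO 1 (fun t => \det (Hs t) - \det (frakH : 'M[R]_n.+1)).
  by apply: (det_isO (N := fun=> frakH)) => // i j; exact: isO_cst.
have hc : isO 1 (fun t => cofactor (Hs t) k k - cofactor (frakH : 'M[R]_n.+1) k k).
  apply: (isO_eq (isOZ ((-1) ^+ (k + k)) (det_isO (M := fun t => row' k (col' k (Hs t))) (N := fun=> row' k (col' k frakH)) (m := 1) _ _ _))) => [i j|i j|i j|t].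
  - by apply: (isO_eq (b1 (lift k i) (lift k j))) => t; rewrite [RHS]mxE [RHS]mxE.
  - exact: isO_cst.
  - by apply: (isO_eq (h1 (lift k i) (lift k j))) => t; rewrite [row' _ _ i j]mxE [col' _ _ _ j]mxE [row' _ _ i j]mxE [col' _ _ _ j]mxE.
  - by rewrite /cofactor mulrBr.
have uH := frakH_unit (R := R) n.+1.
have dH : \det (frakH : 'M[R]_n.+1) != 0 by rewrite -unitfE -unitmxE.
have lowd : bounded_away (fun t => \det (Hs t)) := bounded_away_isO (bounded_away_cst dH) hd.
have hu : \forall t \near (0:R)^'+, Hs t \in unitmx.
  by apply: filterS (bounded_away_neq0 lowd) => t; rewrite unitmxE unitfE.
split => //.
have hi := isO_inv dH hd.
have iE (M : 'M[R]_n.+1) : M \in unitmx -> invmx M k k = (\det M)^-1 * cofactor M k k.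
  by move=> uM; rewrite /invmx uM !mxE.
have e1 := isOM hi (isO_bounded hc); have e2 := isOM (isO_cst (\det (frakH : 'M[R]_n.+1))^-1) hc.
apply: (isO_near (isOD e1 e2)); apply: filterS hu => t ut.
by rewrite !iE//; ring.
Qed.

(** Undo the rescaling: the grading is diagonal in the Krylov basis, so only
    the k-th weight enters. *)
Lemma krylov_inv t k : 0 < t -> Hs t \in unitmx ->
  dotp (q k) (invmx (G t) *m q k) = (d k ^+ 2)^-1 * (t ^+ (k.*2).+1)^-1 * invmx (Hs t) k k.
Proof.
move=> t0 uH; have uG := spd_unit (gramian_spd kal t0).
pose D : 'M[R]_n.+1 := diag_mx (\row_i (d i * t ^+ i)).
have uD : D \in unitmx.
  rewrite unitmxE det_diag unitfE; apply/prodf_neq0 => i _.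
  by rewrite mxE mulf_neq0 ?lt0r_neq0 ?exprn_gt0.
have GD : gram_mx t = t *: (D *m Hs t *m D).
  apply/matrixP => i j; rewrite [RHS]mxE mul_mx_diag [X in _ = _ * X]mxE mul_diag_mx [X in _ = _ * (X * _)]mxE.
  rewrite [rescaled _ _ _ _ _]mxE [X in _ * (X * _ * _)]mxE [X in _ = _ * (_ * X)]mxE exprS exprD.
  have a1 := lt0r_neq0 t0; have a2 : t ^+ i != 0 by rewrite expf_neq0.
  have a3 : t ^+ j != 0 by rewrite expf_neq0.
  have a4 := lt0r_neq0 (d0 i); have a5 := lt0r_neq0 (d0 j).
  move: a2 a3 a4 a5; move: (t ^+ i) (t ^+ j) (d i) (d j) (gram_mx t i j) => u v x y z u0 v0 x0 y0.
  by field; rewrite a1 u0 v0 x0 y0.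
have uQ : Q \in unitmx by apply: (mulmx1_unit QQT).1.
have uQT : Q^T \in unitmx by rewrite unitmx_tr.
have uGam : gram_mx t \in unitmx by rewrite gram_mxE !unitmx_mul uQ uQT uG.
have GI : invmx (G t) = Q *m invmx (gram_mx t) *m Q^T.
  apply: (can_inj (mulKmx uG)); rewrite mulmxV//.
  have -> : G t = Q *m gram_mx t *m Q^T by rewrite gram_mxE !mulmxA QQT mul1mx -mulmxA QQT mulmx1.
  rewrite !mulmxA -(mulmxA (Q *m gram_mx t)) QTQ mulmx1 -(mulmxA Q) mulmxV// mulmx1 //.
have GamI : invmx (gram_mx t) = t^-1 *: (invmx D *m invmx (Hs t) *m invmx D).
  apply: (can_inj (mulKmx uGam)); rewrite mulmxV// GD -scalemxAl -scalemxAr scalerA mulfV ?lt0r_neq0// scale1r.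
  rewrite !mulmxA mulmxK// -(mulmxA D) mulmxV// mulmx1 mulmxV//.
have qE : q k = col k Q by apply/matrixP => i j; rewrite ord1 !mxE.
have QTq : Q^T *m q k = delta_mx k 0.
  apply/matrixP => i j; rewrite ord1 mxE [RHS]mxE andbT -(krylov_orthonormal kal) dotpE.
  by apply: eq_bigr => l _; rewrite !mxE.
have DI : invmx D = diag_mx (\row_i (d i * t ^+ i)^-1).
  apply: (can_inj (mulKmx uD)); rewrite mulmxV// /D mulmx_diag.
  by apply/matrixP => i j; rewrite !mxE mulfV// mulf_neq0 ?lt0r_neq0 ?exprn_gt0.
rewrite GI -!mulmxA QTq -{1}[Q]trmxK -dotp_mull QTq.
have -> : dotp (delta_mx k 0) (invmx (gram_mx t) *m delta_mx k 0) = invmx (gram_mx t) k k.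
  by rewrite dotp_delta -colE mxE.
rewrite GamI [LHS]mxE DI mul_mx_diag [X in _ * X]mxE mul_diag_mx [X in _ * (X * _)]mxE.
rewrite [X in _ * (X * _ * _)]mxE [X in _ * (_ * X)]mxE.
have -> : t ^+ (k.*2).+1 = t * (t ^+ k) ^+ 2 by rewrite exprS -exprM muln2.
have a1 := lt0r_neq0 t0; have a2 : t ^+ k != 0 by rewrite expf_neq0.
have a4 := lt0r_neq0 (d0 k).
move: a2 a4; move: (t ^+ k) (d k) (invmx (Hs t) k k) => u x z u0 x0.
by field; rewrite a1 u0 x0.
Qed.

Lemma opnorm_krylov (k : 'I_n.+1) : exists2 e : R -> R,
  isO 1 e & \forall t \near (0:R)^'+,
    L2opnorm (grad_fokker_planck A b t (q k)) =
          (expR (- 2^-1) * (Num.sqrt ((invmx frakH : 'M[R]_n.+1) k k) / d k)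
           * t `^ (- k.+1%:R + 2^-1) * (1 + e t))%:E.
Proof.
have [hH hu] := rescaled_inv_isO k.
set h0 := (invmx frakH : 'M[R]_n.+1) k k in hH *.
have h00 : 0 < h0 := frakH_inv_gt0 k.
pose g t := Num.sqrt (invmx (Hs t) k k) / Num.sqrt h0.
pose x t := expR (- (t * (\tr A / 2))).
exists (fun t => x t * g t - 1).
  have hg : isO 1 (fun t => g t - 1) := sqrt_isO h00 hH.
  have hx : isO 1 (fun t => x t - 1).
    apply: (isO_eq (isOB (isO_le (leqnSn 1) (expR_isO (\tr A / 2))) (isOZ (\tr A / 2) (isOX 1)))) => t.
    by rewrite expr1 /x; ring.
  have e1 := isOM hx (isO_bounded hg).
  by apply: (isO_eq (isOD e1 hg)) => t; ring.
apply: filterS2 hu near0_pos => t ut t0.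
have q1 : enorm (q k) = 1 by have [] := krylov_vecP kal k.
have [_ ->] := grad_fokker_planck_opnorm kal q1 t0.
have tk : 0 < t ^+ (k.*2).+1 by rewrite exprn_gt0.
rewrite krylov_inv// powR_half// addrC subrK; congr (_%:E); rewrite /x /g.
have -> : t * \tr A / 2 = t * (\tr A / 2) by rewrite mulrA.
rewrite sqrtrM ?mulr_ge0 ?invr_ge0 ?sqr_ge0 ?(ltW tk)// sqrtrM ?invr_ge0 ?sqr_ge0//.
rewrite -exprVn sqrtr_sqr ger0_norm ?invr_ge0 ?(ltW (d0 k))//.
have s0 : Num.sqrt h0 != 0 by rewrite lt0r_neq0// sqrtr_gt0.
have dk := lt0r_neq0 (d0 k).
have aux (u w y z p r : R) : u != 0 -> z != 0 -> p * r * (z^-1 * y * w) = p * (u / z) * y * (r * (w / u)).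
  by move=> u0 z0; field; rewrite u0 z0.
exact: aux.
Qed.

End Asymptotics.

Theorem corollary14 (R : realType) (n : nat) (A : 'M[R]_n) (b : 'cV[R]_n)
    (hAb : kalman A b) :
  [/\ (forall (q : 'cV[R]_n) (t : R), enorm q = 1 -> 0 < t ->
        (* (q . grad) S_t^* is a well-defined operator on L^2 *)
        (forall rho, rho \in L2 ->
          (forall x, derivable (fokker_planck A b t rho) x q) /\
          grad_fokker_planck A b t q rho \in L2) /\
        L2opnorm (grad_fokker_planck A b t q) =
          (expR (- 2^-1) * expR (- (t * \tr A / 2))
           * Num.sqrt (dotp q (invmx (gramian A b t) *m q)))%:E),
      (forall k : 'I_n, exists2 e : R -> R,
        e =O_ (0^'+) (fun t : R => t ^+ 2) &
        \forall t \near 0^'+,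
          L2opnorm (grad_fokker_planck A b t (principal_direction A b t k)) =
          (expR (- 2^-1) / (Num.sqrt (kappa k) * krylov_d A b k)
           * t `^ (- k.+1%:R + 2^-1)
           * (1 - (krylov_a A b k + \tr A) / 2 * t + e t))%:E),
      (forall k : 'I_n, exists2 e : R -> R,
        e =O_ (0^'+) (fun t : R => t) &
        \forall t \near 0^'+,
          L2opnorm (grad_fokker_planck A b t (krylov_vec A b k)) =
          (expR (- 2^-1) * (Num.sqrt (invmx frakH k k) / krylov_d A b k)
           * t `^ (- k.+1%:R + 2^-1) * (1 + e t))%:E) &
      (forall k : 'I_n,
        (invmx frakH : 'M[R]_n) k k =
          ((n + k)`! ^ 2)%N%:R
          / (k.*2.+1 * (n - k.+1)`! ^ 2 * k`! ^ 2)%N%:R)].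
Proof.
case: n A b hAb => [|n] A b kal.
  split; try by case.
  move=> q t q1 t0; move: q1; rewrite /enorm /dotp mxE big_ord0 sqrtr0 => /eqP.
  by rewrite eq_sym oner_eq0.
split => [q t q1 t0|k|k|k].
- exact: grad_fokker_planck_opnorm.
- have [e he h] := opnorm_principal kal k.
  by exists e => //; exact: isO_bigO he.
- have [e he h] := opnorm_krylov kal k.
  by exists e => //; apply: (isO_bigO he).
- exact: frakH_inv_diag.
Qed.
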